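(* Let $V:S^1\to\mathbb{R}$ be of class $C^{k-1,1}(S^1)$ with $k\ge1$, let $\phi(\theta)=e^{-V(\theta)}$, and let $\pi_n$ be the monic degree-$n$ orthogonal polynomial with respect to $\phi$ on the unit circle. Then for each $\rho\in(0,1)$ there are constants $K_\rho^\pm>0$ such that for all sufficiently large $n$, \[ \sup_{\rho<|z|<1}\left|\pi_n(z)-z^ne^{-V_0-\overline{N(1/\overline{z})}}e^{E_kV(r,\theta)}\right|\le K_\rho^-\frac{\log(n)}{n^k}, \qquad \sup_{|z|<\rho}|\pi_n(z)|\le\frac{K_\rho^+}{n^k}, \] where $z=re^{i\theta}$.
   Context: $C^{k-1,1}(S^1)$: functions on the circle whose periodic extension has $k-1$ Lipschitz continuous derivatives. Orthogonality is with respect to $\langle f,g\rangle_\phi=\frac{1}{2\pi}\int_{-\pi}^{\pi}f(e^{i\theta})\overline{g(e^{i\theta})}\phi(\theta)d\theta$. $V_j=\frac{1}{2\pi}\int_{-\pi}^\pi V(\theta)e^{-ij\theta}d\theta$, $V_0$ is the mean of $V$, and $N(z)=\sum_{j\ge1}V_{-j}z^{-j}$ for $|z|\ge1$. For a $C^{m-1}$ function $f$ on $S^1$, the extension is $E_mf(r,\theta)=\sum_{p=0}^{m-1}\frac{f^{(p)}(\theta)}{p!}(-i\log r)^p$ for $r>0$. *)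

(* Defs.v *)
From Stdlib Require Import Reals Arith.
From Coquelicot Require Import Coquelicot.
Open Scope R_scope.

Definition Cexp (z : C) : C := (exp (Re z) * cos (Im z), exp (Re z) * sin (Im z)).

Definition eit (t : R) : C := Cexp (0, t).

Definition CRInt (f : R -> C) (a b : R) : C :=
  (RInt (fun t => Re (f t)) a b, RInt (fun t => Im (f t)) a b).

Definition CSeries (a : nat -> C) : C :=
  (Series (fun n => Re (a n)), Series (fun n => Im (a n))).

(* V : S^1 -> R represented as a 2pi-periodic function of theta;
   V in C^{k-1,1}(S^1): V has k-1 derivatives everywhere and the (k-1)-th
   derivative is Lipschitz. *)
Definition periodic2pi (V : R -> R) : Prop := forall t, V (t + 2 * PI) = V t.

Definition C_lip (k : nat) (V : R -> R) : Prop :=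
  (forall p x, (p <= k - 1)%nat -> ex_derive_n V p x) /\
  exists L : R, forall x y,
    Rabs (Derive_n V (k - 1) x - Derive_n V (k - 1) y) <= L * Rabs (x - y).

Definition polyC (c : nat -> C) (d : nat) (z : C) : C :=
  sum_n (fun j => (c j * z ^ j)%C) d.

Definition ip (phi : R -> R) (f g : C -> C) : C :=
  ((/ (2 * PI))%R : C) *
  CRInt (fun t => (f (eit t) * Cconj (g (eit t)) * (phi t : C))%C) (- PI) PI.

Definition monic_OP (phi : R -> R) (n : nat) (c : nat -> C) : Prop :=
  c n = 1%R /\
  forall (m : nat) (q : nat -> C), (m < n)%nat ->
    ip phi (polyC c n) (polyC q m) = 0%R.

Definition fourier (V : R -> R) (j : Z) : C :=
  ((/ (2 * PI))%R : C) *
  CRInt (fun t => ((V t : C) * eit (- IZR j * t))%C) (- PI) PI.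

Definition Nfun (V : R -> R) (w : C) : C :=
  CSeries (fun j => (fourier V (- Z.of_nat (S j)) * (/ w) ^ (S j))%C).

Definition Eext (m : nat) (f : R -> R) (r t : R) : C :=
  sum_n (fun p => ((Derive_n f p t / INR (Factorial.fact p))%R : C) *
                  (- (Ci * (ln r : C))) ^ p)%C (m - 1).

(* Main.v *)
Require Import Defs.
From Stdlib Require Import Reals Lra Lia ZArith.
From Coquelicot Require Import Coquelicot.
Open Scope R_scope.

(** Write [V = V_0 + V_+ + conj V_+] on the circle, with [V_+] the part of positive frequencies, and
    [F = exp (- V_+) = sum f_i z^i], [G = 1 / F = sum g_i z^i], so that [exp (- V) = e^(- V_0) |F|^2].

    Coefficients.  The function [y = pi_n - z^n conj G] is orthogonal to all polynomials of degree
    less than [n], so by minimality its norm is at most that of the tail of [conj G], which is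
    [O(n^-k)] because the Fourier coefficients of [V] satisfy a Sobolev bound of order [k].
    Moreover [y conj F] has no frequency [>= n] and [u = y |F|^2] has no frequency in [[0, n)].
    Multiplying [y conj F] successively by [F], [conj G] and [G], and controlling each time the leak
    of low frequencies into high ones by a Hankel operator (Hardy's inequality), one gets
    [sum_j |c_j - conj g_(n-j)| = O(n^-k)].  In [|z| < rho] the polynomial
    [p = sum_j conj g_(n-j) z^j] is itself [O(n^-k)].

    Extension.  Let [U = exp V].  Since [conj G = e^(- V_0) F U] on the circle, [e^(V_0) p(z)] equals
    [z^n F(z) sum_(j >= -n) U_j z^j] up to [O(n^-k)], by the same Hankel bound.  Comparing
    [sum_(j >= -n) U_j z^j] with the Taylor polynomial [E_k U] costs [r^-n log n / n^k], by Abel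
    summation: the partial sums of [(ij)^k U_j e^(ijt)] are [O(log n)] because the Dirichlet kernel
    has logarithmic [L^1] norm and [U^(k-1)] is Lipschitz.  Finally [E_k (exp V)] and [exp (E_k V)]
    agree to order [(log r)^k]. *)

(** * Finite sums *)

(** The obstacle is that [V^(k-1)] is merely Lipschitz, so that the coefficients are only controlled
    by [sum (j^k |V_j|)^2 < oo]. The tail of [G] beyond [n] is then [O(n^-k)] in [l^2], whereas
    Cauchy-Schwarz would give [O(n^(1/2-k))] in [l^1]. A sup bound on the disc asks for [l^1], and
    the half power must not be lost. This is what the Hankel operators are for: the matrix
    [alpha_(l+m+1)] maps [l^2] boundedly into [l^1] as soon as [sum (i alpha_i)^2] is finite, which
    [1 <= k] guarantees. Accordingly only the nonnegative frequencies of [y] are estimated in [l^1];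
    its negative frequencies consist of the tail of [z^n conj G] and stay in [l^2]. In the extension
    step the loss [r^-n] is exactly compensated by [|z^n|]. A [k]-th derivative is never formed:
    difference quotients of step [h] take its place, bounded by the Lipschitz constant uniformly in
    [h]. Limits, in [h] as well as in truncation orders, are taken by proving an inequality with an
    arbitrarily small slack. *)

(* Unlike in [sum_n], the upper bound is excluded. *)
Fixpoint rsum (a : nat -> R) (n : nat) : R :=
  match n with O => 0 | S m => rsum a m + a m end.

Fixpoint csum (a : nat -> C) (n : nat) : C :=
  match n with O => 0%R | S m => (csum a m + a m)%C end.

Lemma rsum_ext a b n : (forall i, (i < n)%nat -> a i = b i) -> rsum a n = rsum b n.
Proof.
  induction n as [|n IH]; intros H; simpl; auto.
  rewrite IH by (intros; apply H; lia). rewrite H by lia. reflexivity.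
Qed.

Lemma rsum_le a b n : (forall i, (i < n)%nat -> a i <= b i) -> rsum a n <= rsum b n.
Proof.
  induction n as [|n IH]; intros H; simpl; [lra|].
  apply Rplus_le_compat; [apply IH; intros; apply H; lia | apply H; lia].
Qed.

Lemma rsum_zero n : rsum (fun _ => 0) n = 0.
Proof. induction n; simpl; lra. Qed.

Lemma rsum_nonneg a n : (forall i, (i < n)%nat -> 0 <= a i) -> 0 <= rsum a n.
Proof. intros H. rewrite <- (rsum_zero n). now apply rsum_le. Qed.

Lemma rsum_plus a b n : rsum (fun i => a i + b i) n = rsum a n + rsum b n.
Proof. induction n; simpl; lra. Qed.

Lemma rsum_scal x a n : rsum (fun i => x * a i) n = x * rsum a n.
Proof. induction n as [|n IH]; simpl; [|rewrite IH]; ring. Qed.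

Lemma rsum_scal_r x a n : rsum (fun i => a i * x) n = rsum a n * x.
Proof. induction n as [|n IH]; simpl; [|rewrite IH]; ring. Qed.

Lemma rsum_const x n : rsum (fun _ => x) n = INR n * x.
Proof. induction n as [|n IH]; [simpl; ring|]. rewrite S_INR. simpl rsum. rewrite IH. ring. Qed.

Lemma rsum_add a n m : rsum a (n + m) = rsum a n + rsum (fun i => a (n + i)%nat) m.
Proof.
  induction m as [|m IH]; simpl.
  - rewrite Nat.add_0_r. ring.
  - rewrite Nat.add_succ_r. simpl. rewrite IH. ring.
Qed.

Lemma rsum_mono a n m : (forall i, 0 <= a i) -> (n <= m)%nat -> rsum a n <= rsum a m.
Proof.
  intros H Hnm. replace m with (n + (m - n))%nat by lia. rewrite rsum_add.
  assert (0 <= rsum (fun i => a (n + i)%nat) (m - n)) by (apply rsum_nonneg; auto). lra.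
Qed.

Lemma rsum_S_l a n : rsum a (S n) = a 0%nat + rsum (fun i => a (S i)) n.
Proof. change (S n) with (1 + n)%nat. rewrite rsum_add. simpl. ring. Qed.

Lemma rsum_swap (h : nat -> nat -> R) n m :
  rsum (fun i => rsum (h i) m) n = rsum (fun j => rsum (fun i => h i j) n) m.
Proof.
  induction n as [|n IH]; simpl.
  - now rewrite rsum_zero.
  - now rewrite IH, rsum_plus.
Qed.

Lemma rsum_term_le a n i : (forall i, 0 <= a i) -> (i < n)%nat -> a i <= rsum a n.
Proof.
  intros H Hi. apply Rle_trans with (rsum a (S i)).
  - simpl. pose proof (rsum_nonneg a i (fun j _ => H j)). lra.
  - apply rsum_mono; auto.
Qed.

Lemma rsum_rev a n : rsum (fun i => a (n - 1 - i)%nat) n = rsum a n.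
Proof.
  induction n as [|n IH]; auto.
  rewrite rsum_S_l. simpl rsum at 2.
  rewrite <- IH. replace (S n - 1 - 0)%nat with n by lia.
  rewrite Rplus_comm. f_equal. apply rsum_ext. intros i Hi. f_equal. lia.
Qed.

(** Both sides run over the triangle [i + l < n], by antidiagonals and by rows; truncated Cauchy
    products are reordered this way throughout. *)
Lemma rsum_triangle (h : nat -> nat -> R) n :
  rsum (fun j => rsum (fun i => h i (j - i)%nat) (S j)) n
  = rsum (fun i => rsum (h i) (n - i)) n.
Proof.
  induction n as [|n IH]; auto.
  cbn [rsum] in *. rewrite IH. replace (S n - n)%nat with 1%nat by lia.
  replace (n - n)%nat with 0%nat by lia. cbn [rsum].
  rewrite (rsum_ext (fun i => rsum (h i) (S n - i))
            (fun i => rsum (h i) (n - i) + h i (n - i)%nat)).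
  - rewrite rsum_plus. ring.
  - intros i Hi. replace (S n - i)%nat with (S (n - i)) by lia. reflexivity.
Qed.

Lemma rsum_cauchy_schwarz a b n :
  (rsum (fun i => a i * b i) n) ^ 2 <= rsum (fun i => a i ^ 2) n * rsum (fun i => b i ^ 2) n.
Proof.
  induction n as [|n IH]; cbn [rsum]; [simpl; lra|].
  set (s := rsum (fun i => a i * b i) n) in *.
  assert (HA : 0 <= rsum (fun i => a i ^ 2) n) by (apply rsum_nonneg; intros; apply pow2_ge_0).
  assert (HB : 0 <= rsum (fun i => b i ^ 2) n) by (apply rsum_nonneg; intros; apply pow2_ge_0).
  set (A := rsum (fun i => a i ^ 2) n) in *. set (B := rsum (fun i => b i ^ 2) n) in *.
  (* Compared after squaring: AM-GM bounds the square of the right side below by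
     [4 A B (a n * b n)^2], and [s ^ 2 <= A * B] is the induction hypothesis. *)
  assert (H : 2 * s * (a n * b n) <= A * b n ^ 2 + B * a n ^ 2).
  { apply Rle_trans with (Rabs (2 * s * (a n * b n))); [apply Rle_abs|].
    rewrite <- (Rabs_pos_eq (A * b n ^ 2 + B * a n ^ 2)).
    2:{ pose proof (pow2_ge_0 (a n)); pose proof (pow2_ge_0 (b n)); nra. }
    apply Rsqr_le_abs_0. unfold Rsqr.
    pose proof (pow2_ge_0 (A * b n ^ 2 - B * a n ^ 2)).
    assert (s ^ 2 * (a n * b n) ^ 2 <= A * B * (a n * b n) ^ 2)
      by (apply Rmult_le_compat_r; [apply pow2_ge_0 | auto]).
    nra. }
  replace ((s + a n * b n) ^ 2) with (s ^ 2 + 2 * s * (a n * b n) + (a n * b n) ^ 2) by ring.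
  replace ((A + a n ^ 2) * (B + b n ^ 2))
    with (A * B + (A * b n ^ 2 + B * a n ^ 2) + (a n * b n) ^ 2) by ring.
  lra.
Qed.

Lemma csum_ext a b n : (forall i, (i < n)%nat -> a i = b i) -> csum a n = csum b n.
Proof.
  induction n as [|n IH]; intros H; simpl; auto.
  rewrite IH by (intros; apply H; lia). rewrite H by lia. reflexivity.
Qed.

Lemma csum_zero n : csum (fun _ => 0%R : C) n = 0%R.
Proof. induction n as [|n IH]; simpl; [|rewrite IH]; [auto|ring]. Qed.

Lemma csum_plus a b n : csum (fun i => a i + b i)%C n = (csum a n + csum b n)%C.
Proof. induction n as [|n IH]; simpl; [|rewrite IH]; ring. Qed.

Lemma csum_minus a b n : csum (fun i => a i - b i)%C n = (csum a n - csum b n)%C.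
Proof. induction n as [|n IH]; simpl; [|rewrite IH]; ring. Qed.

Lemma csum_scal x a n : csum (fun i => x * a i)%C n = (x * csum a n)%C.
Proof. induction n as [|n IH]; simpl; [|rewrite IH]; ring. Qed.

Lemma csum_scal_r x a n : csum (fun i => a i * x)%C n = (csum a n * x)%C.
Proof. induction n as [|n IH]; simpl; [|rewrite IH]; ring. Qed.

Lemma csum_add a n m : csum a (n + m) = (csum a n + csum (fun i => a (n + i)%nat) m)%C.
Proof.
  induction m as [|m IH]; simpl.
  - rewrite Nat.add_0_r. ring.
  - rewrite Nat.add_succ_r. simpl. rewrite IH. ring.
Qed.

Lemma csum_S_l a n : csum a (S n) = (a 0%nat + csum (fun i => a (S i)) n)%C.
Proof. change (S n) with (1 + n)%nat. rewrite csum_add. simpl. ring. Qed.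

Lemma csum_swap (h : nat -> nat -> C) n m :
  csum (fun i => csum (h i) m) n = csum (fun j => csum (fun i => h i j) n) m.
Proof.
  induction n as [|n IH]; simpl.
  - now rewrite csum_zero.
  - now rewrite IH, csum_plus.
Qed.

Lemma csum_triangle (h : nat -> nat -> C) n :
  csum (fun j => csum (fun i => h i (j - i)%nat) (S j)) n
  = csum (fun i => csum (h i) (n - i)) n.
Proof.
  induction n as [|n IH]; auto.
  cbn [csum] in *. rewrite IH. replace (S n - n)%nat with 1%nat by lia.
  replace (n - n)%nat with 0%nat by lia. cbn [csum].
  rewrite (csum_ext (fun i => csum (h i) (S n - i))
            (fun i => csum (h i) (n - i) + h i (n - i)%nat)%C).
  - rewrite csum_plus. ring.
  - intros i Hi. replace (S n - i)%nat with (S (n - i)) by lia. reflexivity.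
Qed.

Lemma csum_rev a n : csum (fun i => a (n - 1 - i)%nat) n = csum a n.
Proof.
  induction n as [|n IH]; auto.
  rewrite csum_S_l. simpl csum at 2.
  rewrite <- IH. replace (S n - 1 - 0)%nat with n by lia.
  rewrite Cplus_comm. f_equal. apply csum_ext. intros i Hi. f_equal. lia.
Qed.

Lemma csum_conj a n : Cconj (csum a n) = csum (fun i => Cconj (a i)) n.
Proof.
  induction n as [|n IH]; simpl.
  - unfold Cconj, RtoC; simpl; f_equal; ring.
  - now rewrite Cplus_conj, IH.
Qed.

Lemma Re_csum a n : Re (csum a n) = rsum (fun i => Re (a i)) n.
Proof. induction n as [|n IH]; cbn [csum rsum]; [reflexivity|]. now rewrite re_plus, IH. Qed.

Lemma Im_csum a n : Im (csum a n) = rsum (fun i => Im (a i)) n.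
Proof. induction n as [|n IH]; cbn [csum rsum]; [reflexivity|]. now rewrite im_plus, IH. Qed.

Lemma Cmod_csum_le a b n :
  (forall i, (i < n)%nat -> Cmod (a i) <= b i) -> Cmod (csum a n) <= rsum b n.
Proof.
  induction n as [|n IH]; intros H; simpl; [rewrite Cmod_0; lra|].
  eapply Rle_trans; [apply Cmod_triangle|].
  apply Rplus_le_compat; [apply IH; intros; apply H; lia | apply H; lia].
Qed.

Lemma csum_RtoC a n : csum (fun i => RtoC (a i)) n = RtoC (rsum a n).
Proof. induction n as [|n IH]; simpl; [reflexivity|]. now rewrite IH, RtoC_plus. Qed.

Lemma sum_n_csum (a : nat -> C) n : sum_n a n = csum a (S n).
Proof.
  induction n as [|n IH].
  - rewrite sum_O. simpl. now rewrite Cplus_0_l.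
  - rewrite sum_Sn, IH. reflexivity.
Qed.

(** * Complex exponentials and derivatives of complex-valued functions *)

Lemma C_eq (a b : C) : Re a = Re b -> Im a = Im b -> a = b.
Proof. destruct a, b; simpl; intros; subst; auto. Qed.

Lemma Cmod_minus_sym a b : Cmod (a - b) = Cmod (b - a).
Proof. rewrite <- Cmod_opp. f_equal. ring. Qed.

Lemma Cmod_minus_triangle a b c : Cmod (a - c) <= Cmod (a - b) + Cmod (b - c).
Proof. replace (a - c)%C with ((a - b) + (b - c))%C by ring. apply Cmod_triangle. Qed.

Lemma Cmod_sub_le a b : Cmod (a - b) <= Cmod a + Cmod b.
Proof.
  replace (a - b)%C with (a + - b)%C by ring.
  rewrite <- (Cmod_opp b). apply Cmod_triangle.
Qed.

Lemma Cmod_Re_Im z : Cmod z <= Rabs (Re z) + Rabs (Im z).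
Proof.
  rewrite <- (Rabs_pos_eq (Cmod z)) by apply Cmod_ge_0.
  rewrite <- (Rabs_pos_eq (Rabs (Re z) + Rabs (Im z))).
  2:{ pose proof (Rabs_pos (Re z)); pose proof (Rabs_pos (Im z)); lra. }
  apply Rsqr_le_abs_0. rewrite !Rsqr_pow2, Cmod2_alt.
  rewrite <- (pow2_abs (Re z)), <- (pow2_abs (Im z)).
  pose proof (Rabs_pos (Re z)); pose proof (Rabs_pos (Im z)); nra.
Qed.

Lemma Im_le_Cmod z : Rabs (Im z) <= Cmod z.
Proof.
  eapply Rle_trans; [|apply Rmax_Cmod]. apply Rmax_r.
Qed.

Lemma Cexp_plus a b : Cexp (a + b) = (Cexp a * Cexp b)%C.
Proof.
  unfold Cexp. rewrite re_plus, im_plus, exp_plus, cos_plus, sin_plus.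
  unfold Cmult; simpl. f_equal; ring.
Qed.

Lemma Cexp_0 : Cexp 0%R = 1%R.
Proof. unfold Cexp, RtoC; simpl. rewrite exp_0, cos_0, sin_0. f_equal; ring. Qed.

Lemma Cmod_Cexp z : Cmod (Cexp z) = exp (Re z).
Proof.
  rewrite <- (Rabs_pos_eq (Cmod _)) by apply Cmod_ge_0.
  rewrite <- (Rabs_pos_eq (exp _)) by (left; apply exp_pos).
  apply Rsqr_eq_abs_0. rewrite !Rsqr_pow2, Cmod2_alt. unfold Cexp; simpl.
  pose proof (sin2_cos2 (Im z)) as H. unfold Rsqr in H. nra.
Qed.

Lemma Cexp_RtoC x : Cexp (RtoC x) = RtoC (exp x).
Proof. unfold Cexp, RtoC; simpl. rewrite cos_0, sin_0. f_equal; ring. Qed.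

Lemma Cexp_conj z : Cconj (Cexp z) = Cexp (Cconj z).
Proof.
  unfold Cexp, Cconj, Re, Im; simpl. rewrite cos_neg, sin_neg. f_equal; ring.
Qed.

Lemma eit_alt t : eit t = (cos t, sin t).
Proof. unfold eit, Cexp; simpl. rewrite exp_0. f_equal; ring. Qed.

Lemma eit_plus a b : eit (a + b) = (eit a * eit b)%C.
Proof.
  unfold eit. rewrite <- Cexp_plus. f_equal. unfold Cplus; simpl. f_equal; ring.
Qed.

Lemma eit_0 : eit 0 = 1%R.
Proof. rewrite eit_alt, cos_0, sin_0. reflexivity. Qed.

Lemma Cmod_eit t : Cmod (eit t) = 1.
Proof. unfold eit. rewrite Cmod_Cexp. apply exp_0. Qed.

Lemma eit_conj t : Cconj (eit t) = eit (- t).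
Proof. rewrite !eit_alt. unfold Cconj; simpl. now rewrite cos_neg, sin_neg. Qed.

Lemma eit_pow t n : (eit t ^ n)%C = eit (INR n * t).
Proof.
  induction n as [|n IH].
  - rewrite Rmult_0_l, eit_0. reflexivity.
  - rewrite Cpow_S, IH, <- eit_plus, S_INR. f_equal. ring.
Qed.

Lemma eit_period j t : eit (IZR j * (t + 2 * PI)) = eit (IZR j * t).
Proof.
  assert (H : forall n, eit (INR n * (2 * PI)) = 1%R).
  { intros n. rewrite <- eit_pow, eit_alt, cos_2PI, sin_2PI.
    change ((1, 0) : C) with (RtoC 1). apply Cpow_1_l. }
  assert (HZ : eit (IZR j * (2 * PI)) = 1%R).
  { destruct (Z_le_gt_dec 0 j).
    - rewrite <- (Z2Nat.id j), <- INR_IZR_INZ by lia. apply H.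
    - replace (IZR j * (2 * PI)) with (- (IZR (- j) * (2 * PI))) by (rewrite opp_IZR; ring).
      rewrite <- eit_conj, <- (Z2Nat.id (- j)), <- INR_IZR_INZ by lia. rewrite H.
      unfold Cconj, RtoC; simpl; f_equal; ring. }
  rewrite Rmult_plus_distr_l, eit_plus, HZ. apply Cmult_1_r.
Qed.

(** A real variable is enough: power series are differentiated along the segment from 0 to [z], jets
    with respect to [s = - ln r], and exponentials in the angle. *)
Definition Cderiv (f : R -> C) (x : R) (l : C) : Prop :=
  is_derive (fun t => Re (f t)) x (Re l) /\ is_derive (fun t => Im (f t)) x (Im l).

Lemma Cderiv_ext f g x l : (forall t, f t = g t) -> Cderiv f x l -> Cderiv g x l.
Proof.
  intros H [H1 H2]; split; eapply is_derive_ext; try eassumption; intros t; now rewrite <- H.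
Qed.

Lemma Cderiv_const c x : Cderiv (fun _ => c) x 0%R.
Proof. split; simpl; apply @is_derive_const. Qed.

Lemma Cderiv_plus f g x a b :
  Cderiv f x a -> Cderiv g x b -> Cderiv (fun t => f t + g t)%C x (a + b)%C.
Proof.
  intros [H1 H2] [H3 H4]; split; simpl.
  - apply @is_derive_plus with (K := R_AbsRing) (V := R_NormedModule); auto.
  - apply @is_derive_plus with (K := R_AbsRing) (V := R_NormedModule); auto.
Qed.

Lemma Cderiv_mult f g x a b :
  Cderiv f x a -> Cderiv g x b ->
  Cderiv (fun t => f t * g t)%C x (a * g x + f x * b)%C.
Proof.
  intros [H1 H2] [H3 H4]; split.
  - apply is_derive_ext with (fun t => Re (f t) * Re (g t) - Im (f t) * Im (g t)); [reflexivity|].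
    replace (Re (a * g x + f x * b)%C) with
      ((Re a * Re (g x) + Re (f x) * Re b) - (Im a * Im (g x) + Im (f x) * Im b))
      by (simpl; unfold Re, Im; ring).
    apply @is_derive_minus with (K := R_AbsRing) (V := R_NormedModule);
      apply @is_derive_mult; auto; intros; apply Rmult_comm.
  - apply is_derive_ext with (fun t => Re (f t) * Im (g t) + Im (f t) * Re (g t)); [reflexivity|].
    replace (Im (a * g x + f x * b)%C) with
      ((Re a * Im (g x) + Re (f x) * Im b) + (Im a * Re (g x) + Im (f x) * Re b))
      by (simpl; unfold Re, Im; ring).
    apply @is_derive_plus with (K := R_AbsRing) (V := R_NormedModule);
      apply @is_derive_mult; auto; intros; apply Rmult_comm.
Qed.

Lemma Cderiv_RtoC f x l : is_derive f x l -> Cderiv (fun t => RtoC (f t)) x (RtoC l).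
Proof. intros H; split; simpl; auto. apply @is_derive_const. Qed.

Lemma Cderiv_scal c f x a : Cderiv f x a -> Cderiv (fun t => c * f t)%C x (c * a)%C.
Proof.
  intros H. replace (c * a)%C with (0%R * f x + c * a)%C by ring.
  apply (Cderiv_mult (fun _ => c) f); auto. apply Cderiv_const.
Qed.

Lemma Cderiv_csum (f : nat -> R -> C) (a : nat -> C) n x :
  (forall i, (i < n)%nat -> Cderiv (f i) x (a i)) ->
  Cderiv (fun t => csum (fun i => f i t) n) x (csum a n).
Proof.
  induction n as [|n IH]; intros H; simpl.
  - apply Cderiv_const.
  - apply Cderiv_plus; [apply IH; intros; apply H; lia | apply H; lia].
Qed.

Lemma Cderiv_Cexp f x l : Cderiv f x l -> Cderiv (fun t => Cexp (f t)) x (l * Cexp (f x))%C.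
Proof.
  intros [H1 H2].
  assert (E : is_derive (fun t => exp (Re (f t))) x (Re l * exp (Re (f x)))).
  { apply (is_derive_comp (V := R_NormedModule) exp (fun t => Re (f t))); auto.
    apply is_derive_exp. }
  assert (Co : is_derive (fun t => cos (Im (f t))) x (Im l * - sin (Im (f x)))).
  { apply (is_derive_comp (V := R_NormedModule) cos (fun t => Im (f t))); auto.
    apply is_derive_cos. }
  assert (Si : is_derive (fun t => sin (Im (f t))) x (Im l * cos (Im (f x)))).
  { apply (is_derive_comp (V := R_NormedModule) sin (fun t => Im (f t))); auto.
    apply is_derive_sin. }
  split.
  - apply is_derive_ext with (fun t => exp (Re (f t)) * cos (Im (f t))); [reflexivity|].
    replace (Re (l * Cexp (f x))%C) with (Re l * exp (Re (f x)) * cos (Im (f x))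
      + exp (Re (f x)) * (Im l * - sin (Im (f x)))) by (simpl; unfold Re, Im; ring).
    apply (is_derive_mult (fun t => exp (Re (f t))) (fun t => cos (Im (f t)))); auto.
    intros; apply Rmult_comm.
  - apply is_derive_ext with (fun t => exp (Re (f t)) * sin (Im (f t))); [reflexivity|].
    replace (Im (l * Cexp (f x))%C) with (Re l * exp (Re (f x)) * sin (Im (f x))
      + exp (Re (f x)) * (Im l * cos (Im (f x)))) by (simpl; unfold Re, Im; ring).
    apply (is_derive_mult (fun t => exp (Re (f t))) (fun t => sin (Im (f t)))); auto.
    intros; apply Rmult_comm.
Qed.

Lemma Cderiv_eit a x : Cderiv (fun t => eit (a * t)) x (Ci * RtoC a * eit (a * x))%C.
Proof.
  apply (Cderiv_Cexp (fun t => (0, a * t) : C)). split; simpl.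
  - replace (0 * a - 1 * 0) with 0 by ring. apply @is_derive_const.
  - auto_derive; auto. ring.
Qed.

Lemma derive_nonneg_le (f df : R -> R) a b : a <= b ->
  (forall x, a <= x <= b -> is_derive f x (df x)) ->
  (forall x, a <= x <= b -> 0 <= df x) -> f a <= f b.
Proof.
  intros Hab Hd Hp.
  destruct (MVT_gen f a b df) as [c [Hc E]].
  - rewrite Rmin_left, Rmax_right by lra. intros; apply Hd; lra.
  - rewrite Rmin_left, Rmax_right by lra. intros x Hx.
    apply continuity_pt_filterlim. apply @ex_derive_continuous.
    exists (df x). apply Hd; lra.
  - rewrite Rmin_left, Rmax_right in Hc by lra. specialize (Hp c Hc). nra.
Qed.

(** The increment [d] is projected on its own direction: [Re (conj d * f)] has derivative at most
    [Cmod d * phi'], which brings the claim back to the real mean value theorem. It serves below to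
    integrate differential inequalities without integrals. *)
Lemma Cderiv_mean_value (f f' : R -> C) (phi phi' : R -> R) a b : a <= b ->
  (forall x, a <= x <= b -> Cderiv f x (f' x)) ->
  (forall x, a <= x <= b -> is_derive phi x (phi' x)) ->
  (forall x, a <= x <= b -> Cmod (f' x) <= phi' x) ->
  Cmod (f b - f a) <= phi b - phi a.
Proof.
  intros Hab Hf Hphi Hle. set (d := (f b - f a)%C).
  assert (Hmono : phi a <= phi b).
  { apply derive_nonneg_le with phi'; auto. intros x Hx.
    eapply Rle_trans; [apply Cmod_ge_0 | apply Hle; auto]. }
  destruct (Req_dec (Cmod d) 0) as [H0|H0]; [lra|].
  assert (Hpos : 0 < Cmod d) by (pose proof (Cmod_ge_0 d); lra).
  set (h := fun x => Cmod d * phi x - (Re d * Re (f x) + Im d * Im (f x))).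
  assert (Hh : h a <= h b).
  { apply derive_nonneg_le with
      (fun x => Cmod d * phi' x - (Re d * Re (f' x) + Im d * Im (f' x))); auto.
    - intros x Hx. destruct (Hf x Hx) as [H1 H2]. specialize (Hphi x Hx). unfold h.
      apply @is_derive_minus with (K := R_AbsRing) (V := R_NormedModule);
        [|apply @is_derive_plus with (K := R_AbsRing) (V := R_NormedModule)];
        apply is_derive_scal; auto.
    - intros x Hx.
      replace (Re d * Re (f' x) + Im d * Im (f' x)) with (Re (Cconj d * f' x)%C)
        by (simpl; unfold Re, Im; ring).
      pose proof (re_le_Cmod (Cconj d * f' x)) as H.
      rewrite Cmod_mult, Cmod_conj in H.
      pose proof (Rle_abs (Re (Cconj d * f' x))).
      pose proof (Rmult_le_compat_l _ _ _ (Cmod_ge_0 d) (Hle x Hx)). lra. }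
  unfold h in Hh. apply Rmult_le_reg_l with (Cmod d); auto.
  pose proof (Cmod2_alt d) as E.
  assert (Re d = Re (f b) - Re (f a)) by (unfold d; simpl; unfold Re; ring).
  assert (Im d = Im (f b) - Im (f a)) by (unfold d; simpl; unfold Im; ring).
  nra.
Qed.

Lemma exp_le_compat x y : x <= y -> exp x <= exp y.
Proof. intros [H|H]; [left; now apply exp_increasing | right; now f_equal]. Qed.

Lemma Cmod_Cexp_minus_1 w : Cmod (Cexp w - 1%R) <= exp (Cmod w) - 1.
Proof.
  pose proof (Cderiv_mean_value (fun x => Cexp (w * RtoC x)) (fun x => w * Cexp (w * RtoC x))%C
    (fun x => exp (Cmod w * x)) (fun x => Cmod w * exp (Cmod w * x)) 0 1 ltac:(lra)) as H.
  cbv beta in H. rewrite Cmult_0_r, Cexp_0, Rmult_0_r, exp_0, !Cmult_1_r, Rmult_1_r in H. apply H.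
  - intros x _. apply (Cderiv_Cexp (fun x => (w * RtoC x)%C)).
    assert (Hd : Cderiv (fun x => (w * RtoC x)%C) x (w * 1%R)).
    { apply Cderiv_scal, Cderiv_RtoC. apply @is_derive_id. }
    now rewrite Cmult_1_r in Hd.
  - intros x _. auto_derive; auto. ring.
  - intros x Hx. rewrite !Cmod_mult, Cmod_Cexp.
    apply Rmult_le_compat_l; [apply Cmod_ge_0|].
    apply exp_le_compat. rewrite re_scal_r.
    apply Rmult_le_compat_r; [lra|].
    eapply Rle_trans; [apply Rle_abs | apply re_le_Cmod].
Qed.

(** * Means over a period and Fourier coefficients *)

Definition Rcont (f : R -> R) : Prop := forall x, continuous f x.

Lemma Rcont_const c : Rcont (fun _ => c).
Proof. intros x. apply continuous_const. Qed.

Lemma Rcont_plus f g : Rcont f -> Rcont g -> Rcont (fun t => f t + g t).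
Proof. intros Hf Hg x. apply (continuous_plus (V := R_NormedModule) f g); auto. Qed.

Lemma Rcont_minus f g : Rcont f -> Rcont g -> Rcont (fun t => f t - g t).
Proof. intros Hf Hg x. apply (continuous_minus (V := R_NormedModule) f g); auto. Qed.

Lemma Rcont_mult f g : Rcont f -> Rcont g -> Rcont (fun t => f t * g t).
Proof. intros Hf Hg x. apply (continuous_mult (K := R_AbsRing) f g); auto. Qed.

Lemma Rcont_comp f g : Rcont f -> Rcont g -> Rcont (fun t => g (f t)).
Proof. intros Hf Hg x. apply continuous_comp; auto. Qed.

Lemma Rcont_derive f f' : (forall x, is_derive f x (f' x)) -> Rcont f.
Proof. intros H x. apply @ex_derive_continuous. exists (f' x). apply H. Qed.

Lemma Rcont_exp : Rcont exp.
Proof. apply Rcont_derive with exp. intros. apply is_derive_exp. Qed.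

Lemma Rcont_cos : Rcont cos.
Proof. intros x. apply continuous_cos. Qed.

Lemma Rcont_sin : Rcont sin.
Proof. intros x. apply continuous_sin. Qed.

Lemma Rcont_ext f g : (forall t, f t = g t) -> Rcont f -> Rcont g.
Proof. intros H Hf x. apply continuous_ext with f; auto. Qed.

Lemma Rcont_affine h : Rcont (fun t => t + h).
Proof. apply Rcont_plus; [intros x; apply continuous_id | apply Rcont_const]. Qed.

Lemma Rcont_unif_limit f :
  (forall d, 0 < d -> exists g, Rcont g /\ forall x, Rabs (f x - g x) <= d) -> Rcont f.
Proof.
  intros H x. apply continuity_pt_filterlim. intros e He.
  destruct (H (e / 4) ltac:(lra)) as [g [Hg Hd]].
  pose proof (proj2 (continuity_pt_filterlim g x) (Hg x)) as Hc.
  destruct (Hc (e / 4) ltac:(lra)) as [a [Ha Hb]].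
  exists a; split; auto. intros y Hy. specialize (Hb y Hy).
  simpl in *. unfold R_dist in *.
  replace (f y - f x) with ((f y - g y) + (g y - g x) - (f x - g x)) by ring.
  pose proof (Hd x); pose proof (Hd y).
  eapply Rle_lt_trans; [apply Rabs_triang|]. rewrite Rabs_Ropp.
  pose proof (Rabs_triang (f y - g y) (g y - g x)). lra.
Qed.

Lemma Rcont_Lipschitz f L : (forall x y, Rabs (f x - f y) <= L * Rabs (x - y)) -> Rcont f.
Proof.
  intros H x. apply continuity_pt_filterlim. intros e He.
  assert (HL : 0 < Rabs L + 1) by (pose proof (Rabs_pos L); lra).
  exists (e / (Rabs L + 1)). split; [now apply Rdiv_lt_0_compat|].
  intros y [_ Hy]. simpl in *. unfold R_dist in *.
  eapply Rle_lt_trans; [apply H|].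
  apply Rle_lt_trans with ((Rabs L + 1) * Rabs (y - x)).
  - apply Rmult_le_compat_r; [apply Rabs_pos|]. pose proof (Rle_abs L). lra.
  - apply Rmult_lt_compat_l with (r := Rabs L + 1) in Hy; auto.
    replace ((Rabs L + 1) * (e / (Rabs L + 1))) with e in Hy by (field; lra). auto.
Qed.

Lemma Rcont_bounded f a b : Rcont f -> exists M, 0 < M /\ forall x, a <= x <= b -> Rabs (f x) <= M.
Proof.
  intros H. destruct (Rle_dec a b) as [Hab|Hab].
  2:{ exists 1. split; [lra|]. intros; lra. }
  assert (Hc : forall x, a <= x <= b -> continuity_pt (fun t => Rabs (f t)) x).
  { intros x _. apply continuity_pt_filterlim.
    apply (continuous_comp f Rabs); auto. apply continuous_Rabs. }
  destruct (continuity_ab_maj (fun t => Rabs (f t)) a b Hab Hc) as [m [Hm _]].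
  exists (Rabs (f m) + 1). split; [pose proof (Rabs_pos (f m)); lra|].
  intros x Hx. specialize (Hm x Hx). lra.
Qed.

Lemma Rcont_ex_RInt f a b : Rcont f -> ex_RInt f a b.
Proof. intros H. apply (ex_RInt_continuous (V := R_CompleteNormedModule)). auto. Qed.

Definition mean (f : R -> R) : R := / (2 * PI) * RInt f (- PI) PI.

Lemma two_PI_pos : 0 < 2 * PI.
Proof. pose proof PI_RGT_0; lra. Qed.

Lemma mean_ext f g : (forall t, f t = g t) -> mean f = mean g.
Proof. intros H. unfold mean. f_equal. apply RInt_ext. auto. Qed.

Lemma mean_plus f g : Rcont f -> Rcont g -> mean (fun t => f t + g t) = mean f + mean g.
Proof.
  intros Hf Hg. unfold mean.
  rewrite (RInt_plus (V := R_CompleteNormedModule) f g) by now apply Rcont_ex_RInt.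
  apply Rmult_plus_distr_l.
Qed.

Lemma mean_minus f g : Rcont f -> Rcont g -> mean (fun t => f t - g t) = mean f - mean g.
Proof.
  intros Hf Hg. unfold mean.
  rewrite (RInt_minus (V := R_CompleteNormedModule) f g) by now apply Rcont_ex_RInt.
  apply Rmult_minus_distr_l.
Qed.

Lemma mean_scal c f : Rcont f -> mean (fun t => c * f t) = c * mean f.
Proof.
  intros Hf. unfold mean.
  pose proof (RInt_scal (V := R_CompleteNormedModule) f (-PI) PI c
    (Rcont_ex_RInt _ _ _ Hf)) as E.
  change (RInt (fun t => c * f t) (- PI) PI = c * RInt f (- PI) PI) in E.
  rewrite E. ring.
Qed.

Lemma mean_const c : mean (fun _ => c) = c.
Proof.
  unfold mean. rewrite RInt_const.
  change (scal (PI - - PI) c) with ((PI - - PI) * c).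
  field. pose proof two_PI_pos. lra.
Qed.

Lemma mean_le f g : Rcont f -> Rcont g ->
  (forall t, - PI <= t <= PI -> f t <= g t) -> mean f <= mean g.
Proof.
  intros Hf Hg H. pose proof two_PI_pos. unfold mean. apply Rmult_le_compat_l.
  - left. now apply Rinv_0_lt_compat.
  - apply RInt_le; try (apply Rcont_ex_RInt; auto); [lra|]. intros; apply H; lra.
Qed.

Lemma mean_nonneg f : Rcont f -> (forall t, 0 <= f t) -> 0 <= mean f.
Proof.
  intros Hf H. rewrite <- (mean_const 0). apply mean_le; auto. apply Rcont_const.
Qed.

Lemma mean_rsum (f : nat -> R -> R) n : (forall i, Rcont (f i)) ->
  Rcont (fun t => rsum (fun i => f i t) n) /\
  mean (fun t => rsum (fun i => f i t) n) = rsum (fun i => mean (f i)) n.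
Proof.
  intros H. induction n as [|n [IH1 IH2]]; simpl.
  - split; [apply Rcont_const | apply mean_const].
  - split; [apply Rcont_plus; auto|]. rewrite mean_plus, IH2; auto.
Qed.

Lemma mean_translate f h : Rcont f -> periodic2pi f -> mean (fun t => f (t + h)) = mean f.
Proof.
  intros Hf Hp. unfold mean. f_equal.
  assert (S : forall h a b, RInt (fun t => f (t + h)) a b = RInt f (a + h) (b + h)).
  { intros u a b.
    pose proof (RInt_comp_lin (V := R_CompleteNormedModule) f 1 u a b
      (Rcont_ex_RInt _ _ _ Hf)) as H.
    rewrite !Rmult_1_l in H. rewrite <- H. apply RInt_ext.
    intros x _. change (f (x + u) = 1 * f (1 * x + u)). now rewrite !Rmult_1_l. }
  rewrite S.
  pose proof (S (2 * PI) (- PI) (- PI + h)) as H2.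
  rewrite (RInt_ext _ f) in H2 by (intros; apply Hp).
  replace (- PI + 2 * PI) with PI in H2 by ring.
  replace (- PI + h + 2 * PI) with (PI + h) in H2 by ring.
  pose proof (RInt_Chasles (V := R_CompleteNormedModule) f (- PI) (- PI + h) (PI + h)
    (Rcont_ex_RInt _ _ _ Hf) (Rcont_ex_RInt _ _ _ Hf)) as C1.
  pose proof (RInt_Chasles (V := R_CompleteNormedModule) f (- PI) PI (PI + h)
    (Rcont_ex_RInt _ _ _ Hf) (Rcont_ex_RInt _ _ _ Hf)) as C2.
  unfold plus in C1, C2; simpl in C1, C2. lra.
Qed.

Definition Ccont (f : R -> C) : Prop :=
  Rcont (fun t => Re (f t)) /\ Rcont (fun t => Im (f t)).

Lemma Ccont_const c : Ccont (fun _ => c).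
Proof. split; apply Rcont_const. Qed.

Lemma Ccont_RtoC f : Rcont f -> Ccont (fun t => RtoC (f t)).
Proof. split; simpl; auto. apply Rcont_const. Qed.

Lemma Ccont_plus f g : Ccont f -> Ccont g -> Ccont (fun t => f t + g t)%C.
Proof. intros [] []; split; simpl; apply Rcont_plus; auto. Qed.

Lemma Ccont_minus f g : Ccont f -> Ccont g -> Ccont (fun t => f t - g t)%C.
Proof.
  intros [] []; split;
  [ apply Rcont_ext with (fun t => Re (f t) - Re (g t))
  | apply Rcont_ext with (fun t => Im (f t) - Im (g t)) ];
  try (intros; simpl; unfold Re, Im; ring); apply Rcont_minus; auto.
Qed.

Lemma Ccont_mult f g : Ccont f -> Ccont g -> Ccont (fun t => f t * g t)%C.
Proof.
  intros [] []; split; simpl; [apply Rcont_minus | apply Rcont_plus]; apply Rcont_mult; auto.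
Qed.

Lemma Ccont_conj f : Ccont f -> Ccont (fun t => Cconj (f t)).
Proof.
  intros [H1 H2]; split; auto. apply Rcont_ext with (fun t => 0 - Im (f t)).
  - intros; simpl; unfold Im; ring.
  - apply Rcont_minus; auto. apply Rcont_const.
Qed.

Lemma Ccont_Cexp f : Ccont f -> Ccont (fun t => Cexp (f t)).
Proof.
  intros [H1 H2]; split; simpl; apply Rcont_mult.
  - apply (Rcont_comp _ exp); auto using Rcont_exp.
  - apply (Rcont_comp _ cos); auto using Rcont_cos.
  - apply (Rcont_comp _ exp); auto using Rcont_exp.
  - apply (Rcont_comp _ sin); auto using Rcont_sin.
Qed.

Lemma Ccont_eit a : Ccont (fun t => eit (a * t)).
Proof.
  unfold eit. apply Ccont_Cexp. split; simpl.
  - apply Rcont_const.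
  - apply Rcont_mult; [apply Rcont_const | intros x; apply continuous_id].
Qed.

Lemma Ccont_csum (f : nat -> R -> C) n :
  (forall i, Ccont (f i)) -> Ccont (fun t => csum (fun i => f i t) n).
Proof.
  intros H. induction n; simpl; [apply Ccont_const | now apply Ccont_plus].
Qed.

Lemma Ccont_translate f h : Ccont f -> Ccont (fun t => f (t + h)).
Proof.
  intros [H1 H2]; split.
  - apply (Rcont_comp (fun t => t + h) (fun t => Re (f t))); auto using Rcont_affine.
  - apply (Rcont_comp (fun t => t + h) (fun t => Im (f t))); auto using Rcont_affine.
Qed.

Lemma Ccont_sqr_Cmod f : Ccont f -> Rcont (fun t => Cmod (f t) ^ 2).
Proof.
  intros [H1 H2]. apply Rcont_ext with (fun t => Re (f t) * Re (f t) + Im (f t) * Im (f t)).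
  - intros. rewrite Cmod2_alt. ring.
  - apply Rcont_plus; apply Rcont_mult; auto.
Qed.

Lemma Ccont_unif_limit f :
  (forall d, 0 < d -> exists g, Ccont g /\ forall x, Cmod (f x - g x) <= d) -> Ccont f.
Proof.
  intros H; split; apply Rcont_unif_limit; intros d Hd; destruct (H d Hd) as [g [[] Hg]].
  - exists (fun t => Re (g t)); split; auto. intros x. eapply Rle_trans; [|apply (Hg x)].
    eapply Rle_trans; [|apply re_le_Cmod]. right; f_equal; simpl; unfold Re; ring.
  - exists (fun t => Im (g t)); split; auto. intros x. eapply Rle_trans; [|apply (Hg x)].
    eapply Rle_trans; [|apply Im_le_Cmod]. right; f_equal; simpl; unfold Im; ring.
Qed.

Lemma Ccont_bounded f a b : Ccont f -> exists M, 0 < M /\ forall x, a <= x <= b -> Cmod (f x) <= M.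
Proof.
  intros [H1 H2].
  destruct (Rcont_bounded _ a b H1) as [M1 [P1 B1]], (Rcont_bounded _ a b H2) as [M2 [P2 B2]].
  exists (M1 + M2). split; [lra|]. intros x Hx.
  eapply Rle_trans; [apply Cmod_Re_Im|]. specialize (B1 x Hx); specialize (B2 x Hx). lra.
Qed.

Definition cmean (f : R -> C) : C := ((/ (2 * PI))%R : C) * CRInt f (- PI) PI.

Lemma cmean_alt f : cmean f = (mean (fun t => Re (f t)), mean (fun t => Im (f t))).
Proof. unfold cmean, CRInt, mean, Cmult; simpl. f_equal; ring. Qed.

Lemma cmean_ext f g : (forall t, f t = g t) -> cmean f = cmean g.
Proof. intros H. rewrite !cmean_alt. f_equal; apply mean_ext; intros; now rewrite H. Qed.

Lemma cmean_plus f g : Ccont f -> Ccont g -> cmean (fun t => f t + g t)%C = (cmean f + cmean g)%C.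
Proof.
  intros [] []. rewrite !cmean_alt. unfold Cplus; simpl. f_equal.
  - rewrite <- mean_plus; auto.
  - rewrite <- mean_plus; auto.
Qed.

Lemma cmean_scal c f : Ccont f -> cmean (fun t => c * f t)%C = (c * cmean f)%C.
Proof.
  intros []. rewrite !cmean_alt. unfold Cmult; simpl. f_equal.
  - rewrite mean_minus, !mean_scal; auto; apply Rcont_mult; auto using Rcont_const.
  - rewrite mean_plus, !mean_scal; auto; apply Rcont_mult; auto using Rcont_const.
Qed.

Lemma cmean_minus f g : Ccont f -> Ccont g -> cmean (fun t => f t - g t)%C = (cmean f - cmean g)%C.
Proof.
  intros Hf Hg. rewrite (cmean_ext _ (fun t => f t + (- (1)) * g t)%C) by (intros; ring).
  rewrite cmean_plus, cmean_scal; auto; [ring|]. apply Ccont_mult; auto using Ccont_const.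
Qed.

Lemma cmean_conj f : Ccont f -> cmean (fun t => Cconj (f t)) = Cconj (cmean f).
Proof.
  intros [_ H]. rewrite !cmean_alt. unfold Cconj; simpl. f_equal.
  rewrite (mean_ext _ (fun t => (-1) * Im (f t))) by (intros; unfold Im; ring).
  rewrite mean_scal; auto. unfold Im; ring.
Qed.

Lemma cmean_translate f h : Ccont f -> (forall t, f (t + 2 * PI) = f t) ->
  cmean (fun t => f (t + h)) = cmean f.
Proof.
  intros [H1 H2] Hp. rewrite !cmean_alt. f_equal.
  - apply (mean_translate (fun t => Re (f t))); auto. intros t; now rewrite Hp.
  - apply (mean_translate (fun t => Im (f t))); auto. intros t; now rewrite Hp.
Qed.

Lemma Re_cmean f : Re (cmean f) = mean (fun t => Re (f t)).
Proof. now rewrite cmean_alt. Qed.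

Lemma Re_conj_mult c : Re (Cconj c * c)%C = Cmod c ^ 2.
Proof. rewrite Cmod2_alt. simpl. unfold Re, Im. ring. Qed.

(** Projecting on the direction of the value [d] reduces this to monotonicity of the real mean. The
    bound is asked on one period only, because the Dirichlet majorant is valid there and not
    beyond. *)
Lemma Cmod_cmean_le f phi : Ccont f -> Rcont phi ->
  (forall t, - PI <= t <= PI -> Cmod (f t) <= phi t) -> Cmod (cmean f) <= mean phi.
Proof.
  intros Hf Hphi H. set (d := cmean f).
  assert (H0 : 0 <= mean phi).
  { rewrite <- (mean_const 0). apply mean_le; auto using Rcont_const.
    intros t Ht. eapply Rle_trans; [apply Cmod_ge_0 | auto]. }
  destruct (Req_dec (Cmod d) 0) as [E|E]; [lra|].
  assert (Hpos : 0 < Cmod d) by (pose proof (Cmod_ge_0 d); lra).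
  apply Rmult_le_reg_l with (Cmod d); auto.
  rewrite <- mean_scal by auto.
  assert (Ed : Cmod d * Cmod d = mean (fun t => Re (Cconj d * f t)%C)).
  { pose proof (cmean_scal (Cconj d) f Hf) as E1. fold d in E1.
    rewrite <- Re_cmean, E1, Re_conj_mult. ring. }
  rewrite Ed. apply mean_le.
  - apply (Ccont_mult (fun _ => Cconj d) f); auto using Ccont_const.
  - apply Rcont_mult; auto using Rcont_const.
  - intros t Ht. eapply Rle_trans; [apply Rle_abs|].
    eapply Rle_trans; [apply re_le_Cmod|]. rewrite Cmod_mult, Cmod_conj.
    apply Rmult_le_compat_l; [apply Cmod_ge_0 | auto].
Qed.

Lemma mean_derive F f : (forall x, is_derive F x (f x)) -> Rcont f -> F PI = F (- PI) -> mean f = 0.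
Proof.
  intros H Hf E. unfold mean.
  rewrite (is_RInt_unique (V := R_CompleteNormedModule) f (- PI) PI (minus (F PI) (F (- PI)))).
  - rewrite E. unfold minus, plus, opp; simpl. ring.
  - apply (is_RInt_derive (V := R_CompleteNormedModule)); auto.
Qed.

Lemma cmean_derive F f : (forall x, Cderiv F x (f x)) -> Ccont f -> F PI = F (- PI) ->
  cmean f = 0%R.
Proof.
  intros H [H1 H2] E. rewrite cmean_alt. unfold RtoC. f_equal.
  - apply mean_derive with (fun t => Re (F t)); auto; [intros; apply H | now rewrite E].
  - apply mean_derive with (fun t => Im (F t)); auto; [intros; apply H | now rewrite E].
Qed.

(** Extends [fourier] to complex-valued functions, since the factors [F], [G] and [y] are not
    real. *)
Definition coef (f : R -> C) (l : Z) : C := cmean (fun t => f t * eit (- IZR l * t))%C.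

Lemma fourier_coef V j : fourier V j = coef (fun t => RtoC (V t)) j.
Proof. reflexivity. Qed.

Lemma Ccont_mult_eit f a : Ccont f -> Ccont (fun t => f t * eit (a * t))%C.
Proof. intros. apply Ccont_mult; auto using Ccont_eit. Qed.

Lemma coef_ext f g l : (forall t, f t = g t) -> coef f l = coef g l.
Proof. intros H. apply cmean_ext. intros; now rewrite H. Qed.

Lemma coef_plus f g l : Ccont f -> Ccont g ->
  coef (fun t => f t + g t)%C l = (coef f l + coef g l)%C.
Proof.
  intros Hf Hg. unfold coef. rewrite <- cmean_plus by now apply Ccont_mult_eit.
  apply cmean_ext. intros; ring.
Qed.

Lemma coef_minus f g l : Ccont f -> Ccont g ->
  coef (fun t => f t - g t)%C l = (coef f l - coef g l)%C.
Proof.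
  intros Hf Hg. unfold coef. rewrite <- cmean_minus by now apply Ccont_mult_eit.
  apply cmean_ext. intros; ring.
Qed.

Lemma coef_scal c f l : Ccont f -> coef (fun t => c * f t)%C l = (c * coef f l)%C.
Proof.
  intros Hf. unfold coef. rewrite <- cmean_scal by now apply Ccont_mult_eit.
  apply cmean_ext. intros; ring.
Qed.

Lemma coef_const c l : coef (fun _ => c) l = if Z.eq_dec l 0 then c else 0%R.
Proof.
  unfold coef. rewrite (cmean_scal c) by apply Ccont_eit.
  destruct (Z.eq_dec l 0) as [->|Hl].
  - rewrite (cmean_ext _ (fun _ => 1%R)).
    + rewrite cmean_alt. simpl. rewrite !mean_const. apply Cmult_1_r.
    + intros t. replace (- IZR 0 * t) with 0 by (simpl; ring). apply eit_0.
  - assert (E : cmean (fun t => eit (- IZR l * t)) = 0%R); [|rewrite E; ring].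
    assert (Hl' : - IZR l <> 0) by (apply Ropp_neq_0_compat; apply not_0_IZR; auto).
    assert (P : eit (- IZR l * PI) = eit (- IZR l * - PI)).
    { rewrite <- opp_IZR.
      replace PI with (- PI + 2 * PI) at 1 by ring. apply eit_period. }
    pose proof (cmean_derive (fun t => eit (- IZR l * t))
      (fun t => Ci * RtoC (- IZR l) * eit (- IZR l * t))%C) as E.
    rewrite cmean_scal in E by apply Ccont_eit.
    assert (E0 : (Ci * RtoC (- IZR l) * cmean (fun t => eit (- IZR l * t)))%C = 0%R).
    { apply E; auto.
      - intros x. apply Cderiv_eit.
      - apply Ccont_mult; auto using Ccont_const, Ccont_eit. }
    apply (f_equal Cmod) in E0.
    rewrite !Cmod_mult, Cmod_Ci, Cmod_R, Cmod_0, Rmult_1_l in E0.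
    apply Rmult_integral in E0. destruct E0 as [E0|E0].
    + exfalso. apply Rabs_no_R0 in E0; auto.
    + now apply Cmod_eq_0.
Qed.

Lemma coef_mult_eit f j l : coef (fun t => f t * eit (IZR j * t))%C l = coef f (l - j).
Proof.
  apply cmean_ext. intros t. rewrite <- Cmult_assoc, <- eit_plus. do 2 f_equal.
  rewrite minus_IZR. ring.
Qed.

Lemma coef_eit j l : coef (fun t => eit (IZR j * t)) l = if Z.eq_dec l j then 1%R else 0%R.
Proof.
  rewrite (coef_ext _ (fun t => 1%R * eit (IZR j * t))%C) by (intros; ring).
  rewrite (coef_mult_eit (fun _ => RtoC 1)), coef_const.
  destruct (Z.eq_dec (l - j) 0), (Z.eq_dec l j); auto; exfalso; lia.
Qed.

Lemma coef_csum (f : nat -> R -> C) n l : (forall i, Ccont (f i)) ->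
  coef (fun t => csum (fun i => f i t) n) l = csum (fun i => coef (f i) l) n.
Proof.
  intros H. induction n as [|n IH]; simpl.
  - rewrite coef_const. destruct (Z.eq_dec l 0); auto.
  - rewrite coef_plus, IH; auto using Ccont_csum.
Qed.

Lemma coef_conj f l : Ccont f -> coef (fun t => Cconj (f t)) l = Cconj (coef f (- l)).
Proof.
  intros H. unfold coef. rewrite <- cmean_conj by now apply Ccont_mult_eit.
  apply cmean_ext. intros t. rewrite Cmult_conj, eit_conj. do 2 f_equal. rewrite opp_IZR. ring.
Qed.

Lemma coef_translate f h l : Ccont f -> (forall t, f (t + 2 * PI) = f t) ->
  coef (fun t => f (t + h)) l = (eit (IZR l * h) * coef f l)%C.
Proof.
  intros Hf Hp. unfold coef.
  rewrite <- (cmean_translate (fun t => f t * eit (- IZR l * t))%C h).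
  - rewrite <- cmean_scal by now apply (Ccont_translate (fun t => f t * eit (- IZR l * t))%C), Ccont_mult_eit.
    apply cmean_ext. intros t.
    replace (- IZR l * t) with (IZR l * h + - IZR l * (t + h)) by ring.
    rewrite eit_plus. ring.
  - now apply Ccont_mult_eit.
  - intros t. rewrite Hp, <- opp_IZR, eit_period. reflexivity.
Qed.

Lemma Cmod_coef_le f l M : Ccont f -> (forall t, - PI <= t <= PI -> Cmod (f t) <= M) ->
  Cmod (coef f l) <= M.
Proof.
  intros Hf H. rewrite <- (mean_const M). apply Cmod_cmean_le; auto using Rcont_const.
  - now apply Ccont_mult_eit.
  - intros t Ht. rewrite Cmod_mult, Cmod_eit, Rmult_1_r. auto.
Qed.

Definition sqnorm (f : R -> C) : R := mean (fun t => Cmod (f t) ^ 2).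

Lemma sqnorm_nonneg f : Ccont f -> 0 <= sqnorm f.
Proof. intros. apply mean_nonneg; [now apply Ccont_sqr_Cmod | intros; apply pow2_ge_0]. Qed.

Lemma sqnorm_le f g M : Ccont f -> Ccont g ->
  (forall t, - PI <= t <= PI -> Cmod (f t) <= M * Cmod (g t)) -> sqnorm f <= M ^ 2 * sqnorm g.
Proof.
  intros Hf Hg H. unfold sqnorm. rewrite <- mean_scal by now apply Ccont_sqr_Cmod.
  apply mean_le.
  - now apply Ccont_sqr_Cmod.
  - apply Rcont_mult; [apply Rcont_const | now apply Ccont_sqr_Cmod].
  - intros t Ht. rewrite <- Rpow_mult_distr. apply pow_incr. split; [apply Cmod_ge_0 | auto].
Qed.

Lemma sqnorm_bounded f M : Ccont f ->
  (forall t, - PI <= t <= PI -> Cmod (f t) <= M) -> sqnorm f <= M ^ 2.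
Proof.
  intros Hf H. rewrite <- (mean_const (M ^ 2)). apply mean_le; auto using Rcont_const.
  - now apply Ccont_sqr_Cmod.
  - intros t Ht. apply pow_incr. split; [apply Cmod_ge_0 | auto].
Qed.

Lemma Cmod_sqr_minus a b :
  Cmod (a - b) ^ 2 = Cmod a ^ 2 - 2 * Re (a * Cconj b) + Cmod b ^ 2.
Proof. rewrite !Cmod2_alt. simpl. unfold Re, Im. ring. Qed.

Lemma sqnorm_minus_eit f c l : Ccont f ->
  sqnorm (fun t => f t - c * eit (IZR l * t))%C
  = sqnorm f - 2 * Re (Cconj c * coef f l) + Cmod c ^ 2.
Proof.
  intros Hf. unfold sqnorm.
  assert (Hg : Ccont (fun t => Cconj c * (f t * eit (- IZR l * t)))%C).
  { apply Ccont_mult; [apply Ccont_const | now apply Ccont_mult_eit]. }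
  rewrite (mean_ext _ (fun t => (Cmod (f t) ^ 2
     - 2 * Re (Cconj c * (f t * eit (- IZR l * t)))%C) + Cmod c ^ 2)).
  - rewrite mean_plus, mean_minus, mean_scal, mean_const; auto using Rcont_const.
    + pose proof (cmean_scal (Cconj c) (fun t => f t * eit (- IZR l * t))%C
        (Ccont_mult_eit f _ Hf)) as E.
      unfold coef. now rewrite <- E, Re_cmean.
    + apply Hg.
    + now apply Ccont_sqr_Cmod.
    + apply Rcont_mult; [apply Rcont_const | apply Hg].
    + apply Rcont_minus; [now apply Ccont_sqr_Cmod|].
      apply Rcont_mult; [apply Rcont_const | apply Hg].
  - intros t. rewrite Cmod_sqr_minus, Cmod_mult, Cmod_eit, Cmult_conj, eit_conj.
    replace (- IZR l * t) with (- (IZR l * t)) by ring.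
    replace (f t * (Cconj c * eit (- (IZR l * t))))%C
      with (Cconj c * (f t * eit (- (IZR l * t))))%C by ring.
    ring.
Qed.

(** Subtracting the component of frequency [iota n] lowers [sqnorm] by the square of its coefficient
    and leaves the other coefficients unchanged. The function thus changes along the induction, so
    [f] is quantified after [n]. *)
Lemma bessel (iota : nat -> Z) : (forall i j, iota i = iota j -> i = j) ->
  forall n f, Ccont f -> rsum (fun i => Cmod (coef f (iota i)) ^ 2) n <= sqnorm f.
Proof.
  intros Hinj. induction n as [|n IH]; intros f Hf; cbn [rsum].
  - now apply sqnorm_nonneg.
  - set (c := coef f (iota n)).
    assert (He : Ccont (fun t => c * eit (IZR (iota n) * t))%C)
      by (apply Ccont_mult; auto using Ccont_const, Ccont_eit).
    pose proof (IH (fun t => f t - c * eit (IZR (iota n) * t))%C ltac:(now apply Ccont_minus)) as H.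
    rewrite sqnorm_minus_eit in H by auto. fold c in H.
    rewrite (rsum_ext _ (fun i => Cmod (coef f (iota i)) ^ 2)) in H.
    + rewrite Re_conj_mult in H. lra.
    + intros i Hi. do 2 f_equal. rewrite coef_minus by auto.
      rewrite coef_scal by apply Ccont_eit. rewrite coef_eit.
      destruct (Z.eq_dec (iota i) (iota n)) as [e|e]; [apply Hinj in e; lia | ring].
Qed.

(** * Inequalities for nonnegative sequences *)

Lemma Rle_of_sqr_le x y : 0 <= y -> x ^ 2 <= y ^ 2 -> x <= y.
Proof.
  intros Hy H. apply Rle_trans with (Rabs x); [apply Rle_abs|].
  rewrite <- (Rabs_pos_eq y) by auto. apply Rsqr_le_abs_0. now rewrite !Rsqr_pow2.
Qed.

(** The form in which every passage to the limit is made: [d] is a step or a truncation error, and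
    [c] may depend on everything but [d]. *)
Lemma Rle_eps_plus x y c : 0 <= c -> (forall d, 0 < d -> x <= y + c * d) -> x <= y.
Proof.
  intros Hc H. apply Rnot_lt_le. intros Hlt.
  specialize (H ((x - y) / (2 * (c + 1))) ltac:(apply Rdiv_lt_0_compat; lra)).
  assert (c * ((x - y) / (2 * (c + 1))) < x - y).
  { apply Rle_lt_trans with ((c + 1) * ((x - y) / (2 * (c + 1)))).
    - apply Rmult_le_compat_r; [left; apply Rdiv_lt_0_compat; lra | lra].
    - replace ((c + 1) * ((x - y) / (2 * (c + 1)))) with ((x - y) / 2) by (field; lra). lra. }
  lra.
Qed.

(* Summation by parts bounds the left-hand side [S] by [2 * sqrt S * sqrt (sum of (i a_i)^2)]. *)
Lemma hardy a N : (forall i, 0 <= a i) ->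
  rsum (fun m => (rsum a N - rsum a (S m)) ^ 2) (N - 1)
  <= 4 * rsum (fun i => (INR i * a i) ^ 2) N.
Proof.
  intros Ha. set (T := fun m => rsum a N - rsum a m).
  assert (HT : forall m, (m <= N)%nat -> 0 <= T m).
  { intros m Hm. unfold T. pose proof (rsum_mono a m N Ha Hm). lra. }
  assert (HS : forall m, T m = a m + T (S m)) by (intros; unfold T; simpl; ring).
  (* The boundary term of the summation by parts is kept to make the induction run; it disappears at
     the last index, where the tail [T] is zero. *)
  assert (P : forall M, (M + 1 <= N)%nat ->
    rsum (fun m => T (S m) ^ 2) M
    <= INR M * T (S M) ^ 2 + 2 * rsum (fun m => (INR (S m) * a (S m)) * T (S m)) M).
  { induction M as [|M IH]; intros HM; [simpl; lra|].
    specialize (IH ltac:(lia)). cbn [rsum].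
    assert (E : T (S M) = a (S M) + T (S (S M))) by apply HS.
    assert (0 <= T (S (S M))) by (apply HT; lia).
    assert (0 <= INR M) by apply pos_INR. specialize (Ha (S M)).
    rewrite S_INR.
    assert (INR M * T (S M) ^ 2 + T (S M) ^ 2
       <= (INR M + 1) * T (S (S M)) ^ 2 + 2 * ((INR M + 1) * a (S M) * T (S M))).
    { rewrite E.
      assert (0 <= (INR M + 1) * a (S M) ^ 2)
        by (apply Rmult_le_pos; [lra | apply pow2_ge_0]).
      nra. }
    lra. }
  destruct N as [|N']; [simpl; lra|].
  replace (S N' - 1)%nat with N' by lia.
  specialize (P N' ltac:(lia)).
  assert (TN : T (S N') = 0) by (unfold T; ring). rewrite TN in P.
  set (S0 := rsum (fun m => T (S m) ^ 2) N') in *.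
  change (S0 <= 4 * rsum (fun i => (INR i * a i) ^ 2) (S N')).
  rewrite rsum_S_l. set (b := fun m => INR (S m) * a (S m)).
  change (rsum (fun i => (INR (S i) * a (S i)) ^ 2) N') with (rsum (fun i => b i ^ 2) N').
  pose proof (rsum_cauchy_schwarz b (fun m => T (S m)) N') as CS. fold S0 in CS.
  change (rsum (fun m => INR (S m) * a (S m) * T (S m)) N')
    with (rsum (fun m => b m * T (S m)) N') in P.
  assert (0 <= S0) by (apply rsum_nonneg; intros; apply pow2_ge_0).
  assert (0 <= rsum (fun i => b i ^ 2) N') by (apply rsum_nonneg; intros; apply pow2_ge_0).
  set (B := rsum (fun i => b i ^ 2) N') in *. set (Q := rsum (fun m => b m * T (S m)) N') in *.
  replace (INR 0 * a 0%nat) with 0 by (simpl; ring).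
  destruct (Req_dec S0 0) as [HS0|HS0]; [rewrite HS0; simpl; lra|].
  assert (0 < S0) by lra.
  assert (H2 : S0 <= 2 * Q) by (replace (INR N' * 0 ^ 2) with 0 in P by ring; lra).
  assert (S0 * S0 <= (4 * B) * S0).
  { apply Rle_trans with ((2 * Q) * (2 * Q)); [apply Rmult_le_compat; lra|].
    replace (2 * Q * (2 * Q)) with (4 * Q ^ 2) by ring.
    change (Q ^ 2 <= B * S0) in CS. lra. }
  assert (S0 <= 4 * B) by (apply Rmult_le_reg_r with S0; auto). simpl. lra.
Qed.

(** After exchanging the sums, the column of index [m] adds up to at most the tail of [alpha] beyond
    [m]. Cauchy-Schwarz separates [x] from these tails, and Hardy's inequality bounds their [l^2]
    norm by [tau]. *)
Lemma hankel_bound alpha tau x X L M :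
  (forall i, 0 <= alpha i) -> 0 <= tau ->
  (forall N, 4 * rsum (fun i => (INR i * alpha i) ^ 2) N <= tau ^ 2) ->
  0 <= X -> (forall m, 0 <= x m) -> rsum (fun m => x m ^ 2) M <= X ^ 2 ->
  rsum (fun l => rsum (fun m => alpha (l + S m)%nat * x m) M) L <= tau * X.
Proof.
  intros Ha Ht HA HX Hx Hs. rewrite rsum_swap.
  set (N := (L + M + 1)%nat).
  assert (HW : forall m, (m < M)%nat ->
    rsum (fun l => alpha (l + S m)%nat) L <= rsum alpha N - rsum alpha (S m)).
  { intros m Hm. assert (H : rsum alpha (S m + L) <= rsum alpha N) by (apply rsum_mono; auto; lia).
    rewrite rsum_add in H.
    rewrite (rsum_ext _ (fun i => alpha (S m + i)%nat)) by (intros; f_equal; lia). lra. }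
  apply Rle_trans with (rsum (fun m => x m * (rsum alpha N - rsum alpha (S m))) M).
  - apply rsum_le. intros m Hm. rewrite rsum_scal_r, Rmult_comm.
    apply Rmult_le_compat_l; auto.
  - apply Rle_of_sqr_le; [now apply Rmult_le_pos|].
    eapply Rle_trans; [apply rsum_cauchy_schwarz|].
    rewrite Rpow_mult_distr, Rmult_comm. apply Rmult_le_compat; auto.
    + apply rsum_nonneg; intros; apply pow2_ge_0.
    + apply rsum_nonneg; intros; apply pow2_ge_0.
    + eapply Rle_trans; [|apply (HA N)]. eapply Rle_trans; [|now apply hardy].
      apply rsum_mono; [intros; apply pow2_ge_0 | lia].
Qed.

Lemma rsum_inv_sqr_le n : rsum (fun i => / INR (S i) ^ 2) n <= 2.
Proof.
  assert (H : forall n, rsum (fun i => / INR (S i) ^ 2) (S n) <= 2 - / INR (S n)).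
  { induction n0 as [|m IH].
    - simpl. lra.
    - cbn [rsum] in *. rewrite (S_INR (S m)).
      assert (0 < INR (S m)) by (apply lt_0_INR; lia). set (y := INR (S m)) in *.
      assert (E : / (y + 1) ^ 2 <= / y - / (y + 1)).
      { replace (/ y - / (y + 1)) with (/ (y * (y + 1))) by (field; lra).
        apply Rinv_le_contravar; nra. }
      lra. }
  destruct n as [|n]; [simpl; lra|]. specialize (H n).
  assert (0 < / INR (S n)) by (apply Rinv_0_lt_compat, lt_0_INR; lia). lra.
Qed.

(** AM-GM on [a i = (INR (S i) * a i) * / INR (S i)]; the summand 1 is half of the bound 2 on the
    sum of the inverse squares. *)
Lemma rsum_le_of_weighted_sqr a B n :
  rsum (fun i => (INR (S i) * a i) ^ 2) n <= B -> rsum a n <= B / 2 + 1.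
Proof.
  intros H.
  assert (rsum a n <= rsum (fun i => / 2 * (INR (S i) * a i) ^ 2 + / 2 * / INR (S i) ^ 2) n).
  { apply rsum_le. intros i _.
    assert (0 < INR (S i)) by (apply lt_0_INR; lia). set (y := INR (S i)) in *.
    pose proof (pow2_ge_0 (y * a i - / y)).
    assert (y * / y = 1) by (field; lra).
    replace (/ y ^ 2) with ((/ y) ^ 2) by (field; lra). nra. }
  rewrite rsum_plus, !rsum_scal in H0. pose proof (rsum_inv_sqr_le n). lra.
Qed.

(** Young's inequality for a convolution of [l^1] with [l^2]. Splitting [a i] into two factors
    [sqrt (a i)] before Cauchy-Schwarz leaves one factor that sees only the [l^1] norm of [a]. *)
Lemma young a b n : (forall i, 0 <= a i) -> (forall i, 0 <= b i) ->
  rsum (fun j => (rsum (fun i => a i * b (j - i)%nat) (S j)) ^ 2) n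
  <= rsum a n ^ 2 * rsum (fun j => b j ^ 2) n.
Proof.
  intros Ha Hb.
  apply Rle_trans with (rsum (fun j => rsum a n * rsum (fun i => a i * b (j - i)%nat ^ 2) (S j)) n).
  - apply rsum_le. intros j Hj.
    pose proof (rsum_cauchy_schwarz (fun i => sqrt (a i)) (fun i => sqrt (a i) * b (j - i)%nat) (S j)) as H.
    rewrite (rsum_ext _ (fun i => a i * b (j - i)%nat)) in H.
    2:{ intros i _. rewrite <- Rmult_assoc, sqrt_sqrt; auto. }
    rewrite (rsum_ext (fun i => sqrt (a i) ^ 2) a) in H.
    2:{ intros i _. rewrite <- Rsqr_pow2, Rsqr_sqrt; auto. }
    rewrite (rsum_ext (fun i => (sqrt (a i) * b (j - i)%nat) ^ 2) (fun i => a i * b (j - i)%nat ^ 2)) in H.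
    2:{ intros i _. rewrite Rpow_mult_distr, <- (Rsqr_pow2 (sqrt _)), Rsqr_sqrt; auto. }
    eapply Rle_trans; [apply H|]. apply Rmult_le_compat_r.
    + apply rsum_nonneg. intros; apply Rmult_le_pos; auto. apply pow2_ge_0.
    + apply rsum_mono; auto.
  - rewrite rsum_scal. simpl (_ ^ 2) at 2. rewrite Rmult_1_r, Rmult_assoc.
    apply Rmult_le_compat_l; [apply rsum_nonneg; auto|].
    rewrite (rsum_triangle (fun i l => a i * b l ^ 2)), <- rsum_scal_r.
    apply rsum_le. intros i Hi. rewrite rsum_scal.
    apply Rmult_le_compat_l; auto. apply rsum_mono; [intros; apply pow2_ge_0 | lia].
Qed.

Lemma rsum_bounded_cauchy a A : (forall i, 0 <= a i) -> (forall n, rsum a n <= A) ->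
  forall d, 0 < d -> exists N, forall n m, (N <= n <= m)%nat -> rsum a m - rsum a n <= d.
Proof.
  intros Ha HA d Hd.
  destruct (ex_finite_lim_seq_incr (rsum a) A) as [l Hl]; auto.
  { intros n. simpl. specialize (Ha n). lra. }
  apply is_lim_seq_spec in Hl. destruct (Hl (mkposreal (d / 2) ltac:(lra))) as [N HN].
  exists N. intros n m [H1 H2]. simpl in HN.
  pose proof (HN n H1) as A1. pose proof (HN m ltac:(lia)) as A2.
  apply Rabs_def2 in A1. apply Rabs_def2 in A2. lra.
Qed.

(** The left side is the mass of the pairs in the square of side [M] outside the square of side [h].
    It dominates what a truncated Cauchy product misses. *)
Lemma rsum_prod_defect a b A B : (forall i, 0 <= a i) -> (forall i, 0 <= b i) ->
  (forall n, rsum a n <= A) -> (forall n, rsum b n <= B) ->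
  forall d, 0 < d -> exists N, forall h M, (N <= h <= M)%nat ->
    rsum a M * rsum b M - rsum a h * rsum b h <= d.
Proof.
  intros Ha Hb HA HB d Hd.
  assert (A0 : 0 <= A) by (specialize (HA 0%nat); simpl in HA; lra).
  assert (B0 : 0 <= B) by (specialize (HB 0%nat); simpl in HB; lra).
  assert (He : 0 < d / (A + B + 1)) by (apply Rdiv_lt_0_compat; lra).
  set (e := d / (A + B + 1)) in *.
  assert (Ee : e * (A + B + 1) = d) by (unfold e; field; lra).
  destruct (rsum_bounded_cauchy a A Ha HA e He) as [N1 H1].
  destruct (rsum_bounded_cauchy b B Hb HB e He) as [N2 H2].
  exists (N1 + N2)%nat. intros h M Hh.
  specialize (H1 h M ltac:(lia)). specialize (H2 h M ltac:(lia)).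
  pose proof (HA h). pose proof (HB M).
  assert (0 <= rsum a h) by (apply rsum_nonneg; auto).
  assert (0 <= rsum b M) by (apply rsum_nonneg; auto).
  replace (rsum a M * rsum b M - rsum a h * rsum b h)
    with ((rsum a M - rsum a h) * rsum b M + rsum a h * (rsum b M - rsum b h)) by ring.
  assert ((rsum a M - rsum a h) * rsum b M <= e * B).
  { apply Rle_trans with (e * rsum b M); [apply Rmult_le_compat_r; auto | apply Rmult_le_compat_l; lra]. }
  assert (rsum a h * (rsum b M - rsum b h) <= A * e).
  { apply Rle_trans with (rsum a h * e); [apply Rmult_le_compat_l; auto | apply Rmult_le_compat_r; lra]. }
  nra.
Qed.

(** Row [i] of the full product misses the columns from [T - i] on. Truncated subtraction covers the
    rows [i > T] as well: there [T - i = 0] and the whole row is missing. *)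
Lemma cauchy_product_defect a b alpha beta T M :
  (forall i, Cmod (a i) <= alpha i) -> (forall i, Cmod (b i) <= beta i) -> (T <= M)%nat ->
  Cmod (csum a M * csum b M - csum (fun j => csum (fun i => a i * b (j - i)%nat)%C (S j)) T)
  <= rsum (fun i => alpha i * (rsum beta M - rsum beta (T - i))) M.
Proof.
  intros Ha Hb HT.
  rewrite (csum_triangle (fun i l => a i * b l)%C).
  replace (csum (fun i => csum (fun l => a i * b l)%C (T - i)) T)
    with (csum (fun i => csum (fun l => a i * b l)%C (T - i)) M).
  2:{ replace M with (T + (M - T))%nat by lia. rewrite csum_add.
      rewrite (csum_ext (fun i => csum _ (T - (T + i))) (fun _ => RtoC 0)).
      - rewrite csum_zero. ring.
      - intros i _. replace (T - (T + i))%nat with 0%nat by lia. reflexivity. }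
  rewrite <- csum_scal_r, <- csum_minus. apply Cmod_csum_le. intros i Hi.
  rewrite csum_scal.
  replace M with ((T - i) + (M - (T - i)))%nat by lia. rewrite csum_add, rsum_add.
  replace (a i * (csum b (T - i) + csum (fun i0 => b (T - i + i0)%nat) (M - (T - i)))
     - a i * csum b (T - i))%C
    with (a i * csum (fun i0 => b (T - i + i0)%nat) (M - (T - i)))%C by ring.
  rewrite Cmod_mult. apply Rmult_le_compat; try apply Cmod_ge_0; auto.
  replace (rsum beta (T - i) + rsum (fun i0 => beta (T - i + i0)%nat) (M - (T - i)) - rsum beta (T - i))
    with (rsum (fun i0 => beta (T - i + i0)%nat) (M - (T - i))) by ring.
  apply Cmod_csum_le. auto.
Qed.

(** The condition [2 * h <= T + 1] says that the square of side [h] lies inside the triangle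
    [i + l < T]. *)
Lemma triangle_defect_le alpha beta h T M :
  (forall i, 0 <= alpha i) -> (forall i, 0 <= beta i) ->
  (h <= M)%nat -> (2 * h <= T + 1)%nat ->
  rsum (fun i => alpha i * (rsum beta M - rsum beta (T - i))) M
  <= rsum alpha M * rsum beta M - rsum alpha h * rsum beta h.
Proof.
  intros Ha Hb HhM HT.
  rewrite (rsum_ext _ (fun i => alpha i * rsum beta M + (-1) * (alpha i * rsum beta (T - i))))
    by (intros; ring).
  rewrite rsum_plus, rsum_scal_r, rsum_scal.
  assert (rsum alpha h * rsum beta h <= rsum (fun i => alpha i * rsum beta (T - i)) M).
  { rewrite <- rsum_scal_r. apply Rle_trans with (rsum (fun i => alpha i * rsum beta (T - i)) h).
    - apply rsum_le. intros i Hi. apply Rmult_le_compat_l; auto. apply rsum_mono; auto. lia.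
    - apply rsum_mono; auto. intros i. apply Rmult_le_pos; auto. apply rsum_nonneg; auto. }
  lra.
Qed.

(** The order of the quantifiers is the point: [N] depends on the majorant alone, hence the
    convergence is uniform in any parameter hidden in [a], such as [z] or an angle. *)
Lemma CSeries_uniform alpha A : (forall i, 0 <= alpha i) -> (forall n, rsum alpha n <= A) ->
  forall d, 0 < d -> exists N, forall n, (N <= n)%nat -> forall a,
    (forall i, Cmod (a i) <= alpha i) -> Cmod (csum a n - CSeries a) <= d.
Proof.
  intros Ha HA d Hd. destruct (rsum_bounded_cauchy alpha A Ha HA d Hd) as [N HN].
  exists N. intros n Hn a Haa.
  assert (Hs : forall b, (forall i, Rabs (b i) <= alpha i) -> is_lim_seq (rsum b) (Series b)).
  { intros b Hb.
    assert (Es : forall c n, sum_n c n = rsum c (S n)).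
    { intros c m. induction m as [|m IH]; [rewrite sum_O; symmetry; apply Rplus_0_l|].
      rewrite sum_Sn, IH. reflexivity. }
    assert (ex_series alpha) as Hexa.
    { destruct (ex_finite_lim_seq_incr (fun n => rsum alpha (S n)) A) as [l Hl]; auto.
      - intros m. simpl. specialize (Ha (S m)). lra.
      - exists l. apply is_lim_seq_ext with (2 := Hl). intros; now rewrite Es. }
    assert (Hexb : ex_series b).
    { apply (ex_series_le (V := R_CompleteNormedModule) b alpha); auto. }
    apply Series_correct in Hexb.
    apply is_lim_seq_incr_1. apply is_lim_seq_ext with (2 := Hexb). intros; now rewrite Es. }
  assert (H1 := Hs (fun i => Re (a i)) ltac:(intros i; eapply Rle_trans; [apply re_le_Cmod | apply Haa])).
  assert (H2 := Hs (fun i => Im (a i)) ltac:(intros i; eapply Rle_trans; [apply Im_le_Cmod | apply Haa])).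
  apply is_lim_seq_spec in H1. apply is_lim_seq_spec in H2.
  apply Rle_eps_plus with 2; [lra|]. intros e He.
  destruct (H1 (mkposreal e He)) as [N1 K1]. destruct (H2 (mkposreal e He)) as [N2 K2].
  set (m := (n + N1 + N2)%nat).
  specialize (K1 m ltac:(lia)). specialize (K2 m ltac:(lia)). simpl in K1, K2.
  eapply Rle_trans; [apply (Cmod_minus_triangle _ (csum a m))|].
  apply Rplus_le_compat.
  - rewrite Cmod_minus_sym. replace m with (n + (m - n))%nat by lia. rewrite csum_add.
    replace (csum a n + csum (fun i => a (n + i)%nat) (m - n) - csum a n)%C
      with (csum (fun i => a (n + i)%nat) (m - n)) by ring.
    apply Rle_trans with (rsum (fun i => alpha (n + i)%nat) (m - n)).
    + apply Cmod_csum_le. auto.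
    + specialize (HN n m ltac:(lia)). replace m with (n + (m - n))%nat in HN at 1 by lia.
      rewrite rsum_add in HN. lra.
  - eapply Rle_trans; [apply Cmod_Re_Im|].
    replace (Re (csum a m - CSeries a)) with (rsum (fun i => Re (a i)) m - Series (fun i => Re (a i)))
      by (rewrite <- Re_csum; simpl; unfold Re; ring).
    replace (Im (csum a m - CSeries a)) with (rsum (fun i => Im (a i)) m - Series (fun i => Im (a i)))
      by (rewrite <- Im_csum; simpl; unfold Im; ring).
    lra.
Qed.

(** * Exponential of a power series *)

(** Course-of-values recursion: each coefficient needs all the earlier ones, so stage [n] is a table
    of the coefficients up to [n]. *)
Fixpoint expcoef_upto (b : nat -> C) (n : nat) : nat -> C :=
  match n with
  | O => fun _ => 1%R
  | S m => fun j =>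
      if Nat.eq_dec j (S m)
      then (RtoC (/ INR (S m)) *
            csum (fun i => RtoC (INR (S i)) * b i * expcoef_upto b m (m - i)%nat) (S m))%C
      else expcoef_upto b m j
  end.

(* The coefficients of [exp (sum_i b_i z^(i+1))]: note the shift of index in [b].
   They come from [F' = (sum_i b_i z^(i+1))' F]. *)
Definition expcoef (b : nat -> C) (j : nat) : C := expcoef_upto b j j.

Lemma expcoef_upto_eq b n j : (j <= n)%nat -> expcoef_upto b n j = expcoef b j.
Proof.
  induction n as [|n IH]; intros H.
  - now replace j with 0%nat by lia.
  - destruct (Nat.eq_dec j (S n)) as [->|Hj]; [reflexivity|].
    cbn [expcoef_upto]. destruct (Nat.eq_dec j (S n)); [congruence|]. apply IH. lia.
Qed.

Lemma expcoef_0 b : expcoef b 0 = 1%R.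
Proof. reflexivity. Qed.

Lemma expcoef_S b m :
  (RtoC (INR (S m)) * expcoef b (S m))%C
  = csum (fun i => RtoC (INR (S i)) * b i * expcoef b (m - i)%nat)%C (S m).
Proof.
  unfold expcoef at 1. cbn [expcoef_upto].
  destruct (Nat.eq_dec (S m) (S m)); [|congruence].
  rewrite Cmult_assoc, <- RtoC_mult, Rinv_r by (apply not_0_INR; lia).
  rewrite Cmult_1_l. apply csum_ext. intros i Hi. now rewrite expcoef_upto_eq by lia.
Qed.

(** Applied to bounds on [Cmod (b i)], this is the coefficientwise majorant of the complex
    exponential series. *)
Definition rexpcoef (b : nat -> R) (j : nat) : R := Re (expcoef (fun i => RtoC (b i)) j).

Lemma rexpcoef_0 b : rexpcoef b 0 = 1.
Proof. reflexivity. Qed.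

Lemma expcoef_RtoC b j : expcoef (fun i => RtoC (b i)) j = RtoC (rexpcoef b j).
Proof.
  induction j as [j IH] using lt_wf_ind. destruct j as [|m]; [reflexivity|].
  assert (E : exists x, expcoef (fun i => RtoC (b i)) (S m) = RtoC x).
  { exists (/ INR (S m) * rsum (fun i => INR (S i) * b i * rexpcoef b (m - i)%nat) (S m)).
    pose proof (expcoef_S (fun i => RtoC (b i)) m) as H.
    rewrite (csum_ext _ (fun i => RtoC (INR (S i) * b i * rexpcoef b (m - i)%nat))) in H.
    - rewrite csum_RtoC in H. rewrite RtoC_mult, <- H, Cmult_assoc, <- RtoC_mult.
      rewrite Rinv_l by (apply not_0_INR; lia). ring.
    - intros i Hi. rewrite IH by lia. now rewrite !RtoC_mult. }
  destruct E as [x E]. unfold rexpcoef. rewrite E. reflexivity.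
Qed.

Lemma rexpcoef_S b m :
  INR (S m) * rexpcoef b (S m) = rsum (fun i => INR (S i) * b i * rexpcoef b (m - i)%nat) (S m).
Proof.
  apply RtoC_inj. rewrite RtoC_mult, <- expcoef_RtoC, expcoef_S, <- csum_RtoC.
  apply csum_ext. intros i _. now rewrite !RtoC_mult, expcoef_RtoC.
Qed.

Lemma rexpcoef_nonneg b : (forall i, 0 <= b i) -> forall j, 0 <= rexpcoef b j.
Proof.
  intros Hb j. induction j as [j IH] using lt_wf_ind. destruct j as [|m].
  - rewrite rexpcoef_0. lra.
  - assert (0 < INR (S m)) by (apply lt_0_INR; lia).
    apply Rmult_le_reg_l with (INR (S m)); auto. rewrite Rmult_0_r, rexpcoef_S.
    apply rsum_nonneg. intros i Hi. apply Rmult_le_pos; [|apply IH; lia].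
    apply Rmult_le_pos; auto. apply pos_INR.
Qed.

Lemma Cmod_expcoef_le b beta : (forall i, Cmod (b i) <= beta i) ->
  forall j, Cmod (expcoef b j) <= rexpcoef beta j.
Proof.
  intros Hb j. induction j as [j IH] using lt_wf_ind. destruct j as [|m].
  - rewrite expcoef_0, rexpcoef_0, Cmod_1. lra.
  - assert (0 < INR (S m)) by (apply lt_0_INR; lia).
    apply Rmult_le_reg_l with (INR (S m)); auto. rewrite rexpcoef_S.
    replace (INR (S m) * Cmod (expcoef b (S m)))
      with (Cmod (RtoC (INR (S m)) * expcoef b (S m))%C)
      by (rewrite Cmod_mult, Cmod_R, Rabs_pos_eq; lra).
    rewrite expcoef_S. apply Cmod_csum_le. intros i Hi.
    rewrite !Cmod_mult, Cmod_R, Rabs_pos_eq by apply pos_INR.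
    apply Rmult_le_compat; try apply Cmod_ge_0.
    + apply Rmult_le_pos; [apply pos_INR | apply Cmod_ge_0].
    + apply Rmult_le_compat_l; auto. apply pos_INR.
    + apply IH. lia.
Qed.

Lemma is_derive_rsum (f : nat -> R -> R) (a : nat -> R) n x :
  (forall i, (i < n)%nat -> is_derive (f i) x (a i)) ->
  is_derive (fun t => rsum (fun i => f i t) n) x (rsum a n).
Proof.
  induction n as [|n IH]; intros H; simpl.
  - apply @is_derive_const.
  - apply @is_derive_plus with (K := R_AbsRing) (V := R_NormedModule);
      [apply IH; intros; apply H; lia | apply H; lia].
Qed.

Lemma is_derive_monomial c n x : is_derive (fun t => c * t ^ S n) x (c * INR (S n) * x ^ n).
Proof.
  replace (c * INR (S n) * x ^ n) with (c * (INR (S n) * 1 * x ^ n)) by ring.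
  apply is_derive_scal. apply (is_derive_pow (fun t => t) (S n) x 1). apply @is_derive_id.
Qed.

(* [P' <= B' P] for the truncations [P], [B] of the two series, so [P exp (- B)] decreases. *)
Lemma rsum_rexpcoef_le b J : (forall i, 0 <= b i) ->
  rsum (rexpcoef b) J <= exp (rsum b J).
Proof.
  intros Hb. set (e := rexpcoef b). assert (He : forall j, 0 <= e j) by now apply rexpcoef_nonneg.
  apply Rle_trans with (rsum e (S J)); [apply rsum_mono; auto|].
  set (P := fun x => 1 + rsum (fun j => e (S j) * x ^ S j) J).
  set (B := fun x => rsum (fun i => b i * x ^ S i) J).
  set (P' := fun x => rsum (fun j => e (S j) * INR (S j) * x ^ j) J).
  set (B' := fun x => rsum (fun i => b i * INR (S i) * x ^ i) J).
  assert (HP : forall x, is_derive P x (P' x)).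
  { intros x. unfold P, P'. rewrite <- (Rplus_0_l (rsum _ J)).
    apply @is_derive_plus with (K := R_AbsRing) (V := R_NormedModule);
      [apply @is_derive_const|].
    apply (is_derive_rsum (fun j t => e (S j) * t ^ S j)). intros; apply is_derive_monomial. }
  assert (HB : forall x, is_derive B x (B' x)).
  { intros x. apply (is_derive_rsum (fun j t => b j * t ^ S j)). intros; apply is_derive_monomial. }
  assert (PE : forall x, P x = rsum (fun j => e j * x ^ j) (S J)).
  { intros x. rewrite rsum_S_l. unfold P, e. rewrite rexpcoef_0. simpl (x ^ 0). ring. }
  (* By the recursion, [P'] is the part [i + l < J] of the product [B' P]; the remaining products
     are nonnegative. *)
  assert (Hle : forall x, 0 <= x <= 1 -> P' x <= B' x * P x).
  { intros x Hx. unfold P'.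
    rewrite (rsum_ext _ (fun j => rsum (fun i => (b i * INR (S i) * x ^ i)
      * (e (j - i)%nat * x ^ (j - i))) (S j))).
    - rewrite (rsum_triangle (fun i l => (b i * INR (S i) * x ^ i) * (e l * x ^ l))).
      unfold B'. rewrite <- rsum_scal_r. apply rsum_le. intros i Hi.
      rewrite rsum_scal. apply Rmult_le_compat_l.
      + apply Rmult_le_pos; [|apply pow_le; lra]. apply Rmult_le_pos; auto. apply pos_INR.
      + rewrite PE. apply rsum_mono; [|lia]. intros l. apply Rmult_le_pos; auto. apply pow_le; lra.
    - intros j Hj. rewrite (Rmult_comm (e (S j))). unfold e at 1. rewrite rexpcoef_S.
      rewrite <- rsum_scal_r. apply rsum_ext. intros i Hi.
      replace j with (i + (j - i))%nat at 2 by lia. rewrite pow_add. unfold e. ring. }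
  assert (D : - (P 0 * exp (- B 0)) <= - (P 1 * exp (- B 1))).
  { apply (derive_nonneg_le (fun x => - (P x * exp (- B x)))
      (fun x => - (P' x * exp (- B x) + P x * (- B' x * exp (- B x))))); [lra| |].
    - intros x _. apply @is_derive_opp with (K := R_AbsRing) (V := R_NormedModule).
      apply (is_derive_mult P (fun x => exp (- B x))); auto.
      + apply (is_derive_comp (V := R_NormedModule) exp (fun x => - B x)).
        * apply is_derive_exp.
        * apply @is_derive_opp with (K := R_AbsRing) (V := R_NormedModule). auto.
      + intros; apply Rmult_comm.
    - intros x Hx. specialize (Hle x Hx). pose proof (exp_pos (- B x)). nra. }
  assert (B0 : B 0 = 0).
  { unfold B. rewrite (rsum_ext _ (fun _ => 0)); [apply rsum_zero|]. intros. simpl. ring. }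
  assert (P0 : P 0 = 1).
  { unfold P. rewrite (rsum_ext _ (fun _ => 0)); [rewrite rsum_zero; ring|]. intros. simpl. ring. }
  assert (B1 : B 1 = rsum b J).
  { unfold B. apply rsum_ext. intros. rewrite pow1. ring. }
  assert (P1 : P 1 = rsum e (S J)).
  { rewrite PE. apply rsum_ext. intros. rewrite pow1. ring. }
  rewrite B0, P0, B1, P1, Ropp_0, exp_0 in D.
  assert (rsum e (S J) * exp (- rsum b J) <= 1) by lra.
  apply Rmult_le_reg_r with (exp (- rsum b J)); [apply exp_pos|].
  rewrite <- exp_plus, Rplus_opp_r, exp_0. auto.
Qed.

Lemma Cderiv_monomial c n x :
  Cderiv (fun t => c * RtoC (t ^ S n))%C x (RtoC (INR (S n)) * c * RtoC (x ^ n))%C.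
Proof.
  replace (RtoC (INR (S n)) * c * RtoC (x ^ n))%C with (c * RtoC (1 * INR (S n) * x ^ n))%C
    by (rewrite !RtoC_mult; ring).
  apply Cderiv_scal, Cderiv_RtoC.
  apply is_derive_ext with (fun t => 1 * t ^ S n); [intros; apply Rmult_1_l|].
  apply is_derive_monomial.
Qed.

(** Along the segment from 0 to [z] the truncations satisfy [P' = B' P] up to the products that the
    truncation cuts off, so [P exp (- B)] stays close to 1. One exponential factor of the bound
    comes from [exp (- B)], the other from multiplying back by [exp B]. *)
Lemma expcoef_truncation b beta z J h : (forall i, Cmod (b i) <= beta i) ->
  Cmod z <= 1 -> (2 * h <= J + 1)%nat ->
  Cmod (csum (fun j => expcoef b j * z ^ j)%C (S J) - Cexp (csum (fun i => b i * z ^ S i)%C (S J)))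
  <= exp (rsum beta (S J)) ^ 2 *
     (rsum beta (S J) * rsum (rexpcoef beta) (S J) - rsum beta h * rsum (rexpcoef beta) h).
Proof.
  intros Hb Hz Hh. set (e := expcoef b). set (al := rexpcoef beta).
  assert (Hbeta : forall i, 0 <= beta i) by (intros i; eapply Rle_trans; [apply Cmod_ge_0 | apply Hb]).
  assert (Hal : forall i, 0 <= al i) by now apply rexpcoef_nonneg.
  set (M := S J).
  set (P := fun x => (1%R + csum (fun j => (e (S j) * z ^ S j) * RtoC (x ^ S j)) J)%C).
  set (B := fun x => csum (fun i => (b i * z ^ S i) * RtoC (x ^ S i))%C M).
  set (P' := fun x => csum (fun j => RtoC (INR (S j)) * (e (S j) * z ^ S j) * RtoC (x ^ j))%C J).
  set (B' := fun x => csum (fun i => RtoC (INR (S i)) * (b i * z ^ S i) * RtoC (x ^ i))%C M).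
  assert (HP : forall x, Cderiv P x (P' x)).
  { intros x. unfold P, P'. rewrite <- (Cplus_0_l (csum _ J)).
    apply Cderiv_plus; [apply Cderiv_const|].
    apply (Cderiv_csum (fun j t => (e (S j) * z ^ S j) * RtoC (t ^ S j))%C).
    intros; apply Cderiv_monomial. }
  assert (HB : forall x, Cderiv B x (B' x)).
  { intros x. apply (Cderiv_csum (fun j t => (b j * z ^ S j) * RtoC (t ^ S j))%C).
    intros; apply Cderiv_monomial. }
  assert (PE : forall x, P x = csum (fun j => e j * z ^ j * RtoC (x ^ j))%C M).
  { intros x. unfold M. rewrite csum_S_l. unfold P, e. rewrite expcoef_0.
    simpl (x ^ 0). simpl (z ^ 0)%C. ring. }
  (* Indicator of the missing pairs, those with [i + l >= J]. *)
  set (chi := fun i l => if Nat.ltb l (J - i) then 0 else 1).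
  assert (Hchi : forall i l, 0 <= chi i l) by (intros; unfold chi; destruct (_ <? _)%nat; lra).
  assert (Echi : forall i g, rsum (fun l => chi i l * g l) M = rsum g M - rsum g (J - i)).
  { intros i g. replace M with ((J - i) + (M - (J - i)))%nat by (unfold M; lia).
    rewrite !rsum_add. rewrite (rsum_ext _ (fun _ => 0)), rsum_zero.
    - rewrite (rsum_ext (fun l => chi _ _ * _) (fun l => g (J - i + l)%nat)); [ring|].
      intros l Hl. unfold chi. destruct (Nat.ltb_spec (J - i + l) (J - i)); [lia | ring].
    - intros l Hl. unfold chi. destruct (Nat.ltb_spec l (J - i)); [ring | lia]. }
  (* A primitive that majorizes the defect: its derivative carries the factor [INR (S (i + l))],
     larger than the [INR (S i)] produced by [B'], and its value at 1 is the missing mass without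
     any such weight. *)
  set (Rm := fun x => rsum (fun i => rsum (fun l => beta i * al l * chi i l * x ^ S (i + l)) M) M).
  set (Rm' := fun x => rsum (fun i => rsum (fun l => beta i * al l * chi i l * INR (S (i + l)) * x ^ (i + l)) M) M).
  assert (HR : forall x, is_derive Rm x (Rm' x)).
  { intros x. unfold Rm, Rm'.
    apply (is_derive_rsum (fun i t => rsum (fun l => beta i * al l * chi i l * t ^ S (i + l)) M)).
    intros i _. apply (is_derive_rsum (fun l t => beta i * al l * chi i l * t ^ S (i + l))).
    intros l _. apply is_derive_monomial. }
  assert (Hzp : forall j, Cmod (z ^ j)%C <= 1).
  { intros j. rewrite Cmod_pow. rewrite <- (pow1 j). apply pow_incr. split; [apply Cmod_ge_0 | auto]. }
  assert (Hdef : forall x, 0 <= x <= 1 -> Cmod (B' x * P x - P' x) <= Rm' x).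
  { intros x Hx.
    assert (Hxp : forall j, 0 <= x ^ j) by (intros; apply pow_le; lra).
    assert (EP : P' x = csum (fun j => csum (fun i => (RtoC (INR (S i)) * (b i * z ^ S i) * RtoC (x ^ i))
       * (e (j - i)%nat * z ^ (j - i) * RtoC (x ^ (j - i))))%C (S j)) J).
    { unfold P'. apply csum_ext. intros j Hj. rewrite Cmult_assoc. unfold e at 1.
      rewrite expcoef_S, <- !csum_scal_r. apply csum_ext. intros i Hi.
      replace (S j) with (S i + (j - i))%nat by lia.
      replace j with (i + (j - i))%nat at 3 by lia.
      rewrite Cpow_add_r, pow_add, RtoC_mult. unfold e. ring. }
    rewrite EP, PE. unfold B'.
    eapply Rle_trans; [apply (cauchy_product_defect
      (fun i => RtoC (INR (S i)) * (b i * z ^ S i) * RtoC (x ^ i))%C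
      (fun j => e j * z ^ j * RtoC (x ^ j))%C
      (fun i => INR (S i) * beta i * x ^ i) (fun l => al l * x ^ l)); [| |unfold M; lia]|].
    - intros i. rewrite !Cmod_mult, !Cmod_R, !Rabs_pos_eq; auto using pos_INR.
      apply Rmult_le_compat_r; auto. apply Rmult_le_compat_l; [apply pos_INR|].
      rewrite <- (Rmult_1_r (beta i)). apply Rmult_le_compat; auto using Cmod_ge_0.
    - intros l. rewrite !Cmod_mult, Cmod_R, Rabs_pos_eq; auto.
      apply Rmult_le_compat_r; auto.
      rewrite <- (Rmult_1_r (al l)). apply Rmult_le_compat; auto using Cmod_ge_0.
      now apply Cmod_expcoef_le.
    - unfold Rm'. apply rsum_le. intros i Hi. rewrite <- Echi, <- rsum_scal.
      apply rsum_le. intros l Hl. rewrite pow_add.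
      replace (INR (S i) * beta i * x ^ i * (chi i l * (al l * x ^ l)))
        with (beta i * al l * chi i l * (x ^ i * x ^ l) * INR (S i)) by ring.
      replace (beta i * al l * chi i l * INR (S (i + l)) * (x ^ i * x ^ l))
        with (beta i * al l * chi i l * (x ^ i * x ^ l) * INR (S (i + l))) by ring.
      apply Rmult_le_compat_l; [repeat apply Rmult_le_pos; auto | apply le_INR; lia]. }
  set (K := exp (rsum beta M)).
  assert (HBm : forall x, 0 <= x <= 1 -> Cmod (B x) <= rsum beta M).
  { intros x Hx. apply Cmod_csum_le. intros i _. rewrite !Cmod_mult, Cmod_R.
    rewrite Rabs_pos_eq by (apply pow_le; lra).
    rewrite <- (Rmult_1_r (beta i)), <- (Rmult_1_r (beta i * 1)).
    apply Rmult_le_compat; auto using Cmod_ge_0.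
    - apply Rmult_le_pos; apply Cmod_ge_0.
    - apply pow_le; lra.
    - apply Rmult_le_compat; auto using Cmod_ge_0.
    - rewrite <- (pow1 (S i)). apply pow_incr; lra. }
  assert (HE : forall s x, Rabs s <= 1 -> 0 <= x <= 1 -> Cmod (Cexp (RtoC s * B x)) <= K).
  { intros s x Hs Hx. rewrite Cmod_Cexp. apply exp_le_compat.
    eapply Rle_trans; [apply Rle_abs|]. eapply Rle_trans; [apply re_le_Cmod|].
    rewrite Cmod_mult, Cmod_R. specialize (HBm x Hx).
    pose proof (Cmod_ge_0 (B x)). pose proof (Rabs_pos s). nra. }
  assert (R0 : Rm 0 = 0).
  { unfold Rm. rewrite (rsum_ext _ (fun _ => 0)); [apply rsum_zero|]. intros i _.
    rewrite (rsum_ext _ (fun _ => 0)); [apply rsum_zero|]. intros. simpl. ring. }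
  assert (R1 : Rm 1 <= rsum beta M * rsum al M - rsum beta h * rsum al h).
  { eapply Rle_trans; [|apply (triangle_defect_le beta al h J M); auto; unfold M; lia].
    unfold Rm. right. apply rsum_ext. intros i _. rewrite <- Echi, <- rsum_scal.
    apply rsum_ext. intros l _. rewrite pow1. ring. }
  assert (D : Cmod (P 1 * Cexp (RtoC (-1) * B 1) - P 0 * Cexp (RtoC (-1) * B 0))
              <= K * Rm 1 - K * Rm 0).
  { apply (Cderiv_mean_value (fun x => P x * Cexp (RtoC (-1) * B x))%C
      (fun x => P' x * Cexp (RtoC (-1) * B x) + P x * ((RtoC (-1) * B' x) * Cexp (RtoC (-1) * B x)))%C
      (fun x => K * Rm x) (fun x => K * Rm' x)); [lra| | |].
    - intros x _. apply (Cderiv_mult P (fun x => Cexp (RtoC (-1) * B x))); auto.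
      apply (Cderiv_Cexp (fun x => RtoC (-1) * B x)%C). now apply Cderiv_scal.
    - intros x _. now apply is_derive_scal.
    - intros x Hx.
      replace (P' x * Cexp (RtoC (-1) * B x) + P x * ((RtoC (-1) * B' x) * Cexp (RtoC (-1) * B x)))%C
        with (RtoC (-1) * (Cexp (RtoC (-1) * B x) * (B' x * P x - P' x)))%C by ring.
      rewrite !Cmod_mult, Cmod_R. replace (Rabs (-1)) with 1 by (rewrite Rabs_left; lra).
      rewrite Rmult_1_l. apply Rmult_le_compat; auto using Cmod_ge_0.
      apply HE; auto. rewrite Rabs_left; lra. }
  assert (B0 : B 0 = 0%R).
  { unfold B. rewrite (csum_ext _ (fun _ => RtoC 0)); [apply csum_zero|].
    intros. simpl (0 ^ S i). rewrite Rmult_0_l. ring. }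
  assert (P0 : P 0 = 1%R).
  { unfold P. rewrite (csum_ext _ (fun _ => RtoC 0)); [rewrite csum_zero; ring|].
    intros. simpl (0 ^ S i). rewrite Rmult_0_l. ring. }
  assert (B1 : B 1 = csum (fun i => b i * z ^ S i)%C M).
  { unfold B. apply csum_ext. intros. rewrite pow1. ring. }
  assert (P1 : P 1 = csum (fun j => e j * z ^ j)%C M).
  { rewrite PE. apply csum_ext. intros. rewrite pow1. ring. }
  rewrite B0, P0, R0, Cmult_0_r, Cexp_0, Cmult_1_r, Rmult_0_r, Rminus_0_r in D.
  rewrite <- B1, <- P1.
  replace (P 1 - Cexp (B 1))%C with ((P 1 * Cexp (RtoC (-1) * B 1) - 1%R) * Cexp (RtoC 1 * B 1))%C.
  - rewrite Cmod_mult.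
    assert (H1 : Cmod (Cexp (RtoC 1 * B 1)) <= K) by (apply HE; [rewrite Rabs_R1|]; lra).
    simpl (_ ^ 2). rewrite Rmult_1_r.
    replace (K * K * (rsum beta M * rsum al M - rsum beta h * rsum al h))
      with (K * (rsum beta M * rsum al M - rsum beta h * rsum al h) * K) by ring.
    apply Rmult_le_compat; auto using Cmod_ge_0.
    eapply Rle_trans; [apply D|]. apply Rmult_le_compat_l; auto. left; apply exp_pos.
  - rewrite Cmult_1_l.
    assert (E1 : (Cexp (RtoC (-1) * B 1) * Cexp (B 1))%C = 1%R).
    { rewrite <- Cexp_plus, <- Cexp_0. f_equal. ring. }
    replace ((P 1 * Cexp (RtoC (-1) * B 1) - 1%R) * Cexp (B 1))%C
      with (P 1 * (Cexp (RtoC (-1) * B 1) * Cexp (B 1)) - Cexp (B 1))%C by ring.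
    rewrite E1. ring.
Qed.

(* Power series without constant term; [b i] is the coefficient of [z^(i+1)]. *)
Definition pser (b : nat -> C) (z : C) : C := CSeries (fun i => b i * z ^ S i)%C.

Lemma Cmod_mult_pow_le c z j x : Cmod z <= 1 -> Cmod c <= x -> Cmod (c * z ^ j)%C <= x.
Proof.
  intros Hz Hc. rewrite Cmod_mult, Cmod_pow, <- (Rmult_1_r x).
  apply Rmult_le_compat; auto using Cmod_ge_0, pow_le.
  rewrite <- (pow1 j). apply pow_incr. split; auto using Cmod_ge_0.
Qed.

Lemma Cmod_Cexp_minus a b :
  Cmod (Cexp a - Cexp b) <= exp (Cmod b) * (exp (Cmod (a - b)) - 1).
Proof.
  replace (Cexp a - Cexp b)%C with (Cexp b * (Cexp (a - b) - 1%R))%C.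
  - rewrite Cmod_mult. apply Rmult_le_compat; auto using Cmod_ge_0, Cmod_Cexp_minus_1.
    rewrite Cmod_Cexp. apply exp_le_compat.
    eapply Rle_trans; [apply Rle_abs | apply re_le_Cmod].
  - replace (Cexp a) with (Cexp (b + (a - b))) by (f_equal; ring). rewrite Cexp_plus. ring.
Qed.

Lemma exp_minus_1_le x : 0 <= x <= 1 -> exp x - 1 <= 3 * x.
Proof.
  intros Hx.
  assert (H : 3 * 0 - (exp 0 - 1) <= 3 * x - (exp x - 1)).
  { apply (derive_nonneg_le (fun t => 3 * t - (exp t - 1)) (fun t => 3 - exp t)); [lra| |].
    - intros t _. auto_derive; auto. ring.
    - intros t Ht. assert (exp t <= exp 1) by (apply exp_le_compat; lra).
      pose proof exp_le_3. lra. }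
  rewrite exp_0 in H. lra.
Qed.

(** Uniformity up to the boundary matters: the same statement gives the functions [F] and [G] on the
    circle and the values at points inside the disc. *)
Lemma expcoef_pser b beta A : (forall i, Cmod (b i) <= beta i) -> (forall n, rsum beta n <= A) ->
  forall d, 0 < d -> exists N, forall n, (N <= n)%nat -> forall z, Cmod z <= 1 ->
    Cmod (csum (fun j => expcoef b j * z ^ j)%C n - Cexp (pser b z)) <= d.
Proof.
  intros Hb HA d Hd.
  assert (Hbeta : forall i, 0 <= beta i) by (intros i; eapply Rle_trans; [apply Cmod_ge_0 | apply Hb]).
  assert (A0 : 0 <= A) by (specialize (HA 0%nat); simpl in HA; lra).
  assert (Hal : forall n, rsum (rexpcoef beta) n <= exp A).
  { intros n. eapply Rle_trans; [now apply rsum_rexpcoef_le|]. now apply exp_le_compat. }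
  set (K := exp A). assert (HK : 1 <= K).
  { unfold K. rewrite <- exp_0. now apply exp_le_compat. }
  destruct (rsum_prod_defect beta (rexpcoef beta) A K Hbeta (rexpcoef_nonneg _ Hbeta) HA Hal
    (d / 2 / K ^ 2) ltac:(apply Rdiv_lt_0_compat; [lra | apply pow_lt; lra])) as [N1 H1].
  (* The cap 1 allows [exp x - 1 <= 3 * x]; the other bound gives [K * (3 * e) <= d / 2], because
     [1 <= K]. *)
  set (e := Rmin 1 (d / (6 * K * K))).
  assert (He : 0 < e) by (apply Rmin_pos; [lra | apply Rdiv_lt_0_compat; nra]).
  assert (He1 : e <= 1) by apply Rmin_l.
  assert (He2 : e * (6 * K * K) <= d).
  { apply Rle_trans with (d / (6 * K * K) * (6 * K * K)).
    - apply Rmult_le_compat_r; [nra | apply Rmin_r].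
    - right. field. lra. }
  destruct (CSeries_uniform beta A Hbeta HA e He) as [N2 H2].
  exists (2 * N1 + N2 + 1)%nat. intros n Hn z Hz.
  destruct n as [|J]; [lia|].
  specialize (H2 (S J) ltac:(lia) (fun i => b i * z ^ S i)%C
    (fun i => Cmod_mult_pow_le _ _ _ _ Hz (Hb i))).
  eapply Rle_trans; [apply (Cmod_minus_triangle _ (Cexp (csum (fun i => b i * z ^ S i)%C (S J))))|].
  replace d with (d / 2 + d / 2) by field. apply Rplus_le_compat.
  - eapply Rle_trans; [apply (expcoef_truncation b beta z J N1); auto; lia|].
    specialize (H1 N1 (S J) ltac:(lia)).
    assert (HD : 0 <= rsum beta (S J) * rsum (rexpcoef beta) (S J) - rsum beta N1 * rsum (rexpcoef beta) N1).
    { assert (rsum beta N1 * rsum (rexpcoef beta) N1 <= rsum beta (S J) * rsum (rexpcoef beta) (S J)); [|lra].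
      apply Rmult_le_compat; try (apply rsum_nonneg; intros; auto using rexpcoef_nonneg);
        apply rsum_mono; auto using rexpcoef_nonneg; lia. }
    apply Rle_trans with (K ^ 2 * (d / 2 / K ^ 2)).
    + apply Rmult_le_compat; auto.
      * apply pow2_ge_0.
      * apply pow_incr. split; [left; apply exp_pos | now apply exp_le_compat].
    + right. field. lra.
  - rewrite Cmod_minus_sym.
    eapply Rle_trans; [apply Cmod_Cexp_minus|].
    rewrite Cmod_minus_sym in H2. fold (pser b z) in H2.
    set (x := Cmod (pser b z - csum (fun i => b i * z ^ S i)%C (S J))) in *.
    assert (Hx : exp x - 1 <= 3 * e).
    { apply Rle_trans with (3 * x); [|lra].
      apply exp_minus_1_le. split; [apply Cmod_ge_0 | lra]. }
    assert (HKc : exp (Cmod (csum (fun i => b i * z ^ S i)%C (S J))) <= K).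
    { apply exp_le_compat. eapply Rle_trans; [|apply (HA (S J))]. apply Cmod_csum_le.
      intros i _. now apply Cmod_mult_pow_le. }
    apply Rle_trans with (K * (3 * e)).
    + apply Rmult_le_compat; auto.
      * left; apply exp_pos.
      * assert (1 <= exp x); [|lra]. rewrite <- exp_0. apply exp_le_compat, Cmod_ge_0.
    + nra.
Qed.

Lemma pow_plus_le x y n : 0 <= x -> 0 <= y -> (x + y) ^ n <= 2 ^ n * (x ^ n + y ^ n).
Proof.
  intros Hx Hy. assert (H : forall a c, 0 <= a -> a <= c -> (a + c) ^ n <= 2 ^ n * (a ^ n + c ^ n)).
  { intros a c Ha Hc. apply Rle_trans with ((2 * c) ^ n).
    - apply pow_incr. lra.
    - rewrite Rpow_mult_distr. apply Rmult_le_compat_l; [apply pow_le; lra|].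
      pose proof (pow_le a n Ha). lra. }
  destruct (Rle_dec x y); [apply H; lra|].
  rewrite (Rplus_comm x), (Rplus_comm (x ^ n)). apply H; lra.
Qed.

(** In the recursion, the weight [(m+1)^q] is distributed over the two factors of the convolution at
    the cost of [2^q]. This gives [u], a convolution of [e] with [i^(q+1) b], and [v], a convolution
    of [i b] with [j^q e]; Young's inequality treats both, the first factor being measured in
    [l^1]. *)
Lemma rexpcoef_sobolev b A B k : (forall i, 0 <= b i) -> (forall n, rsum b n <= A) ->
  (forall n, rsum (fun i => (INR (S i) ^ k * b i) ^ 2) n <= B) ->
  forall q, (q <= k)%nat -> exists D, forall n, rsum (fun j => (INR j ^ q * rexpcoef b j) ^ 2) n <= D.
Proof.
  intros Hb HA HB. set (e := rexpcoef b).
  assert (He : forall j, 0 <= e j) by now apply rexpcoef_nonneg.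
  assert (Hel : forall n, rsum e n <= exp A).
  { intros n. eapply Rle_trans; [now apply rsum_rexpcoef_le|]. now apply exp_le_compat. }
  assert (HB' : forall p n, (p <= k)%nat -> rsum (fun i => (INR (S i) ^ p * b i) ^ 2) n <= B).
  { intros p n Hp. eapply Rle_trans; [|apply (HB n)]. apply rsum_le. intros i _.
    apply pow_incr. split; [apply Rmult_le_pos; auto; apply pow_le, pos_INR|].
    apply Rmult_le_compat_r; auto. apply Rle_pow; [|auto]. rewrite S_INR. pose proof (pos_INR i). lra. }
  induction q as [|q IH]; intros Hq.
  - exists (exp A * exp A). intros n.
    apply Rle_trans with (rsum (fun j => e j * exp A) n).
    + apply rsum_le. intros j _. simpl. rewrite Rmult_1_l, Rmult_1_r.
      apply Rmult_le_compat_l; auto. eapply Rle_trans; [|apply (Hel (S j))].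
      apply rsum_term_le; auto.
    + rewrite rsum_scal_r. apply Rmult_le_compat_r; auto. left; apply exp_pos.
  - destruct (IH ltac:(lia)) as [D HD].
    set (u := fun m => rsum (fun i => e i * (INR (S (m - i)) ^ S q * b (m - i)%nat)) (S m)).
    set (v := fun m => rsum (fun i => (INR (S i) * b i) * (INR (m - i) ^ q * e (m - i)%nat)) (S m)).
    assert (Hrec : forall m, INR (S m) ^ S q * e (S m) <= 2 ^ q * (u m + v m)).
    { intros m. simpl (_ ^ S q). rewrite (Rmult_comm (INR (S m))), Rmult_assoc.
      unfold e at 1. rewrite rexpcoef_S. fold e. rewrite <- rsum_scal.
      unfold u.
      rewrite <- (rsum_rev (fun i => e i * (INR (S (m - i)) ^ S q * b (m - i)%nat)) (S m)).
      unfold v. rewrite <- rsum_plus, <- rsum_scal.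
      apply rsum_le. intros i Hi.
      replace (S m - 1 - i)%nat with (m - i)%nat by lia.
      replace (m - (m - i))%nat with i by lia.
      assert (H : INR (S m) ^ q <= 2 ^ q * (INR (S i) ^ q + INR (m - i) ^ q)).
      { replace (S m) with (S i + (m - i))%nat by lia. rewrite plus_INR.
        apply pow_plus_le; apply pos_INR. }
      assert (0 <= INR (S i) * b i * e (m - i)%nat)
        by (repeat apply Rmult_le_pos; auto; apply pos_INR).
      apply Rle_trans with (2 ^ q * (INR (S i) ^ q + INR (m - i) ^ q) * (INR (S i) * b i * e (m - i)%nat)).
      - apply Rmult_le_compat_r; auto.
      - change (INR (S i) ^ S q) with (INR (S i) * INR (S i) ^ q). right. ring. }
    assert (HU : exists Du, forall n, rsum (fun m => u m ^ 2) n <= Du).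
    { exists (exp A ^ 2 * B). intros n. unfold u.
      eapply Rle_trans; [apply (young e (fun i => INR (S i) ^ S q * b i)); auto|].
      { intros i. apply Rmult_le_pos; auto. apply pow_le, pos_INR. }
      apply Rmult_le_compat; auto.
      - apply pow2_ge_0.
      - apply rsum_nonneg; intros; apply pow2_ge_0.
      - apply pow_incr. split; [apply rsum_nonneg; auto | apply Hel]. }
    assert (HV : exists Dv, forall n, rsum (fun m => v m ^ 2) n <= Dv).
    (* For [q = 0] the sequence [i b_i] is only known to be in [l^2] when [k = 1], but then [v] is
       [u] read backwards. For larger [q] one has [2 <= k], which puts [i b_i] in [l^1]. *)
    { destruct q as [|q].
      - destruct HU as [Du HU]. exists Du. intros n.
        rewrite (rsum_ext _ (fun m => u m ^ 2)); auto. intros m _. f_equal. unfold u, v.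
        rewrite <- (rsum_rev _ (S m)). apply rsum_ext. intros i Hi.
        replace (S m - 1 - i)%nat with (m - i)%nat by lia.
        replace (m - (m - i))%nat with i by lia. simpl. ring.
      - assert (Hl : forall n, rsum (fun i => INR (S i) * b i) n <= B / 2 + 1).
        { intros n. apply rsum_le_of_weighted_sqr. rewrite (rsum_ext _ (fun i => (INR (S i) ^ 2 * b i) ^ 2)).
          - apply HB'. lia.
          - intros i _. simpl. ring. }
        exists ((B / 2 + 1) ^ 2 * D). intros n. unfold v.
        assert (Hp : forall i, 0 <= INR (S i) * b i) by (intros; apply Rmult_le_pos; auto; apply pos_INR).
        eapply Rle_trans; [apply (young (fun i => INR (S i) * b i) (fun i => INR i ^ S q * e i)); auto|].
        { intros i. apply Rmult_le_pos; auto. apply pow_le, pos_INR. }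
        apply Rmult_le_compat; auto.
        + apply pow2_ge_0.
        + apply rsum_nonneg; intros; apply pow2_ge_0.
        + apply pow_incr. split; [apply rsum_nonneg; auto | apply Hl]. }
    destruct HU as [Du HU], HV as [Dv HV].
    exists ((2 ^ q) ^ 2 * (2 * Du + 2 * Dv)). intros n.
    apply Rle_trans with (rsum (fun j => (INR j ^ S q * e j) ^ 2) (S n)).
    { apply rsum_mono; [intros; apply pow2_ge_0 | lia]. }
    rewrite rsum_S_l. replace ((INR 0 ^ S q * e 0%nat) ^ 2) with 0 by (simpl; ring).
    rewrite Rplus_0_l.
    apply Rle_trans with (rsum (fun m => (2 ^ q) ^ 2 * (2 * u m ^ 2 + 2 * v m ^ 2)) n).
    + apply rsum_le. intros m _. apply Rle_trans with ((2 ^ q * (u m + v m)) ^ 2).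
      * apply pow_incr. split; auto. apply Rmult_le_pos; auto. apply pow_le, pos_INR.
      * rewrite Rpow_mult_distr. apply Rmult_le_compat_l; [apply pow2_ge_0|].
        pose proof (pow2_ge_0 (u m - v m)). lra.
    + rewrite rsum_scal. apply Rmult_le_compat_l; [apply pow2_ge_0|].
      rewrite rsum_plus, !rsum_scal. specialize (HU n); specialize (HV n). lra.
Qed.

(** * Fourier series of Lipschitz functions *)

Lemma fourier_derive (f f' : R -> R) l :
  (forall x, is_derive f x (f' x)) -> Rcont f' -> periodic2pi f ->
  fourier f' l = (Ci * RtoC (IZR l) * fourier f l)%C.
Proof.
  intros Hd Hc Hp. assert (Hf : Rcont f) by now apply Rcont_derive with f'.
  rewrite !fourier_coef. set (e := fun t => eit (- IZR l * t)).
  assert (Hg : Ccont (fun t => RtoC (f' t) * e t)%C)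
    by (apply Ccont_mult_eit; now apply Ccont_RtoC).
  assert (Hh : Ccont (fun t => RtoC (f t) * e t)%C)
    by (apply Ccont_mult_eit; now apply Ccont_RtoC).
  assert (E : cmean (fun t => RtoC (f' t) * e t + (- (Ci * RtoC (IZR l))) * (RtoC (f t) * e t))%C = 0%R).
  { apply cmean_derive with (fun t => RtoC (f t) * e t)%C.
    - intros x.
      replace (RtoC (f' x) * e x + (- (Ci * RtoC (IZR l))) * (RtoC (f x) * e x))%C
        with (RtoC (f' x) * e x + RtoC (f x) * (Ci * RtoC (- IZR l) * e x))%C
        by (rewrite RtoC_opp; ring).
      apply (Cderiv_mult (fun t => RtoC (f t)) e); [now apply Cderiv_RtoC | apply Cderiv_eit].
    - apply Ccont_plus; auto. apply Ccont_mult; auto using Ccont_const.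
    - unfold e. rewrite <- opp_IZR. replace PI with (- PI + 2 * PI) at 1 2 by ring.
      now rewrite Hp, eit_period. }
  rewrite cmean_plus, cmean_scal in E; auto.
  2:{ apply Ccont_mult; auto using Ccont_const. }
  unfold coef, e in *. 
  match type of E with (?a + _)%C = _ => replace a with ((a + (- (Ci * RtoC (IZR l))) *
    cmean (fun t => RtoC (f t) * eit (- IZR l * t))%C) + Ci * RtoC (IZR l) *
    cmean (fun t => RtoC (f t) * eit (- IZR l * t))%C)%C by ring end.
  rewrite E. ring.
Qed.

Definition Lipschitz (L : R) (f : R -> R) : Prop :=
  forall x y, Rabs (f x - f y) <= L * Rabs (x - y).

Lemma Lipschitz_const_nonneg L f : Lipschitz L f -> 0 <= L.
Proof.
  intros H. specialize (H 1 0). rewrite Rminus_0_r, Rabs_R1, Rmult_1_r in H.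
  eapply Rle_trans; [apply Rabs_pos | apply H].
Qed.

Lemma Cmod_eit_minus_1 y : Cmod (eit y - 1%R) <= Rabs y.
Proof.
  assert (H : forall a, Cmod (eit (a * 1) - eit (a * 0)) <= Rabs a * 1 - Rabs a * 0).
  { intros a. apply (Cderiv_mean_value (fun t => eit (a * t)) (fun t => Ci * RtoC a * eit (a * t))%C
      (fun t => Rabs a * t) (fun _ => Rabs a)); [lra| | |].
    - intros; apply Cderiv_eit.
    - intros x _. auto_derive; auto. ring.
    - intros x _. rewrite !Cmod_mult, Cmod_Ci, Cmod_R, Cmod_eit. lra. }
  specialize (H y). rewrite !Rmult_0_r, !Rmult_1_r, eit_0 in H. lra.
Qed.

Lemma Cmod_eit_minus_linear a h : 0 <= h ->
  Cmod (eit (a * h) - 1%R - Ci * RtoC (a * h)) <= a ^ 2 * h ^ 2.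
Proof.
  intros Hh.
  assert (H : Cmod ((eit (a * h) + (- (Ci * RtoC a)) * RtoC h)
                    - (eit (a * 0) + (- (Ci * RtoC a)) * RtoC 0)) <= a ^ 2 / 2 * h ^ 2 - a ^ 2 / 2 * 0 ^ 2).
  { apply (Cderiv_mean_value (fun t => eit (a * t) + (- (Ci * RtoC a)) * RtoC t)%C
      (fun t => Ci * RtoC a * eit (a * t) + (- (Ci * RtoC a)) * 1%R)%C
      (fun t => a ^ 2 / 2 * t ^ 2) (fun t => a ^ 2 * t)); auto.
    - intros x _. apply Cderiv_plus; [apply Cderiv_eit|].
      apply Cderiv_scal, Cderiv_RtoC. apply @is_derive_id.
    - intros x _. auto_derive; auto. field.
    - intros x Hx.
      replace (Ci * RtoC a * eit (a * x) + (- (Ci * RtoC a)) * 1%R)%C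
        with (Ci * RtoC a * (eit (a * x) - 1%R))%C by ring.
      rewrite !Cmod_mult, Cmod_Ci, Cmod_R, Rmult_1_l.
      apply Rle_trans with (Rabs a * Rabs (a * x)).
      + apply Rmult_le_compat_l; [apply Rabs_pos | apply Cmod_eit_minus_1].
      + rewrite Rabs_mult, (Rabs_pos_eq x), <- Rmult_assoc, <- Rabs_mult by lra.
        rewrite (Rabs_pos_eq (a * a)) by nra. lra. }
  rewrite Rmult_0_r, eit_0 in H.
  replace (eit (a * h) - 1%R - Ci * RtoC (a * h))%C
    with (eit (a * h) + (- (Ci * RtoC a)) * RtoC h - (1%R + (- (Ci * RtoC a)) * RtoC 0))%C
    by (rewrite RtoC_mult; ring).
  pose proof (pow2_ge_0 a). pose proof (pow2_ge_0 h). nra.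
Qed.

(** * Difference quotients of Lipschitz functions and square-summability of [j f_j] *)

Definition diffquot (f : R -> R) (h t : R) : R := (f (t + h) - f t) / h.

Lemma diffquot_le f L h : Lipschitz L f -> 0 < h -> forall t, Rabs (diffquot f h t) <= L.
Proof.
  intros HL Hh t. unfold diffquot, Rdiv. rewrite Rabs_mult, Rabs_inv, (Rabs_pos_eq h) by lra.
  apply Rmult_le_reg_r with h; auto. rewrite Rmult_assoc, Rinv_l, Rmult_1_r by lra.
  eapply Rle_trans; [apply HL|]. replace (t + h - t) with h by ring.
  rewrite Rabs_pos_eq; lra.
Qed.

Lemma Rcont_diffquot f h : Rcont f -> Rcont (diffquot f h).
Proof.
  intros Hf. apply Rcont_mult; [|apply Rcont_const]. apply Rcont_minus; auto.
  apply (Rcont_comp (fun t => t + h) f); auto using Rcont_affine.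
Qed.

Lemma fourier_diffquot f h l : Rcont f -> periodic2pi f -> h <> 0 ->
  fourier (diffquot f h) l = (RtoC (/ h) * (eit (IZR l * h) - 1%R) * fourier f l)%C.
Proof.
  intros Hf Hp Hh. rewrite !fourier_coef.
  rewrite (coef_ext _ (fun t => RtoC (/ h) * (RtoC (f (t + h)%R) - RtoC (f t)))%C).
  2:{ intros t. unfold diffquot, Rdiv. rewrite RtoC_mult, RtoC_minus. ring. }
  assert (Hc : Ccont (fun t => RtoC (f t))) by now apply Ccont_RtoC.
  assert (Hc' : Ccont (fun t => RtoC (f (t + h)))) by now apply (Ccont_translate (fun t => RtoC (f t))).
  rewrite coef_scal by now apply Ccont_minus.
  rewrite coef_minus by auto.
  rewrite (coef_translate (fun t => RtoC (f t))); auto; [ring|].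
  intros t. now rewrite Hp.
Qed.

(** The Fourier multiplier of the difference quotient is within [O(h)] of that of the derivative at
    a fixed frequency. This suffices, as only finitely many frequencies are present when [h] tends
    to 0. *)
Lemma Cmod_eit_quotient a h : 0 < h ->
  Cmod (RtoC (/ h) * (eit (a * h) - 1%R) - Ci * RtoC a) <= a ^ 2 * h.
Proof.
  intros Hh.
  replace (RtoC (/ h) * (eit (a * h) - 1%R) - Ci * RtoC a)%C
    with (RtoC (/ h) * (eit (a * h) - 1%R - Ci * RtoC (a * h)))%C.
  - rewrite Cmod_mult, Cmod_R, Rabs_pos_eq by (left; now apply Rinv_0_lt_compat).
    apply Rle_trans with (/ h * (a ^ 2 * h ^ 2)).
    + apply Rmult_le_compat_l; [left; now apply Rinv_0_lt_compat|].
      apply Cmod_eit_minus_linear. lra.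
    + right. field. lra.
  - rewrite RtoC_mult.
    assert (E : (RtoC (/ h) * RtoC h)%C = 1%R) by (rewrite <- RtoC_mult, Rinv_l by lra; reflexivity).
    replace (RtoC (/ h) * (eit (a * h) - 1%R - Ci * (RtoC a * RtoC h)))%C
      with (RtoC (/ h) * (eit (a * h) - 1%R) - Ci * RtoC a * (RtoC (/ h) * RtoC h))%C by ring.
    rewrite E. ring.
Qed.

Lemma periodic_diffquot f h : periodic2pi f -> periodic2pi (diffquot f h).
Proof.
  intros H t. unfold diffquot. replace (t + 2 * PI + h) with (t + h + 2 * PI) by ring.
  now rewrite !H.
Qed.

(* Bessel's inequality for the difference quotients replaces the missing derivative. *)
Lemma fourier_lipschitz_sqr_sum f L (iota : nat -> Z) n :
  Lipschitz L f -> periodic2pi f -> (forall i j, iota i = iota j -> i = j) ->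
  rsum (fun i => (Rabs (IZR (iota i)) * Cmod (fourier f (iota i))) ^ 2) n <= L ^ 2.
Proof.
  intros HL Hp Hi. assert (Hf : Rcont f) by now apply Rcont_Lipschitz with L.
  set (c := fun i => Cmod (fourier f (iota i))). set (a := fun i => IZR (iota i)).
  set (s := fun i => Rabs (a i) * c i).
  assert (Hc : forall i, 0 <= c i) by (intros; apply Cmod_ge_0).
  assert (Hs : forall i, 0 <= s i) by (intros; apply Rmult_le_pos; auto; apply Rabs_pos).
  apply Rle_eps_plus with (rsum (fun i => 2 * s i * (a i ^ 2 * c i)) n).
  { apply rsum_nonneg. intros i _. apply Rmult_le_pos.
    - apply Rmult_le_pos; [lra | apply Hs].
    - apply Rmult_le_pos; [apply pow2_ge_0 | apply Hc]. }
  intros h Hh.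
  pose proof (bessel iota Hi n (fun t => RtoC (diffquot f h t))
    (Ccont_RtoC _ (Rcont_diffquot f h Hf))) as B.
  assert (HB : sqnorm (fun t => RtoC (diffquot f h t)) <= L ^ 2).
  { apply sqnorm_bounded; [now apply Ccont_RtoC, Rcont_diffquot|].
    intros t _. rewrite Cmod_R. now apply diffquot_le. }
  rewrite Rmult_comm, <- rsum_scal.
  apply Rle_trans with (rsum (fun i => Cmod (coef (fun t => RtoC (diffquot f h t)) (iota i)) ^ 2
     + h * (2 * s i * (a i ^ 2 * c i))) n).
  - apply rsum_le. intros i _. rewrite <- fourier_coef, fourier_diffquot by (auto; lra).
    rewrite Cmod_mult. fold (c i) (a i).
    set (w := Cmod (RtoC (/ h) * (eit (a i * h) - 1%R))).
    assert (Hw : Rabs (a i) <= w + a i ^ 2 * h).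
    { pose proof (Cmod_eit_quotient (a i) h Hh) as Q.
      pose proof (Cmod_triangle (RtoC (/ h) * (eit (a i * h) - 1%R))
        (- (RtoC (/ h) * (eit (a i * h) - 1%R) - Ci * RtoC (a i)))) as T.
      replace (RtoC (/ h) * (eit (a i * h) - 1%R) +
        - (RtoC (/ h) * (eit (a i * h) - 1%R) - Ci * RtoC (a i)))%C with (Ci * RtoC (a i))%C in T by ring.
      rewrite Cmod_opp, Cmod_mult, Cmod_Ci, Cmod_R in T. fold w in T. lra. }
    assert (0 <= w) by apply Cmod_ge_0.
    assert (Hsw : s i <= w * c i + a i ^ 2 * h * c i).
    { unfold s. specialize (Hc i). nra. }
    change (Rabs (a i) * c i) with (s i). specialize (Hs i). specialize (Hc i).
    assert (0 <= a i ^ 2 * c i) by (apply Rmult_le_pos; auto; apply pow2_ge_0).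
    set (x := s i) in *. set (y := w * c i) in *. set (z := a i ^ 2 * c i) in *.
    assert (0 <= y) by (apply Rmult_le_pos; auto).
    assert (Hxy : x <= y + z * h) by (unfold z; lra).
    clearbody x y z.
    (* From [x <= y + z * h] one gets [x ^ 2 <= y ^ 2 + h * (2 * x * z)], where the coefficient of
       [h] no longer involves [y], hence not [h] itself. *)
    destruct (Rle_dec x y) as [Hle|Hgt].
    + assert (x ^ 2 <= y ^ 2) by (apply pow_incr; lra).
      assert (0 <= h * (2 * x * z)) by (repeat apply Rmult_le_pos; lra). lra.
    + assert ((x - y) * (x + y) <= (z * h) * (2 * x)) by (apply Rmult_le_compat; lra).
      replace (x ^ 2) with ((x - y) * (x + y) + y ^ 2) by ring.
      replace (h * (2 * x * z)) with (z * h * (2 * x)) by ring. lra.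
  - rewrite rsum_plus. lra.
Qed.

Lemma fourier_abs_sum f L n : Lipschitz L f -> periodic2pi f ->
  rsum (fun i => Cmod (fourier f (Z.of_nat (S i)))) n <= L ^ 2 / 2 + 1.
Proof.
  intros HL Hp. apply rsum_le_of_weighted_sqr.
  eapply Rle_trans; [|apply (fourier_lipschitz_sqr_sum f L (fun i => Z.of_nat (S i)) n HL Hp); intros; lia].
  right. apply rsum_ext. intros i _. rewrite <- INR_IZR_INZ, Rabs_pos_eq; auto. apply pos_INR.
Qed.

(** * The one-sided Dirichlet kernel and its logarithmic mean *)

Definition dirichlet (m : nat) (x : R) : C := csum (fun j => eit (INR j * x)) m.

(** Merges the bounds [m] and [6 / |x|] on the kernel, whence [7 = 1 + 6], into one continuous
    function with an explicit primitive on each side of 0. *)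
Definition dirichlet_majorant (m : nat) (x : R) : R := 7 / (/ INR m + Rabs x).

(** Up to [PI / 3] the cosine is at least 1/2, so [sin t - t / 3] increases; beyond, the sine is at
    least [sqrt 3 / 2], while [y / 3] is at most [PI / 6]. *)
Lemma sin_ge_third y : 0 <= y <= PI / 2 -> y / 3 <= sin y.
Proof.
  intros Hy. pose proof PI_RGT_0.
  destruct (Rle_dec y (PI / 3)).
  - assert (H1 : sin 0 - 0 / 3 <= sin y - y / 3).
    { apply (derive_nonneg_le (fun t => sin t - t / 3) (fun t => cos t - / 3)); [lra| |].
      - intros t _. auto_derive; auto. field.
      - intros t Ht. assert (cos (PI / 3) <= cos t) by (apply cos_decr_1; lra).
        rewrite cos_PI3 in H0. lra. }
    rewrite sin_0 in H1. lra.
  - assert (sin (PI / 3) <= sin y) by (apply sin_incr_1; lra).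
    rewrite sin_PI3 in H0.
    assert (1.7 < sqrt 3).
    { apply Rsqr_incrst_0; [|lra|apply sqrt_pos]. rewrite Rsqr_sqrt by lra. unfold Rsqr. lra. }
    pose proof PI_4. lra.
Qed.

Lemma Cmod_eit_minus_1_ge x : - PI <= x <= PI -> Rabs x / 3 <= Cmod (eit x - 1%R).
Proof.
  intros Hx. apply Rle_of_sqr_le; [apply Cmod_ge_0|].
  rewrite Cmod2_alt, eit_alt. simpl Re; simpl Im.
  assert (H : Rabs x / 3 <= 2 * sin (Rabs x / 2)).
  { pose proof (sin_ge_third (Rabs x / 2)) as S.
    assert (0 <= Rabs x <= PI) by (split; [apply Rabs_pos | apply Rabs_le; lra]). lra. }
  assert (E : (cos x + - (1)) ^ 2 + (sin x + - 0) ^ 2 = (2 * sin (Rabs x / 2)) ^ 2).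
  { pose proof (sin2_cos2 x) as P. unfold Rsqr in P.
    assert (Ec : cos x = cos (2 * (Rabs x / 2))).
    { replace (2 * (Rabs x / 2)) with (Rabs x) by field. unfold Rabs. destruct (Rcase_abs x); auto.
      now rewrite cos_neg. }
    rewrite cos_2a_sin in Ec. nra. }
  rewrite E. apply pow_incr. pose proof (Rabs_pos x). lra.
Qed.

(** The geometric sum telescopes against [eit x - 1]. The second bound is kept apart for Fejér's
    kernel, where the Lipschitz factor [|x|] absorbs one of two Dirichlet kernels. *)
Lemma dirichlet_bounds m x : (1 <= m)%nat -> - PI <= x <= PI ->
  Cmod (dirichlet m x) <= dirichlet_majorant m x /\ Rabs x * Cmod (dirichlet m x) <= 6.
Proof.
  intros Hm Hx. set (D := dirichlet m x).
  assert (HmR : 0 < INR m) by (apply lt_0_INR; lia).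
  assert (H1 : Cmod D <= INR m).
  { rewrite <- (Rmult_1_r (INR m)), <- rsum_const. apply Cmod_csum_le. intros; rewrite Cmod_eit. lra. }
  assert (H2 : (D * (eit x - 1%R))%C = (eit (INR m * x) - 1%R)%C).
  { unfold D, dirichlet. clear. induction m as [|m IH]; cbn [csum].
    - simpl INR. rewrite Rmult_0_l, eit_0. ring.
    - rewrite Cmult_plus_distr_r, IH, S_INR, Rmult_plus_distr_r, Rmult_1_l, eit_plus. ring. }
  assert (H3 : Cmod D * (Rabs x / 3) <= 2).
  { apply Rle_trans with (Cmod D * Cmod (eit x - 1%R)).
    - apply Rmult_le_compat_l; [apply Cmod_ge_0 | now apply Cmod_eit_minus_1_ge].
    - rewrite <- Cmod_mult, H2. eapply Rle_trans; [apply Cmod_sub_le|].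
      rewrite Cmod_eit, Cmod_1. lra. }
  split; [|lra]. unfold dirichlet_majorant.
  assert (0 < / INR m) by now apply Rinv_0_lt_compat. pose proof (Rabs_pos x).
  apply Rmult_le_reg_r with (/ INR m + Rabs x); [lra|].
  unfold Rdiv. rewrite Rmult_assoc, Rinv_l, Rmult_1_r by lra.
  assert (Cmod D * / INR m <= INR m * / INR m) by (apply Rmult_le_compat_r; lra).
  rewrite Rinv_r in H4 by lra. lra.
Qed.

Lemma Rcont_dirichlet_majorant m : (1 <= m)%nat -> Rcont (dirichlet_majorant m).
Proof.
  intros Hm. assert (HmR : 0 < / INR m) by (apply Rinv_0_lt_compat, lt_0_INR; lia).
  apply Rcont_mult; [apply Rcont_const|]. intros x.
  apply (continuous_comp (fun x => / INR m + Rabs x) Rinv).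
  - apply Rcont_plus; [apply Rcont_const | intros y; apply continuous_Rabs].
  - apply continuous_Rinv. pose proof (Rabs_pos x). lra.
Qed.

Lemma mean_dirichlet_majorant m : (1 <= m)%nat ->
  mean (dirichlet_majorant m) <= 14 * ln (INR m + 1).
Proof.
  intros Hm. pose proof PI_RGT_0 as HPI. pose proof PI2_1 as HPI2.
  assert (HmR : 1 <= INR m) by (apply (le_INR 1); auto).
  assert (Hi : 0 < / INR m) by (apply Rinv_0_lt_compat; lra).
  pose proof (Rcont_dirichlet_majorant m Hm) as Hc.
  assert (I1 : RInt (dirichlet_majorant m) 0 PI = 7 * ln (1 + PI * INR m)).
  { rewrite (is_RInt_unique (V := R_CompleteNormedModule) _ 0 PI
      (minus (7 * ln (/ INR m + PI)) (7 * ln (/ INR m + 0)))).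
    - unfold minus, plus, opp; simpl. rewrite Rplus_0_r, ln_Rinv by lra.
      replace (1 + PI * INR m) with ((/ INR m + PI) * INR m) by (field; lra).
      rewrite ln_mult by lra. ring.
    - apply (is_RInt_derive (V := R_CompleteNormedModule) (fun x => 7 * ln (/ INR m + x))); auto.
      intros x. rewrite Rmin_left, Rmax_right by lra. intros Hx.
      unfold dirichlet_majorant. rewrite (Rabs_pos_eq x) by lra.
      auto_derive; [lra|]. unfold Rdiv, Rminus. ring. }
  assert (I2 : RInt (dirichlet_majorant m) (- PI) 0 = 7 * ln (1 + PI * INR m)).
  { rewrite (is_RInt_unique (V := R_CompleteNormedModule) _ (- PI) 0
      (minus (- 7 * ln (/ INR m - 0)) (- 7 * ln (/ INR m - - PI)))).
    - unfold minus, plus, opp; simpl. rewrite Rminus_0_r, ln_Rinv by lra.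
      replace (1 + PI * INR m) with ((/ INR m - - PI) * INR m) by (field; lra).
      rewrite ln_mult by lra. ring.
    - apply (is_RInt_derive (V := R_CompleteNormedModule) (fun x => - 7 * ln (/ INR m - x))); auto.
      intros x. rewrite Rmin_left, Rmax_right by lra. intros Hx.
      unfold dirichlet_majorant. rewrite (Rabs_left1 x) by lra.
      auto_derive; [lra|]. unfold Rdiv, Rminus. ring. }
  pose proof (RInt_Chasles (V := R_CompleteNormedModule) (dirichlet_majorant m) (- PI) 0 PI
    (Rcont_ex_RInt _ _ _ Hc) (Rcont_ex_RInt _ _ _ Hc)) as Ch.
  unfold plus in Ch; simpl in Ch. rewrite I1, I2 in Ch.
  unfold mean. rewrite <- Ch.
  (* Since [1 + 4 m <= (m + 1)^4]. The two half-periods then total [56 ln (m + 1)], and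
     [1 / (2 PI) <= 1/4] leaves the constant 14. *)
  assert (H4 : ln (1 + PI * INR m) <= 4 * ln (INR m + 1)).
  { replace (4 * ln (INR m + 1)) with (ln ((INR m + 1) ^ 4)) by (rewrite ln_pow by lra; simpl; ring).
    apply ln_le; [nra|]. pose proof PI_4.
    assert (1 + 4 * INR m <= (INR m + 1) ^ 4).
    { assert (0 <= INR m ^ 2) by apply pow2_ge_0. assert (0 <= INR m ^ 3) by (apply pow_le; lra).
      assert (0 <= INR m ^ 4) by (apply pow_le; lra).
      replace ((INR m + 1) ^ 4) with (1 + 4 * INR m + 6 * INR m ^ 2 + 4 * INR m ^ 3 + INR m ^ 4) by ring.
      lra. }
    nra. }
  assert (0 <= ln (INR m + 1)) by (rewrite <- ln_1; apply ln_le; lra).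
  apply Rle_trans with (/ (2 * PI) * (56 * ln (INR m + 1))).
  - apply Rmult_le_compat_l; [left; apply Rinv_0_lt_compat; lra|]. lra.
  - apply Rle_trans with (/ 4 * (56 * ln (INR m + 1))); [|lra].
    apply Rmult_le_compat_r; [lra|]. apply Rinv_le_contravar; lra.
Qed.

(** With difference quotients in place of [f'], the sum is the mean of a function bounded by [L]
    against a Dirichlet kernel, which gives [14 L ln (m + 1)] for every [h]. The error of the
    replacement is proportional to [h]. *)
Lemma fourier_lipschitz_log_sum f L theta m : Lipschitz L f -> periodic2pi f -> (1 <= m)%nat ->
  Cmod (csum (fun j => Ci * RtoC (INR (S j)) * fourier f (Z.of_nat (S j)) * eit (INR (S j) * theta))%C m)
  <= 14 * L * ln (INR m + 1).
Proof.
  intros HL Hp Hm. assert (Hf : Rcont f) by now apply Rcont_Lipschitz with L.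
  pose proof (Lipschitz_const_nonneg _ _ HL) as HL0.
  set (c := fun j => fourier f (Z.of_nat (S j))).
  apply Rle_eps_plus with (rsum (fun j => INR (S j) ^ 2 * Cmod (c j)) m).
  { apply rsum_nonneg. intros. apply Rmult_le_pos; [apply pow2_ge_0 | apply Cmod_ge_0]. }
  intros h Hh.
  set (q := fun j => (RtoC (/ h) * (eit (INR (S j) * h) - 1%R))%C).
  set (S1 := csum (fun j => Ci * RtoC (INR (S j)) * c j * eit (INR (S j) * theta))%C m).
  set (S2 := csum (fun j => q j * c j * eit (INR (S j) * theta))%C m).
  assert (H12 : Cmod (S1 - S2) <= rsum (fun j => INR (S j) ^ 2 * Cmod (c j)) m * h).
  { unfold S1, S2. rewrite <- csum_minus, <- rsum_scal_r. apply Cmod_csum_le. intros j _.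
    replace (Ci * RtoC (INR (S j)) * c j * eit (INR (S j) * theta) - q j * c j * eit (INR (S j) * theta))%C
      with ((Ci * RtoC (INR (S j)) - q j) * (c j * eit (INR (S j) * theta)))%C by ring.
    rewrite !Cmod_mult, Cmod_eit, Rmult_1_r, Cmod_minus_sym.
    replace (INR (S j) ^ 2 * Cmod (c j) * h) with (INR (S j) ^ 2 * h * Cmod (c j)) by ring.
    apply Rmult_le_compat_r; [apply Cmod_ge_0|]. unfold q. now apply Cmod_eit_quotient. }
  set (g := fun t => RtoC (diffquot f h (t + theta))).
  assert (Hg0 : Ccont (fun t => RtoC (diffquot f h t))) by now apply Ccont_RtoC, Rcont_diffquot.
  assert (Hg : Ccont g) by now apply (Ccont_translate (fun t => RtoC (diffquot f h t))).
  assert (E2 : S2 = cmean (fun t => g t * csum (fun j => eit (- INR (S j) * t)) m)%C).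
  { rewrite (cmean_ext _ (fun t => csum (fun j => (g t * eit (- INR (S j) * t))%C) m))
      by (intros; now rewrite csum_scal).
    unfold S2. clear - Hg Hf Hp Hh Hg0. induction m as [|m IH]; cbn [csum].
    - rewrite cmean_alt. simpl. now rewrite !mean_const.
    - rewrite cmean_plus, <- IH.
      + f_equal. unfold q, c.
        pose proof (coef_translate (fun t => RtoC (diffquot f h t)) theta (Z.of_nat (S m)) Hg0) as T.
        rewrite <- fourier_coef, fourier_diffquot, <- INR_IZR_INZ in T by (auto; lra).
        fold g in T. unfold coef in T. rewrite <- INR_IZR_INZ in T. rewrite T.
        * ring.
        * intros t. f_equal. apply periodic_diffquot; auto.
      + apply (Ccont_csum (fun j t => g t * eit (- INR (S j) * t))%C). intros; now apply Ccont_mult_eit.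
      + now apply Ccont_mult_eit. }
  assert (H2 : Cmod S2 <= 14 * L * ln (INR m + 1)).
  { rewrite E2. apply Rle_trans with (mean (fun t => L * dirichlet_majorant m t)).
    - apply Cmod_cmean_le.
      + apply Ccont_mult; auto. apply (Ccont_csum (fun j t => eit (- INR (S j) * t))).
        intros; apply Ccont_eit.
      + apply Rcont_mult; [apply Rcont_const | now apply Rcont_dirichlet_majorant].
      + intros t Ht. rewrite Cmod_mult. apply Rmult_le_compat; try apply Cmod_ge_0.
        * unfold g. rewrite Cmod_R. now apply diffquot_le.
        * assert (E : csum (fun j => eit (- INR (S j) * t)) m = (eit (- t) * dirichlet m (- t))%C).
          { unfold dirichlet. rewrite <- csum_scal. apply csum_ext. intros j _.
            rewrite <- eit_plus. f_equal. rewrite S_INR. ring. }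
          rewrite E, Cmod_mult, Cmod_eit, Rmult_1_l.
          replace (dirichlet_majorant m t) with (dirichlet_majorant m (- t))
            by (unfold dirichlet_majorant; now rewrite Rabs_Ropp).
          apply dirichlet_bounds; auto. lra.
    - rewrite mean_scal by now apply Rcont_dirichlet_majorant.
      pose proof (mean_dirichlet_majorant m Hm). nra. }
  change (Cmod S1 <= 14 * L * ln (INR m + 1) + rsum (fun j => INR (S j) ^ 2 * Cmod (c j)) m * h).
  replace S1 with (S2 + (S1 - S2))%C by ring.
  eapply Rle_trans; [apply Cmod_triangle|]. lra.
Qed.

(** Fejér's identity: expanding [|D + e^(iMx)|^2], the cross term is twice the sum of the cosines,
    so one step of the induction adds exactly the summand [m = M]. *)
Lemma fejer_kernel M x :
  rsum (fun m => 1 + 2 * rsum (fun j => cos (INR (S j) * x)) m) M = Cmod (dirichlet M x) ^ 2.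
Proof.
  unfold dirichlet. induction M as [|M IH]; cbn [rsum csum].
  - rewrite Cmod_0. ring.
  - rewrite IH. set (D := csum (fun j => eit (INR j * x)) M).
    replace (D + eit (INR M * x))%C with (D - - eit (INR M * x))%C by ring.
    rewrite Cmod_sqr_minus, Cmod_opp, Cmod_eit, Copp_conj, eit_conj.
    assert (E : Re (D * - eit (- (INR M * x)))%C = - rsum (fun j => cos (INR (S j) * x)) M).
    { replace (D * - eit (- (INR M * x)))%C with (- (D * eit (- (INR M * x))))%C by ring.
      rewrite re_opp. f_equal. unfold D. rewrite <- csum_scal_r, Re_csum, <- rsum_rev.
      apply rsum_ext. intros j Hj. rewrite <- eit_plus, eit_alt. simpl Re.
      rewrite <- cos_neg. f_equal. rewrite !minus_INR, (S_INR j) by lia. simpl. ring. }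
    rewrite E. ring.
Qed.

Lemma fourier_partial_sum f theta m : Rcont f -> periodic2pi f ->
  Re (fourier f 0) + 2 * Re (csum (fun j => fourier f (Z.of_nat (S j)) * eit theta ^ S j)%C m)
  = mean (fun t => f (t + theta) * (1 + 2 * rsum (fun j => cos (INR (S j) * t)) m)).
Proof.
  intros Hf Hp.
  assert (Hft : Rcont (fun t => f (t + theta)))
    by (apply (Rcont_comp (fun t => t + theta) f); auto using Rcont_affine).
  assert (Hco : forall j, Rcont (fun t => f (t + theta) * cos (INR (S j) * t))).
  { intros j. apply Rcont_mult; auto. apply (Rcont_comp (fun t => INR (S j) * t) cos); auto using Rcont_cos.
    apply Rcont_mult; [apply Rcont_const | intros x; apply continuous_id]. }
  rewrite (mean_ext _ (fun t => f (t + theta)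
     + 2 * rsum (fun j => f (t + theta) * cos (INR (S j) * t)) m))
    by (intros; rewrite rsum_scal; ring).
  destruct (mean_rsum (fun j t => f (t + theta) * cos (INR (S j) * t)) m Hco) as [R1 R2].
  rewrite mean_plus, mean_scal, R2, (mean_translate f theta); auto.
  2:{ apply Rcont_mult; auto using Rcont_const. }
  f_equal; [|f_equal].
  - rewrite fourier_coef. unfold coef. rewrite Re_cmean. apply mean_ext. intros t.
    replace (- 0 * t) with 0 by ring. rewrite eit_0, re_scal_l. simpl Re. ring.
  - rewrite Re_csum. apply rsum_ext. intros j _.
    rewrite eit_pow, fourier_coef, Cmult_comm.
    replace (eit (INR (S j) * theta)) with (eit (IZR (Z.of_nat (S j)) * theta))
      by now rewrite <- INR_IZR_INZ.
    rewrite <- (coef_translate (fun t => RtoC (f t))).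
    + unfold coef. rewrite Re_cmean. apply mean_ext. intros t.
      rewrite re_scal_l, eit_alt, <- INR_IZR_INZ. cbn [Re fst].
      rewrite <- cos_neg. do 2 f_equal. ring.
    + now apply Ccont_RtoC.
    + intros t. now rewrite Hp.
Qed.

Lemma ln_sublinear e : 0 < e ->
  exists N, forall n, (N <= n)%nat -> ln (INR n + 1) <= e * INR n.
Proof.
  (* With [y = sqrt (n + 1)] one has [ln (n + 1) <= 2 y]; the threshold [16 / e^2] forces
     [4 <= e * y], so that [2 y <= e (n + 1) / 2 <= e n]. *)
  intros He. destruct (archimed (16 / e ^ 2)) as [Hu _].
  assert (H16 : 0 < 16 / e ^ 2) by (apply Rdiv_lt_0_compat; [lra | apply pow_lt; lra]).
  set (N := Z.to_nat (up (16 / e ^ 2))).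
  assert (HN : 16 / e ^ 2 < INR N).
  { unfold N. rewrite INR_IZR_INZ, Z2Nat.id; [lra|]. apply le_IZR. lra. }
  exists (N + 1)%nat. intros n Hn.
  assert (H1 : INR N + 1 <= INR n) by (rewrite <- S_INR; apply le_INR; lia).
  pose proof (pos_INR N). set (y := sqrt (INR n + 1)).
  assert (Hy : y * y = INR n + 1) by (apply sqrt_sqrt; lra).
  assert (Hy0 : 0 < y) by (apply sqrt_lt_R0; lra).
  assert (Hl : ln (INR n + 1) <= 2 * y).
  { rewrite <- Hy, ln_mult by auto.
    assert (ln y <= y).
    { destruct (Rlt_dec (ln y) y) as [h|h]; [lra|]. exfalso. apply h.
      rewrite <- (exp_ln y) at 2 by auto.
      destruct (Req_dec (ln y) 0) as [E|E]; [rewrite E, exp_0; lra|].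
      pose proof (exp_ineq1 (ln y) E). lra. }
    lra. }
  assert (Hey : 4 <= e * y).
  { apply Rle_of_sqr_le; [nra|]. rewrite Rpow_mult_distr.
    replace (y ^ 2) with (INR n + 1) by (rewrite <- Hy; ring).
    assert (e ^ 2 * (16 / e ^ 2) <= e ^ 2 * (INR n + 1))
      by (apply Rmult_le_compat_l; [apply pow2_ge_0 | lra]).
    replace (e ^ 2 * (16 / e ^ 2)) with 16 in H0 by (field; lra). lra. }
  assert (H2 : e * ((INR n + 1) / 2) <= e * INR n) by (apply Rmult_le_compat_l; lra).
  assert (H3 : 4 * y <= e * y * y) by (apply Rmult_le_compat_r; lra).
  rewrite <- Hy in H2. lra.
Qed.

(** Absolute summability of the coefficients gives convergence to some limit; to identify it with
    [f theta], the averages of the partial sums are computed with Fejér's kernel. *)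
Lemma fourier_inversion f L theta : Lipschitz L f -> periodic2pi f ->
  f theta = Re (fourier f 0) + 2 * Re (pser (fun j => fourier f (Z.of_nat (S j))) (eit theta)).
Proof.
  intros HL Hp. assert (Hf : Rcont f) by now apply Rcont_Lipschitz with L.
  pose proof (Lipschitz_const_nonneg _ _ HL) as HL0.
  set (c := fun j => fourier f (Z.of_nat (S j))).
  set (s := fun m => Re (fourier f 0) + 2 * Re (csum (fun j => c j * eit theta ^ S j)%C m)).
  set (l := Re (fourier f 0) + 2 * Re (pser c (eit theta))).
  assert (Hs : Un_cv s l).
  { intros e He.
    destruct (CSeries_uniform (fun j => Cmod (c j)) (L ^ 2 / 2 + 1)) with (d := e / 4) as [N HN].
    - intros; apply Cmod_ge_0.
    - intros n. exact (fourier_abs_sum f L n HL Hp).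
    - lra.
    - exists N. intros n Hn. unfold R_dist, s, l.
      specialize (HN n Hn (fun j => c j * eit theta ^ S j)%C).
      assert (HC : Cmod (csum (fun j => c j * eit theta ^ S j)%C n - pser c (eit theta)) <= e / 4).
      { apply HN. intros j. apply Cmod_mult_pow_le; [rewrite Cmod_eit|]; lra. }
      pose proof (re_le_Cmod (csum (fun j => c j * eit theta ^ S j)%C n - pser c (eit theta))) as HR.
      replace (Re (csum (fun j => c j * eit theta ^ S j)%C n - pser c (eit theta))) with
        (Re (csum (fun j => c j * eit theta ^ S j)%C n) - Re (pser c (eit theta))) in HR
        by (simpl; unfold Re; ring).
      replace (Re (fourier f 0) + 2 * Re (csum (fun j => c j * eit theta ^ S j)%C n)
        - (Re (fourier f 0) + 2 * Re (pser c (eit theta)))) with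
        (2 * (Re (csum (fun j => c j * eit theta ^ S j)%C n) - Re (pser c (eit theta)))) by ring.
      rewrite Rabs_mult, (Rabs_pos_eq 2) by lra. lra. }
  (* Against Fejér's kernel the Lipschitz bound gives [L |t| |D|^2 <= 6 L |D|], and the mean of
     [|D|] is at most [14 ln (M + 1)]; the product of the constants is 84. *)
  assert (Hav : forall M, (1 <= M)%nat ->
    Rabs (rsum s M - INR M * f theta) <= 84 * L * ln (INR M + 1)).
  { intros M HM.
    assert (Hk : forall m, Rcont (fun t => 1 + 2 * rsum (fun j => cos (INR (S j) * t)) m)).
    { intros m. apply Rcont_plus; [apply Rcont_const|].
      apply Rcont_mult; [apply Rcont_const|].
      apply (mean_rsum (fun j t => cos (INR (S j) * t))). intros j.
      apply (Rcont_comp (fun t => INR (S j) * t) cos); auto using Rcont_cos.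
      apply Rcont_mult; [apply Rcont_const | intros x; apply continuous_id]. }
    assert (Hft : Rcont (fun t => f (t + theta)))
      by (apply (Rcont_comp (fun t => t + theta) f); auto using Rcont_affine).
    assert (Hd : Rcont (fun t => f (t + theta) - f theta)) by (apply Rcont_minus; auto using Rcont_const).
    assert (E1 : forall m, s m - f theta
       = mean (fun t => (f (t + theta) - f theta) * (1 + 2 * rsum (fun j => cos (INR (S j) * t)) m))).
    { intros m. unfold s, c. rewrite fourier_partial_sum by auto.
      (* The kernel has mean 1: this is the partial sum formula for a constant function. *)
      assert (E0 : f theta = mean (fun t => f theta * (1 + 2 * rsum (fun j => cos (INR (S j) * t)) m))).
      { pose proof (fourier_partial_sum (fun _ => f theta) theta m (Rcont_const _) ltac:(now intros t)) as P.
        rewrite <- P. rewrite (csum_ext _ (fun _ => RtoC 0)).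
        - rewrite csum_zero, fourier_coef, coef_const. simpl. ring.
        - intros j _. rewrite fourier_coef, coef_const.
          destruct (Z.eq_dec (Z.of_nat (S j)) 0); [lia | ring]. }
      rewrite E0 at 1. rewrite <- mean_minus; [apply mean_ext; intros; ring| |];
        apply Rcont_mult; auto using Rcont_const. }
    assert (E2 : rsum s M - INR M * f theta
      = mean (fun t => (f (t + theta) - f theta) * Cmod (dirichlet M t) ^ 2)).
    { rewrite <- rsum_const.
      replace (rsum s M - rsum (fun _ => f theta) M) with (rsum (fun m => s m - f theta) M).
      - rewrite (rsum_ext _ _ M (fun m _ => E1 m)).
        destruct (mean_rsum (fun m t => (f (t + theta) - f theta)
          * (1 + 2 * rsum (fun j => cos (INR (S j) * t)) m)) M) as [_ <-].
        + intros m. apply Rcont_mult; auto.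
        + apply mean_ext. intros t. now rewrite rsum_scal, fejer_kernel.
      - rewrite (rsum_ext _ (fun m => s m + (-1) * f theta)) by (intros; ring).
        rewrite rsum_plus, rsum_scal. ring. }
    rewrite E2.
    replace (Rabs (mean (fun t => (f (t + theta) - f theta) * Cmod (dirichlet M t) ^ 2)))
      with (Cmod (cmean (fun t => RtoC ((f (t + theta) - f theta) * Cmod (dirichlet M t) ^ 2)))).
    2:{ rewrite <- Cmod_R. f_equal. rewrite cmean_alt. simpl. now rewrite mean_const. }
    assert (HcD : Rcont (fun t => Cmod (dirichlet M t) ^ 2)).
    { apply Ccont_sqr_Cmod. apply (Ccont_csum (fun j t => eit (INR j * t))). intros; apply Ccont_eit. }
    apply Rle_trans with (mean (fun t => 6 * L * dirichlet_majorant M t)).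
    - apply Cmod_cmean_le.
      + apply Ccont_RtoC, Rcont_mult; auto.
      + apply Rcont_mult; [apply Rcont_const | now apply Rcont_dirichlet_majorant].
      + intros t Ht. rewrite Cmod_R, Rabs_mult, (Rabs_pos_eq (_ ^ 2)) by apply pow2_ge_0.
        destruct (dirichlet_bounds M t HM Ht) as [B1 B2].
        set (D := Cmod (dirichlet M t)) in *. assert (0 <= D) by apply Cmod_ge_0.
        pose proof (HL (t + theta) theta) as HLt. replace (t + theta - theta) with t in HLt by ring.
        apply Rle_trans with (L * Rabs t * D ^ 2); [apply Rmult_le_compat_r; [apply pow2_ge_0 | auto]|].
        replace (L * Rabs t * D ^ 2) with (L * (Rabs t * D) * D) by ring.
        apply Rmult_le_compat; auto.
        * repeat apply Rmult_le_pos; auto. apply Rabs_pos.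
        * nra.
    - rewrite mean_scal by now apply Rcont_dirichlet_majorant.
      pose proof (mean_dirichlet_majorant M HM). nra. }
  symmetry. apply cond_eq. intros e He.
  destruct (Cesaro_1 s l Hs (e / 2) ltac:(lra)) as [N1 H1].
  destruct (ln_sublinear (e / 4 / (84 * L + 1))) as [N2 H2].
  { apply Rdiv_lt_0_compat; lra. }
  set (n := (N1 + N2 + 1)%nat). specialize (H1 n ltac:(lia)). specialize (H2 n ltac:(lia)).
  specialize (Hav n ltac:(lia)).
  assert (Hn : 0 < INR n) by (apply lt_0_INR; lia).
  assert (Es : forall m, sum_f_R0 s m = rsum s (S m)).
  { induction m as [|m IH]; simpl; [ring|]. rewrite IH. reflexivity. }
  rewrite Es in H1. replace (S (Init.Nat.pred n)) with n in H1 by lia. unfold R_dist in H1.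
  assert (H3 : Rabs (rsum s n / INR n - f theta) <= e / 4).
  { replace (rsum s n / INR n - f theta) with ((rsum s n - INR n * f theta) / INR n) by (field; lra).
    unfold Rdiv. rewrite Rabs_mult, Rabs_inv, (Rabs_pos_eq (INR n)) by lra.
    apply Rmult_le_reg_r with (INR n); auto. rewrite Rmult_assoc, Rinv_l, Rmult_1_r by lra.
    eapply Rle_trans; [apply Hav|].
    assert (0 <= ln (INR n + 1)) by (rewrite <- ln_1; apply ln_le; lra).
    apply Rle_trans with ((84 * L + 1) * ln (INR n + 1)); [nra|].
    apply Rle_trans with ((84 * L + 1) * (e / 4 / (84 * L + 1) * INR n)).
    - apply Rmult_le_compat_l; lra.
    - right. field. lra. }
  replace (l - f theta) with ((rsum s n / INR n - f theta) - (rsum s n / INR n - l)) by ring.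
  unfold Rminus at 1. eapply Rle_lt_trans; [apply Rabs_triang|]. rewrite Rabs_Ropp. lra.
Qed.

(** * Abel summation and Taylor remainders *)

Lemma abel_identity (c : nat -> R) (a : nat -> C) n :
  csum (fun j => RtoC (c j) * a j)%C (S n)
  = (RtoC (c n) * csum a (S n) - csum (fun j => RtoC (c (S j) - c j) * csum a (S j)) n)%C.
Proof.
  induction n as [|n IH]; [simpl; ring|].
  change (csum (fun j => RtoC (c j) * a j)%C (S (S n)))
    with (csum (fun j => RtoC (c j) * a j)%C (S n) + RtoC (c (S n)) * a (S n))%C.
  rewrite IH. change (csum a (S (S n))) with (csum a (S n) + a (S n))%C.
  cbn [csum]. rewrite RtoC_minus. ring.
Qed.

Lemma abel_bound (c : nat -> R) (a : nat -> C) (B : nat -> R) n :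
  (forall j, Cmod (csum a (S j)) <= B j) ->
  Cmod (csum (fun j => RtoC (c j) * a j)%C (S n))
  <= Rabs (c n) * B n + rsum (fun j => Rabs (c (S j) - c j) * B j) n.
Proof.
  intros H. rewrite abel_identity. eapply Rle_trans; [apply Cmod_sub_le|].
  apply Rplus_le_compat.
  - rewrite Cmod_mult, Cmod_R. apply Rmult_le_compat_l; [apply Rabs_pos | auto].
  - apply Cmod_csum_le. intros j _. rewrite Cmod_mult, Cmod_R.
    apply Rmult_le_compat_l; [apply Rabs_pos | auto].
Qed.

Lemma rsum_telescope (c : nat -> R) n : rsum (fun j => c (S j) - c j) n = c n - c 0%nat.
Proof. induction n as [|n IH]; simpl; [|rewrite IH]; ring. Qed.

Lemma abel_decreasing (c : nat -> R) (a : nat -> C) B n :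
  (forall j, c (S j) <= c j) -> (forall j, 0 <= c j) -> 
  (forall j, Cmod (csum a j) <= B) ->
  Cmod (csum (fun j => RtoC (c j) * a j)%C n) <= c 0%nat * B.
Proof.
  intros Hd Hc Ha.
  assert (HB : 0 <= B) by (specialize (Ha 0%nat); simpl in Ha; rewrite Cmod_0 in Ha; auto).
  destruct n as [|n]; [simpl; rewrite Cmod_0; apply Rmult_le_pos; auto|].
  eapply Rle_trans; [apply (abel_bound c a (fun _ => B)); auto|].
  rewrite rsum_scal_r, (rsum_ext _ (fun j => (-1) * (c (S j) - c j))).
  - rewrite rsum_scal, rsum_telescope, Rabs_pos_eq by auto. right. ring.
  - intros j _. rewrite Rabs_left1; [ring|]. specialize (Hd j). lra.
Qed.

(** Both directions occur, for the weights [e^(-sj)] and [e^(sj)]; an increasing weight costs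
    [2 c_n - c_0], whence the factor 2. Partial sums are bounded only up to [n], as their bound will
    grow with the length. *)
Lemma abel_monotone (c : nat -> R) (a : nat -> C) B K n :
  (forall j, c (S j) <= c j) \/ (forall j, c j <= c (S j)) -> (forall j, 0 <= c j) ->
  (forall j, (j < n)%nat -> c j <= K) -> 0 <= K ->
  (forall j, (j <= n)%nat -> Cmod (csum a j) <= B) ->
  Cmod (csum (fun j => RtoC (c j) * a j)%C n) <= 2 * K * B.
Proof.
  intros Hm Hc HK HK0 Ha.
  assert (HB : 0 <= B).
  { specialize (Ha 0%nat ltac:(lia)); simpl in Ha; rewrite Cmod_0 in Ha; auto. }
  destruct n as [|n]; [simpl; rewrite Cmod_0; repeat apply Rmult_le_pos; auto; lra|].
  rewrite (csum_ext _ (fun j => RtoC (c j) * (if Nat.leb (S j) (S n) then a j else 0%R))%C).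
  2:{ intros i Hi. destruct (Nat.leb_spec (S i) (S n)); [auto | lia]. }
  (* Extending by zero makes the bound valid for partial sums of every length, as the preceding Abel
     estimates require. *)
  set (a' := fun j => if Nat.leb (S j) (S n) then a j else 0%R).
  assert (Ha' : forall j, Cmod (csum a' j) <= B).
  { intros j. destruct (Nat.le_gt_cases j (S n)) as [Hj|Hj].
    - rewrite (csum_ext _ a); auto. intros i Hi. unfold a'. destruct (Nat.leb_spec (S i) (S n)); [auto | lia].
    - replace j with (S n + (j - S n))%nat by lia. rewrite csum_add.
      rewrite (csum_ext (fun i => a' (S n + i)%nat) (fun _ => RtoC 0)), csum_zero, Cplus_0_r.
      + rewrite (csum_ext _ a); auto. intros i Hi. unfold a'. destruct (Nat.leb_spec (S i) (S n)); [auto | lia].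
      + intros i Hi. unfold a'. destruct (Nat.leb_spec (S (S n + i)) (S n)); [lia | auto]. }
  destruct Hm as [Hm|Hm].
  - eapply Rle_trans; [apply (abel_decreasing c a' B (S n)); auto|].
    specialize (HK 0%nat ltac:(lia)). nra.
  - eapply Rle_trans; [apply (abel_bound c a' (fun _ => B)); auto|].
    rewrite rsum_scal_r, (rsum_ext _ (fun j => c (S j) - c j)).
    + rewrite rsum_telescope, Rabs_pos_eq by auto.
      specialize (HK n ltac:(lia)). specialize (Hc 0%nat).
      replace (c n * B + (c n - c 0%nat) * B) with ((2 * c n - c 0%nat) * B) by ring.
      apply Rmult_le_compat_r; lra.
    + intros j _. rewrite Rabs_pos_eq; [ring|]. specialize (Hm j). lra.
Qed.

(** It has [q] terms, hence degree below [q]; in particular [taylor_exp 0] is zero, so inductions on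
    [q] can start from the plain exponential. *)
Definition taylor_exp (q : nat) (x : R) : R := rsum (fun p => x ^ p / INR (fact p)) q.

Lemma is_derive_taylor_exp q x : is_derive (taylor_exp (S q)) x (taylor_exp q x).
Proof.
  unfold taylor_exp.
  apply is_derive_ext with (fun x => 1 + rsum (fun p => / INR (fact (S p)) * x ^ S p) q).
  - intros t. rewrite rsum_S_l. f_equal; [simpl; field|].
    apply rsum_ext. intros; unfold Rdiv; apply Rmult_comm.
  - rewrite <- (Rplus_0_l (rsum _ q)).
    apply @is_derive_plus with (K := R_AbsRing) (V := R_NormedModule); [apply @is_derive_const|].
    apply (is_derive_rsum (fun p t => / INR (fact (S p)) * t ^ S p)). intros p _.
    replace (x ^ p / INR (fact p)) with (/ INR (fact (S p)) * INR (S p) * x ^ p).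
    + apply is_derive_monomial.
    + rewrite fact_simpl, mult_INR. field.
      split; [apply INR_fact_neq_0 | apply not_0_INR; lia].
Qed.

Lemma taylor_exp_0 q : taylor_exp (S q) 0 = 1.
Proof.
  unfold taylor_exp. rewrite rsum_S_l, (rsum_ext _ (fun _ => 0)).
  - rewrite rsum_zero. simpl. field.
  - intros i _. simpl. unfold Rdiv. ring.
Qed.

Lemma pow_fact_le_exp x p : 0 <= x -> x ^ p / INR (fact p) <= exp x.
Proof.
  intros Hx.
  assert (T : forall q y, 0 <= y -> taylor_exp q y <= exp y).
  { induction q as [|q IH]; intros y Hy.
    - unfold taylor_exp; simpl. left; apply exp_pos.
    - assert (D : exp 0 - taylor_exp (S q) 0 <= exp y - taylor_exp (S q) y).
      { apply (derive_nonneg_le (fun y => exp y - taylor_exp (S q) y)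
          (fun y => exp y - taylor_exp q y)); auto.
        - intros t _. apply @is_derive_minus with (K := R_AbsRing) (V := R_NormedModule);
            [apply is_derive_exp | apply is_derive_taylor_exp].
        - intros t Ht. specialize (IH t ltac:(lra)). lra. }
      rewrite exp_0, taylor_exp_0 in D. lra. }
  eapply Rle_trans; [|apply (T (S p) x Hx)]. unfold taylor_exp.
  apply (rsum_term_le (fun p => x ^ p / INR (fact p))); [|lia].
  intros i. apply Rdiv_le_0_compat; [now apply pow_le | apply INR_fact_lt_0].
Qed.

Lemma ln_ge_0 x : 1 <= x -> 0 <= ln x.
Proof. intros H. rewrite <- ln_1. apply ln_le; lra. Qed.

(** For [q = 0] this is Abel summation with monotone weights at most [e^(ns)]. The derivative in [s]
    of the sum for [q + 1] is [eps] times the sum for [q], because the inner derivative cancels one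
    power of the frequency; integrating [e^(ns)] then gains the factor [1 / n]. *)
Lemma taylor_head_bound (a : nat -> C) H eps n : (1 <= n)%nat -> eps = 1 \/ eps = -1 ->
  (forall M, (M <= n)%nat -> Cmod (csum a M) <= H) ->
  forall q s, 0 <= s ->
  Cmod (csum (fun j => RtoC ((exp (eps * s * INR (S j)) - taylor_exp q (eps * s * INR (S j)))
                             / INR (S j) ^ q) * a j)%C n)
  <= 2 * H * exp (INR n * s) / INR n ^ q.
Proof.
  intros Hn Heps Ha.
  assert (HH : 0 <= H).
  { specialize (Ha 0%nat ltac:(lia)); simpl in Ha; rewrite Cmod_0 in Ha; auto. }
  assert (Hn0 : 0 < INR n) by (apply lt_0_INR; lia).
  induction q as [|q IH]; intros s Hs.
  - rewrite (csum_ext _ (fun j => RtoC (exp (eps * s * INR (S j))) * a j)%C).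
    + simpl (_ ^ 0). replace (2 * H * exp (INR n * s) / 1) with (2 * exp (INR n * s) * H) by field.
      apply abel_monotone; auto.
      * destruct Heps as [->| ->]; [right | left]; intros j; apply exp_le_compat;
          rewrite (S_INR (S j)); nra.
      * intros; left; apply exp_pos.
      * intros j Hj. apply exp_le_compat.
        assert (INR (S j) <= INR n) by (apply le_INR; lia). pose proof (pos_INR (S j)).
        destruct Heps as [->| ->]; nra.
      * left; apply exp_pos.
    + intros j _. f_equal. f_equal. unfold taylor_exp; simpl rsum. simpl (_ ^ 0). field.
  - set (f := fun s => csum (fun j => RtoC ((exp (eps * s * INR (S j))
       - taylor_exp (S q) (eps * s * INR (S j))) / INR (S j) ^ S q) * a j)%C n).
    change (Cmod (f s) <= 2 * H * exp (INR n * s) / INR n ^ S q).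
    assert (F0 : f 0 = 0%R).
    { unfold f. rewrite (csum_ext _ (fun _ => RtoC 0)); [apply csum_zero|]. intros j _.
      replace (eps * 0 * INR (S j)) with 0 by ring. rewrite exp_0, taylor_exp_0.
      unfold Rdiv. rewrite Rminus_diag, Rmult_0_l. ring. }
    assert (D : Cmod (f s - f 0) <= 2 * H * exp (INR n * s) / INR n ^ S q
                 - 2 * H * exp (INR n * 0) / INR n ^ S q).
    { apply (Cderiv_mean_value f
        (fun s => RtoC eps * csum (fun j => RtoC ((exp (eps * s * INR (S j))
           - taylor_exp q (eps * s * INR (S j))) / INR (S j) ^ q) * a j) n)%C
        (fun s => 2 * H * exp (INR n * s) / INR n ^ S q)
        (fun s => 2 * H * exp (INR n * s) / INR n ^ q)); auto.
      - intros x _. rewrite <- csum_scal. unfold f.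
        apply (Cderiv_csum (fun j s => RtoC ((exp (eps * s * INR (S j))
           - taylor_exp (S q) (eps * s * INR (S j))) / INR (S j) ^ S q) * a j)%C).
        intros j _. set (y := INR (S j)). assert (Hy : 0 < y) by (apply lt_0_INR; lia).
        apply Cderiv_ext with (fun s => (a j * RtoC ((exp (eps * s * y) - taylor_exp (S q) (eps * s * y)) / y ^ S q))%C);
          [intros; apply Cmult_comm|].
        rewrite Cmult_assoc, (Cmult_comm _ (a j)), <- RtoC_mult.
        apply Cderiv_scal, Cderiv_RtoC.
        replace (eps * ((exp (eps * x * y) - taylor_exp q (eps * x * y)) / y ^ q))
          with (/ y ^ S q * ((eps * y) * (exp (eps * x * y) - taylor_exp q (eps * x * y)))).
        2:{ simpl. field. repeat split; try apply pow_nonzero; lra. }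
        apply is_derive_ext with (fun s => / y ^ S q * (exp (eps * s * y) - taylor_exp (S q) (eps * s * y)));
          [intros; unfold Rdiv; apply Rmult_comm|].
        apply is_derive_scal.
        apply (is_derive_comp (V := R_NormedModule)
          (fun v => exp v - taylor_exp (S q) v) (fun s => eps * s * y)).
        + apply @is_derive_minus with (K := R_AbsRing) (V := R_NormedModule);
            [apply is_derive_exp | apply is_derive_taylor_exp].
        + auto_derive; auto. ring.
      - intros x _. simpl (_ ^ S q).
        replace (2 * H * exp (INR n * x) / INR n ^ q) with (2 * H * / (INR n * INR n ^ q) * (INR n * exp (INR n * x)))
          by (field; repeat split; try apply pow_nonzero; lra).
        apply is_derive_ext with (fun s => 2 * H * / (INR n * INR n ^ q) * exp (INR n * s)).
        { intros. unfold Rdiv. rewrite !Rmult_assoc. f_equal. f_equal. apply Rmult_comm. }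
        apply is_derive_scal. auto_derive; auto. ring.
      - intros x Hx. rewrite Cmod_mult, Cmod_R.
        replace (Rabs eps) with 1 by (destruct Heps as [->| ->]; [rewrite Rabs_R1 | rewrite Rabs_left]; lra).
        rewrite Rmult_1_l. apply IH. lra. }
    rewrite F0 in D. replace (f s - 0%R)%C with (f s) in D by ring.
    assert (0 <= 2 * H * exp (INR n * 0) / INR n ^ S q).
    { apply Rdiv_le_0_compat; [|now apply pow_lt]. apply Rmult_le_pos; [lra|]. left; apply exp_pos. }
    lra.
Qed.

(** * Tails of weighted sums whose partial sums grow logarithmically *)

Lemma csum_shift_bound (a : nat -> C) H n :
  0 <= H -> (forall M, Cmod (csum a M) <= H * ln (INR M + 1)) ->
  forall M, Cmod (csum (fun j => a (n + j)%nat) M) <= 2 * H * ln (INR (n + M) + 1).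
Proof.
  intros HH Ha M.
  replace (csum (fun j => a (n + j)%nat) M) with (csum a (n + M) - csum a n)%C
    by (rewrite csum_add; ring).
  eapply Rle_trans; [apply Cmod_sub_le|].
  pose proof (Ha n). pose proof (Ha (n + M)%nat). pose proof (pos_INR n).
  assert (ln (INR n + 1) <= ln (INR (n + M) + 1)).
  { apply ln_le; [lra|]. apply Rplus_le_compat_r, le_INR. lia. }
  nra.
Qed.

Lemma harmonic_tail_bound (a : nat -> C) H n :
  0 <= H -> (forall M, Cmod (csum a M) <= H * ln (INR M + 1)) ->
  forall M, Cmod (csum (fun j => RtoC (/ INR (S (n + j))) * a (n + j)%nat)%C M)
            <= 2 * H * ((2 + ln (INR (S n) + 1)) / INR (S n)).
Proof.
  (* [phi] plays the role of a discrete primitive: its decrements dominate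
     [ln (x + 1) / (x (x + 1))], the constant 2 paying for the growth of the logarithm from one step
     to the next. *)
  intros HH Ha M. set (phi := fun x => (2 + ln (x + 1)) / x).
  assert (Hphi : forall x, 1 <= x -> ln (x + 1) * (/ x - / (x + 1)) <= phi x - phi (x + 1)).
  { intros x Hx. unfold phi.
    assert (Hl : ln (x + 1 + 1) <= ln (x + 1) + / (x + 1)).
    { replace (x + 1 + 1) with ((x + 1) * (1 + / (x + 1))) by (field; lra).
      assert (0 < / (x + 1)) by (apply Rinv_0_lt_compat; lra).
      rewrite ln_mult by lra. apply Rplus_le_compat_l.
      rewrite <- (ln_exp (/ (x + 1))) at 2. apply ln_le; [lra|].
      left. apply exp_ineq1. lra. }
    assert (Hx1 : 0 < / (x + 1)) by (apply Rinv_0_lt_compat; lra).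
    apply Rle_trans with ((2 + ln (x + 1)) / x - (2 + (ln (x + 1) + / (x + 1))) / (x + 1)).
    - replace ((2 + ln (x + 1)) / x - (2 + (ln (x + 1) + / (x + 1))) / (x + 1))
        with (ln (x + 1) * (/ x - / (x + 1)) + (2 * / (x * (x + 1)) - / ((x + 1) * (x + 1))))
        by (field; lra).
      assert (/ ((x + 1) * (x + 1)) <= / (x * (x + 1))) by (apply Rinv_le_contravar; nra).
      assert (0 < / (x * (x + 1))) by (apply Rinv_0_lt_compat; nra). lra.
    - unfold Rdiv. assert ((2 + ln (x + 1 + 1)) * / (x + 1) <= (2 + (ln (x + 1) + / (x + 1))) * / (x + 1))
        by (apply Rmult_le_compat_r; lra). lra. }
  assert (Hpos : forall x, 1 <= x -> 0 <= phi x).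
  { intros x Hx. apply Rdiv_le_0_compat; [|lra]. pose proof (ln_ge_0 (x + 1) ltac:(lra)). lra. }
  assert (Hn1 : 1 <= INR (S n)) by (apply (le_INR 1); lia).
  destruct M as [|M].
  { simpl csum. rewrite Cmod_0. apply Rmult_le_pos; [lra | now apply Hpos]. }
  eapply Rle_trans; [apply (abel_bound (fun j => / INR (S (n + j))) (fun j => a (n + j)%nat)
     (fun j => 2 * H * ln (INR (S (n + j)) + 1)))|].
  { intros j. replace (S (n + j)) with (n + S j)%nat by lia. now apply csum_shift_bound. }
  assert (Hx : forall j, 1 <= INR (S (n + j))) by (intros; apply (le_INR 1); lia).
  assert (T : rsum (fun j => Rabs (/ INR (S (n + S j)) - / INR (S (n + j))) * (2 * H * ln (INR (S (n + j)) + 1))) M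
     <= 2 * H * (phi (INR (S n)) - phi (INR (S (n + M))))).
  { apply Rle_trans with (rsum (fun j => (- (2 * H)) * (phi (INR (S (n + S j))) - phi (INR (S (n + j))))) M).
    - apply rsum_le. intros j _. specialize (Hx j). specialize (Hphi _ Hx).
      replace (S (n + S j)) with (S (S (n + j))) by lia. rewrite (S_INR (S (n + j))).
      set (x := INR (S (n + j))) in *.
      assert (/ (x + 1) <= / x) by (apply Rinv_le_contravar; lra).
      rewrite Rabs_left1 by lra.
      replace (- (/ (x + 1) - / x) * (2 * H * ln (x + 1))) with (2 * H * (ln (x + 1) * (/ x - / (x + 1)))) by ring.
      replace (- (2 * H) * (phi (x + 1) - phi x)) with (2 * H * (phi x - phi (x + 1))) by ring.
      apply Rmult_le_compat_l; lra.
    - rewrite rsum_scal, (rsum_telescope (fun j => phi (INR (S (n + j))))), Nat.add_0_r. right. ring. }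
  assert (E : Rabs (/ INR (S (n + M))) * (2 * H * ln (INR (S (n + M)) + 1)) <= 2 * H * phi (INR (S (n + M)))).
  { specialize (Hx M). set (x := INR (S (n + M))) in *.
    rewrite Rabs_pos_eq by (left; apply Rinv_0_lt_compat; lra).
    replace (/ x * (2 * H * ln (x + 1))) with (2 * H * (ln (x + 1) * / x)) by ring.
    apply Rmult_le_compat_l; [lra|]. unfold phi, Rdiv. apply Rmult_le_compat_r; [left; apply Rinv_0_lt_compat|]; lra. }
  unfold phi in *. lra.
Qed.

(** One factor [1 / j] is spent on making the partial sums of the tail bounded; the rest of the
    weight is decreasing, so a second Abel summation costs only its first value. *)
Lemma weighted_tail_bound (a : nat -> C) H n d q :
  0 <= H -> (forall M, Cmod (csum a M) <= H * ln (INR M + 1)) ->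
  (forall j, 0 <= d j <= 1) -> (forall j, d (S j) <= d j) ->
  forall M, Cmod (csum (fun j => RtoC (d (n + j)%nat / INR (S (n + j)) ^ S q) * a (n + j)%nat)%C M)
            <= 2 * H * (2 + ln (INR (S n) + 1)) / INR (S n) ^ S q.
Proof.
  intros HH Ha Hd Hdec M.
  assert (Hp : forall j, 0 < INR (S j)) by (intros; apply lt_0_INR; lia).
  rewrite (csum_ext _ (fun j => RtoC (d (n + j)%nat / INR (S (n + j)) ^ q)
    * (RtoC (/ INR (S (n + j))) * a (n + j)%nat))%C).
  2:{ intros j _. rewrite Cmult_assoc, <- RtoC_mult. do 2 f_equal. rewrite <- tech_pow_Rmult.
      specialize (Hp (n + j)%nat). field. repeat split; try apply pow_nonzero; lra. }
  eapply Rle_trans; [apply (abel_decreasing (fun j => d (n + j)%nat / INR (S (n + j)) ^ q)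
    (fun j => RtoC (/ INR (S (n + j))) * a (n + j)%nat)%C
    (2 * H * ((2 + ln (INR (S n) + 1)) / INR (S n))))|].
  - intros j. rewrite Nat.add_succ_r. unfold Rdiv. apply Rmult_le_compat.
    + apply Hd.
    + left. apply Rinv_0_lt_compat, pow_lt, Hp.
    + apply Hdec.
    + apply Rinv_le_contravar; [apply pow_lt, Hp|]. apply pow_incr. split; [apply pos_INR|].
      apply le_INR. lia.
  - intros j. apply Rdiv_le_0_compat; [apply Hd | apply pow_lt, Hp].
  - now apply harmonic_tail_bound.
  - rewrite Nat.add_0_r. specialize (Hp n).
    replace (2 * H * (2 + ln (INR (S n) + 1)) / INR (S n) ^ S q)
      with (1 / INR (S n) ^ q * (2 * H * ((2 + ln (INR (S n) + 1)) / INR (S n))))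
      by (rewrite <- tech_pow_Rmult; field; repeat split; try apply pow_nonzero; lra).
    apply Rmult_le_compat_r.
    + apply Rmult_le_pos; [lra|]. apply Rdiv_le_0_compat; auto.
      pose proof (ln_ge_0 (INR (S n) + 1) ltac:(lra)). lra.
    + unfold Rdiv. apply Rmult_le_compat_r; [left; now apply Rinv_0_lt_compat, pow_lt | apply Hd].
Qed.

(** Here [n + 1] and [n + 2] are at most [n^2], and the constant 2 is below [4 ln n], since
    [ln 2 > 1/2]. *)
Lemma ln_shift_bounds n : (2 <= n)%nat ->
  ln (INR n + 1) <= 2 * ln (INR n) /\ 2 + ln (INR (S n) + 1) <= 6 * ln (INR n).
Proof.
  intros Hn. assert (H2 : 2 <= INR n) by (apply (le_INR 2); auto).
  assert (E : 2 * ln (INR n) = ln (INR n * INR n)) by (rewrite ln_mult by lra; ring).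
  assert (L2 : / 2 < ln (INR n)).
  { pose proof ln_lt_2. assert (ln 2 <= ln (INR n)) by (apply ln_le; lra). lra. }
  rewrite S_INR. split.
  - rewrite E. apply ln_le; nra.
  - assert (ln (INR n + 1 + 1) <= 2 * ln (INR n)) by (rewrite E; apply ln_le; nra). lra.
Qed.

(* [w j] plays the role of [U_(j+1) e^(i(j+1)t)]; the two claims are the nonnegative and the
   negative frequencies. *)
Lemma extension_estimate (w : nat -> C) H k s n M : (1 <= k)%nat -> (2 <= n)%nat -> (n <= M)%nat ->
  0 <= H -> 0 <= s ->
  (forall m, Cmod (csum (fun j => RtoC (INR (S j) ^ k) * w j)%C m) <= H * ln (INR m + 1)) ->
  let K := (4 + 12 * (INR k + 1)) * H * exp (INR n * s) * ln (INR n) / INR n ^ k in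
  Cmod (csum (fun j => RtoC (exp (- s * INR (S j)) - taylor_exp k (- s * INR (S j))) * w j)%C M) <= K /\
  Cmod (csum (fun j => RtoC (exp (s * INR (S j))) * w j)%C n
        - csum (fun j => RtoC (taylor_exp k (s * INR (S j))) * w j)%C M) <= K.
Proof.
  intros Hk Hn HM HH Hs Hw K.
  assert (Hn0 : 0 < INR n) by (apply lt_0_INR; lia).
  assert (HnS : INR n <= INR (S n)) by (apply le_INR; lia).
  destruct (ln_shift_bounds n Hn) as [L1 L2].
  assert (L0 : 0 <= ln (INR n)) by (apply ln_ge_0, (le_INR 1); lia).
  set (a := fun j => (RtoC (INR (S j) ^ k) * w j)%C) in *.
  assert (Hp : forall j, 0 < INR (S j)) by (intros; apply lt_0_INR; lia).
  assert (Ew : forall j, w j = (RtoC (/ INR (S j) ^ k) * a j)%C).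
  { intros j. unfold a. rewrite Cmult_assoc, <- RtoC_mult, Rinv_l by (apply pow_nonzero; specialize (Hp j); lra).
    ring. }
  set (ex := exp (INR n * s)). assert (Hex : 1 <= ex).
  { unfold ex. rewrite <- exp_0. apply exp_le_compat. nra. }
  set (lam := H * ex * ln (INR n) / INR n ^ k).
  assert (Hnk : 0 < INR n ^ k) by now apply pow_lt.
  assert (Hlam : 0 <= lam).
  { apply Rdiv_le_0_compat; auto. repeat apply Rmult_le_pos; lra. }
  assert (Head : forall eps, eps = 1 \/ eps = -1 ->
    Cmod (csum (fun j => RtoC (exp (eps * s * INR (S j)) - taylor_exp k (eps * s * INR (S j))) * w j)%C n)
    <= 4 * lam).
  { intros eps He.
    rewrite (csum_ext _ (fun j => RtoC ((exp (eps * s * INR (S j)) - taylor_exp k (eps * s * INR (S j)))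
      / INR (S j) ^ k) * a j)%C).
    - eapply Rle_trans; [apply (taylor_head_bound a (H * ln (INR n + 1)) eps n); auto; try lia|].
      + intros m Hm. eapply Rle_trans; [apply Hw|]. apply Rmult_le_compat_l; auto.
        apply ln_le; [pose proof (pos_INR m); lra|]. apply Rplus_le_compat_r, le_INR. auto.
      + unfold lam, Rdiv. replace (4 * (H * ex * ln (INR n) * / INR n ^ k))
          with (2 * (H * (2 * ln (INR n))) * ex * / INR n ^ k) by ring.
        apply Rmult_le_compat_r; [left; now apply Rinv_0_lt_compat|].
        apply Rmult_le_compat_r; [lra|]. nra.
    - intros j _. rewrite Ew at 1. rewrite Cmult_assoc, <- RtoC_mult. reflexivity. }
  (* The factor [j^p] leaves [k - p >= 1] powers in the denominator, written [S (k - 1 - p)]. The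
     weight [d] will be 1 for the Taylor polynomial and [e^(-sj)] for the decaying exponential. *)
  assert (Tail : forall p d, (p < k)%nat -> (forall j, 0 <= d j <= 1) -> (forall j, d (S j) <= d j) ->
    Cmod (csum (fun j => RtoC (d (n + j)%nat * INR (S (n + j)) ^ p) * w (n + j)%nat)%C (M - n))
    <= 12 * H * ln (INR n) * INR n ^ p / INR n ^ k).
  { intros p d Hpk Hd Hdec.
    rewrite (csum_ext _ (fun j => RtoC (d (n + j)%nat / INR (S (n + j)) ^ S (k - 1 - p)) * a (n + j)%nat)%C).
    - eapply Rle_trans; [now apply (weighted_tail_bound a H n d (k - 1 - p))|].
      replace (12 * H * ln (INR n) * INR n ^ p / INR n ^ k)
        with (2 * H * (6 * ln (INR n)) / INR n ^ S (k - 1 - p)).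
      + unfold Rdiv. apply Rmult_le_compat.
        * apply Rmult_le_pos; [lra|]. pose proof (ln_ge_0 (INR (S n) + 1) ltac:(specialize (Hp n); pose proof (pos_INR (S n)); lra)). lra.
        * left. apply Rinv_0_lt_compat, pow_lt. lra.
        * apply Rmult_le_compat_l; lra.
        * apply Rinv_le_contravar; [now apply pow_lt|]. apply pow_incr. lra.
      + replace k with (S (k - 1 - p) + p)%nat at 2 by lia. rewrite pow_add. field.
        repeat split; try apply pow_nonzero; lra.
    - intros j _. rewrite (Ew (n + j)%nat) at 1. rewrite Cmult_assoc, <- RtoC_mult. do 2 f_equal.
      replace k with (S (k - 1 - p) + p)%nat at 1 by lia. rewrite pow_add.
      specialize (Hp (n + j)%nat). field. repeat split; try apply pow_nonzero; lra. }
  (* Monomial by monomial: the power [n^p] lost in the tail combines with [s^p / p!] into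
     [(n s)^p / p! <= e^(n s)], for each of the [k] monomials. *)
  assert (TT : forall eps, eps = 1 \/ eps = -1 ->
    Cmod (csum (fun j => RtoC (taylor_exp k (eps * s * INR (S (n + j)))) * w (n + j)%nat)%C (M - n))
    <= 12 * INR k * lam).
  { intros eps He.
    rewrite (csum_ext _ (fun j => csum (fun p => RtoC ((eps * s) ^ p / INR (fact p))
       * (RtoC (1 * INR (S (n + j)) ^ p) * w (n + j)%nat))%C k)).
    - rewrite csum_swap.
      apply Rle_trans with (rsum (fun _ => 12 * lam) k); [|rewrite rsum_const; right; ring].
      apply Cmod_csum_le. intros p Hpk. rewrite csum_scal, Cmod_mult, Cmod_R.
      pose proof (Tail p (fun _ => 1) Hpk ltac:(intros; lra) ltac:(intros; lra)) as TP. cbv beta in TP.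
      unfold Rdiv at 1. rewrite Rabs_mult, Rabs_inv, (Rabs_pos_eq (INR (fact p))) by apply pos_INR.
      replace (Rabs ((eps * s) ^ p)) with (s ^ p).
      2:{ rewrite <- RPow_abs, Rabs_mult, (Rabs_pos_eq s) by auto.
          replace (Rabs eps) with 1 by (destruct He as [->| ->]; [rewrite Rabs_R1 | rewrite Rabs_left]; lra).
          now rewrite Rmult_1_l. }
      pose proof (INR_fact_lt_0 p) as Hf.
      apply Rle_trans with (s ^ p * / INR (fact p) * (12 * H * ln (INR n) * INR n ^ p / INR n ^ k)).
      + apply Rmult_le_compat_l; auto. apply Rmult_le_pos; [now apply pow_le|].
        left. now apply Rinv_0_lt_compat.
      + pose proof (pow_fact_le_exp (INR n * s) p ltac:(nra)) as HE. fold ex in HE.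
        rewrite Rpow_mult_distr in HE. unfold lam.
        replace (s ^ p * / INR (fact p) * (12 * H * ln (INR n) * INR n ^ p / INR n ^ k))
          with (12 * H * ln (INR n) / INR n ^ k * (INR n ^ p * s ^ p / INR (fact p)))
          by (field; repeat split; try apply pow_nonzero; lra).
        replace (12 * (H * ex * ln (INR n) / INR n ^ k)) with (12 * H * ln (INR n) / INR n ^ k * ex)
          by (field; apply pow_nonzero; lra).
        apply Rmult_le_compat_l; auto. apply Rdiv_le_0_compat; auto. apply Rmult_le_pos; lra.
    - intros j _.
      rewrite (csum_ext _ (fun p => RtoC ((eps * s * INR (S (n + j))) ^ p / INR (fact p)) * w (n + j)%nat)%C).
      + now rewrite csum_scal_r, csum_RtoC.
      + intros p _. rewrite Cmult_assoc, <- RtoC_mult. do 2 f_equal. rewrite !Rpow_mult_distr.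
        pose proof (INR_fact_lt_0 p). field. lra. }
  (* [4 lam] for the frequencies up to [n], [12 k lam] for the Taylor polynomial beyond [n], and
     [12 lam] for the decaying exponential beyond [n]. *)
  assert (HK : K = 4 * lam + (12 * INR k * lam + 12 * lam)) by (unfold K, lam, Rdiv; fold ex; ring).
  assert (HkR : 0 <= INR k) by apply pos_INR.
  split.
  - replace M with (n + (M - n))%nat by lia. rewrite csum_add.
    eapply Rle_trans; [apply Cmod_triangle|]. rewrite HK. apply Rplus_le_compat.
    + rewrite (csum_ext _ (fun j => RtoC (exp (-1 * s * INR (S j)) - taylor_exp k (-1 * s * INR (S j))) * w j)%C).
      * apply Head. auto.
      * intros j _. now replace (- s) with (-1 * s) by ring.
    + rewrite (csum_ext _ (fun j => RtoC (exp (- s * INR (S (n + j))) * INR (S (n + j)) ^ 0) * w (n + j)%nat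
        - RtoC (taylor_exp k (-1 * s * INR (S (n + j)))) * w (n + j)%nat)%C).
      * rewrite csum_minus. eapply Rle_trans; [apply Cmod_sub_le|].
        rewrite Rplus_comm. apply Rplus_le_compat; [apply TT; auto|].
        eapply Rle_trans; [apply (Tail 0%nat (fun j => exp (- s * INR (S j)))); [lia| |]|].
        -- intros j. split; [left; apply exp_pos|]. rewrite <- exp_0. apply exp_le_compat.
           specialize (Hp j). nra.
        -- intros j. apply exp_le_compat. rewrite (S_INR (S j)). nra.
        -- simpl (_ ^ 0). unfold lam.
           replace (12 * H * ln (INR n) * 1 / INR n ^ k) with (12 * (H * ln (INR n) / INR n ^ k * 1))
             by (field; lra).
           replace (12 * (H * ex * ln (INR n) / INR n ^ k)) with (12 * (H * ln (INR n) / INR n ^ k * ex))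
             by (field; lra).
           apply Rmult_le_compat_l; [lra|]. apply Rmult_le_compat_l; auto.
           apply Rdiv_le_0_compat; auto. nra.
      * intros j _. replace (- s) with (-1 * s) by ring. rewrite RtoC_minus. simpl (_ ^ 0).
        rewrite Rmult_1_r. ring.
  (* Here the exponential grows; it is cut at [n], as the Laurent sum has no frequency below [-n],
     so that only the Taylor polynomial remains beyond. *)
  - replace M with (n + (M - n))%nat by lia. rewrite csum_add.
    match goal with |- Cmod (?A - (?B + ?D))%C <= _ => replace (A - (B + D))%C with ((A - B) - D)%C by ring end.
    eapply Rle_trans; [apply Cmod_sub_le|].
    assert (P1 : Cmod (csum (fun j => RtoC (exp (s * INR (S j))) * w j)%C n
      - csum (fun j => RtoC (taylor_exp k (s * INR (S j))) * w j)%C n) <= 4 * lam).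
    { rewrite <- csum_minus.
      rewrite (csum_ext _ (fun j => RtoC (exp (1 * s * INR (S j)) - taylor_exp k (1 * s * INR (S j))) * w j)%C).
      - apply Head. auto.
      - intros j _. rewrite Rmult_1_l, RtoC_minus. ring. }
    assert (P2 : Cmod (csum (fun j => RtoC (taylor_exp k (s * INR (S (n + j)))) * w (n + j)%nat)%C (M - n))
      <= 12 * INR k * lam).
    { rewrite (csum_ext _ (fun j => RtoC (taylor_exp k (1 * s * INR (S (n + j)))) * w (n + j)%nat)%C).
      - apply TT. auto.
      - intros j _. now rewrite Rmult_1_l. }
    rewrite HK. lra.
Qed.

(** * Jets of products and exponentials *)

(* A sequence [f : nat -> R -> R] stands for the successive derivatives of [f 0]. *)
Definition shift (f : nat -> R -> R) : nat -> R -> R := fun p => f (S p).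

Definition tower (m : nat) (f : nat -> R -> R) : Prop :=
  forall p, (p < m)%nat -> forall x, is_derive (f p) x (f (S p) x).

(** Leibniz's rule as a binary recursion: no binomial coefficients appear, and the sequence
    [mulT p f g] has shift [mulT p (shift f) g + mulT p f (shift g)] by definition. *)
Fixpoint mulT (p : nat) (f g : nat -> R -> R) : R -> R :=
  match p with
  | O => fun x => f 0%nat x * g 0%nat x
  | S q => fun x => mulT q (shift f) g x + mulT q f (shift g) x
  end.

Lemma mulT_derive p : forall f g, tower (S p) f -> tower (S p) g ->
  forall x, is_derive (mulT p f g) x (mulT (S p) f g x).
Proof.
  assert (SH : forall q f, tower (S q) f -> tower q (shift f)).
  { intros q f H i Hi x. apply H. lia. }
  assert (DW : forall q f, tower (S q) f -> tower q f).
  { intros q f H i Hi x. apply H. lia. }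
  induction p as [|p IH]; intros f g Hf Hg x.
  - simpl. apply (is_derive_mult (f 0%nat) (g 0%nat)).
    + apply Hf. lia.
    + apply Hg. lia.
    + intros; apply Rmult_comm.
  - change (is_derive (fun x => mulT p (shift f) g x + mulT p f (shift g) x) x
      (mulT (S p) (shift f) g x + mulT (S p) f (shift g) x)).
    apply @is_derive_plus with (K := R_AbsRing) (V := R_NormedModule); apply IH; auto.
Qed.

Lemma mulT_ext p : forall f g g', (forall i, (i <= p)%nat -> g i = g' i) -> mulT p f g = mulT p f g'.
Proof.
  induction p as [|p IH]; intros f g g' H; simpl.
  - now rewrite (H 0%nat) by lia.
  - rewrite (IH (shift f) g g') by (intros; apply H; lia).
    rewrite (IH f (shift g) (shift g')) by (intros; apply H; lia). reflexivity.
Qed.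

Lemma mulT_periodic p : forall f g, (forall i, (i <= p)%nat -> periodic2pi (f i)) ->
  (forall i, (i <= p)%nat -> periodic2pi (g i)) -> periodic2pi (mulT p f g).
Proof.
  induction p as [|p IH]; intros f g Hf Hg t; simpl.
  - now rewrite (Hf 0%nat), (Hg 0%nat) by lia.
  - unfold periodic2pi in IH. f_equal; apply IH; intros i Hi; try (apply Hf; lia); apply Hg; lia.
Qed.

Definition bddLip (f : R -> R) : Prop :=
  exists B, (forall x, Rabs (f x) <= B) /\ Lipschitz B f.

Lemma bddLip_plus f g : bddLip f -> bddLip g -> bddLip (fun x => f x + g x).
Proof.
  intros [B [H1 H2]] [D [H3 H4]]. exists (B + D). split.
  - intros x. eapply Rle_trans; [apply Rabs_triang|]. specialize (H1 x); specialize (H3 x). lra.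
  - intros x y. replace (f x + g x - (f y + g y)) with ((f x - f y) + (g x - g y)) by ring.
    eapply Rle_trans; [apply Rabs_triang|]. specialize (H2 x y); specialize (H4 x y). lra.
Qed.

Lemma bddLip_mult f g : bddLip f -> bddLip g -> bddLip (fun x => f x * g x).
Proof.
  intros [B [H1 H2]] [D [H3 H4]]. exists (2 * B * D).
  assert (HB : 0 <= B) by (eapply Rle_trans; [apply Rabs_pos | apply (H1 0)]).
  assert (HD : 0 <= D) by (eapply Rle_trans; [apply Rabs_pos | apply (H3 0)]).
  split.
  - intros x. rewrite Rabs_mult. specialize (H1 x); specialize (H3 x).
    apply Rle_trans with (B * D); [apply Rmult_le_compat; auto; apply Rabs_pos | nra].
  - intros x y. replace (f x * g x - f y * g y) with ((f x - f y) * g x + f y * (g x - g y)) by ring.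
    eapply Rle_trans; [apply Rabs_triang|]. rewrite !Rabs_mult.
    specialize (H1 y); specialize (H3 x); specialize (H2 x y); specialize (H4 x y).
    pose proof (Rabs_pos (x - y)).
    apply Rle_trans with (B * Rabs (x - y) * D + B * (D * Rabs (x - y))); [|right; ring].
    apply Rplus_le_compat; apply Rmult_le_compat; auto; apply Rabs_pos.
Qed.

Lemma mulT_bddLip p : forall f g, (forall i, (i <= p)%nat -> bddLip (f i)) ->
  (forall i, (i <= p)%nat -> bddLip (g i)) -> bddLip (mulT p f g).
Proof.
  induction p as [|p IH]; intros f g Hf Hg; simpl.
  - apply bddLip_mult; auto.
  - apply bddLip_plus; apply IH; intros i Hi; try (apply Hf; lia); apply Hg; lia.
Qed.

Lemma derive_Lipschitz f f' B : (forall x, is_derive f x (f' x)) ->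
  (forall x, Rabs (f' x) <= B) -> Lipschitz B f.
Proof.
  intros Hd HB x y.
  destruct (MVT_gen f y x f') as [c [_ E]].
  - intros; apply Hd.
  - intros z _. apply continuity_pt_filterlim. apply (Rcont_derive f f' Hd).
  - rewrite E, Rabs_mult. apply Rmult_le_compat_r; [apply Rabs_pos | auto].
Qed.

Lemma periodic_Lipschitz_bounded f L : periodic2pi f -> Lipschitz L f ->
  forall x, Rabs (f x) <= Rabs (f 0) + L * (2 * PI).
Proof.
  intros Hp HL x. pose proof two_PI_pos as HPI.
  assert (HpN : forall n t, f (t + INR n * (2 * PI)) = f t).
  { induction n as [|n IH]; intros t.
    - simpl. now rewrite Rmult_0_l, Rplus_0_r.
    - rewrite S_INR. replace (t + (INR n + 1) * (2 * PI)) with (t + INR n * (2 * PI) + 2 * PI) by ring.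
      now rewrite Hp. }
  assert (HpZ : forall j t, f (t + IZR j * (2 * PI)) = f t).
  { intros j t. destruct (Z_le_gt_dec 0 j).
    - rewrite <- (Z2Nat.id j), <- INR_IZR_INZ by lia. apply HpN.
    - rewrite <- (HpN (Z.to_nat (- j)) (t + IZR j * (2 * PI))).
      rewrite INR_IZR_INZ, Z2Nat.id, opp_IZR by lia. f_equal. ring. }
  set (j := up (x / (2 * PI))). destruct (archimed (x / (2 * PI))) as [A1 A2]. fold j in A1, A2.
  set (y := x + IZR (- j) * (2 * PI)).
  assert (Hy : - (2 * PI) <= y <= 0).
  { unfold y. rewrite opp_IZR. assert (x = x / (2 * PI) * (2 * PI)) by (field; lra). nra. }
  rewrite <- (HpZ (- j)%Z x). fold y.
  replace (f y) with (f 0 + (f y - f 0)) by ring.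
  eapply Rle_trans; [apply Rabs_triang|]. apply Rplus_le_compat_l.
  eapply Rle_trans; [apply HL|]. apply Rmult_le_compat_l; [now apply (Lipschitz_const_nonneg L f)|].
  rewrite Rabs_left1; lra.
Qed.

Lemma periodic_bddLip f L : periodic2pi f -> Lipschitz L f -> bddLip f.
Proof.
  intros Hp HL. exists (Rabs (f 0) + L * (2 * PI) + L).
  pose proof (Lipschitz_const_nonneg L f HL). pose proof two_PI_pos. pose proof (Rabs_pos (f 0)).
  split.
  - intros x. pose proof (periodic_Lipschitz_bounded f L Hp HL x). lra.
  - intros x y. eapply Rle_trans; [apply HL|]. apply Rmult_le_compat_r; [apply Rabs_pos|]. nra.
Qed.

(** The derivatives of [exp v], from [(e^v)^(r+1) = (v' e^v)^(r)]. Since all lower derivatives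
    enter, [m] bounds the depth of the recursion; the entries [p <= m] are the meaningful ones and
    do not change when [m] grows. *)
Fixpoint expT (v : nat -> R -> R) (m : nat) : nat -> R -> R :=
  match m with
  | O => fun _ x => exp (v 0%nat x)
  | S q => fun p =>
      match p with
      | O => fun x => exp (v 0%nat x)
      | S r => mulT r (shift v) (expT v q)
      end
  end.

Lemma expT_0 v m : expT v m 0%nat = fun x => exp (v 0%nat x).
Proof. destruct m; reflexivity. Qed.

Lemma expT_tower v m : tower m v -> tower m (expT v m).
Proof.
  induction m as [|m IH]; intros Hv p Hp x; [lia|].
  assert (Hm : tower m (expT v m)) by (apply IH; intros i Hi; apply Hv; lia).
  destruct p as [|p].
  - rewrite expT_0. simpl. unfold shift. rewrite expT_0.
    apply (is_derive_comp (V := R_NormedModule) exp (v 0%nat)).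
    + apply is_derive_exp.
    + apply Hv. lia.
  - change (is_derive (mulT p (shift v) (expT v m)) x (mulT (S p) (shift v) (expT v m) x)).
    apply mulT_derive.
    + intros i Hi y. apply Hv. lia.
    + intros i Hi y. apply Hm. lia.
Qed.

Lemma expT_stable v m : forall p, (p <= m)%nat -> expT v (S m) p = expT v m p.
Proof.
  induction m as [|m IH]; intros p Hp.
  - now replace p with 0%nat by lia.
  - destruct p as [|p]; [reflexivity|].
    change (mulT p (shift v) (expT v (S m)) = mulT p (shift v) (expT v m)).
    apply mulT_ext. intros; apply IH. lia.
Qed.

Lemma expT_periodic v m : (forall i, (i <= m)%nat -> periodic2pi (v i)) ->
  forall p, (p <= m)%nat -> periodic2pi (expT v m p).
Proof.
  induction m as [|m IH]; intros Hv p Hp.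
  - intros t. simpl. now rewrite (Hv 0%nat) by lia.
  - destruct p as [|p].
    + intros t. simpl. now rewrite (Hv 0%nat) by lia.
    + apply mulT_periodic; intros i Hi; [apply Hv; lia|].
      apply IH; [intros; apply Hv; lia | lia].
Qed.

Lemma exp_bddLip f : bddLip f -> bddLip (fun x => exp (f x)).
Proof.
  intros [B [H1 H2]].
  assert (HB : 0 <= B) by (eapply Rle_trans; [apply Rabs_pos | apply (H1 0)]).
  assert (He : forall x, exp (f x) <= exp B).
  { intros x. apply exp_le_compat. eapply Rle_trans; [apply Rle_abs | apply H1]. }
  pose proof (exp_pos B).
  assert (Hexp : forall a b, a <= B -> b <= a -> exp a - exp b <= exp B * (a - b)).
  { intros a b Ha Hb. destruct (MVT_gen exp b a exp) as [c [Hc E]].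
    - intros; apply is_derive_exp.
    - intros z _. apply continuity_pt_filterlim, Rcont_exp.
    - rewrite Rmax_right in Hc by auto. rewrite E. apply Rmult_le_compat_r; [lra|].
      apply exp_le_compat. lra. }
  exists (exp B * (B + 1)). split.
  - intros x. rewrite Rabs_pos_eq by (left; apply exp_pos). specialize (He x). nra.
  - intros x y. assert (Hf : forall z, f z <= B) by (intros z; eapply Rle_trans; [apply Rle_abs | apply H1]).
    apply Rle_trans with (exp B * Rabs (f x - f y)).
    + destruct (Rle_dec (f y) (f x)) as [h|h].
      * rewrite !Rabs_pos_eq; [apply Hexp; auto|lra|].
        pose proof (exp_le_compat _ _ h). lra.
      * rewrite !Rabs_left1; [|lra|].
        -- rewrite !Ropp_minus_distr. apply Hexp; auto. lra.
        -- assert (f x <= f y) as h' by lra. pose proof (exp_le_compat _ _ h'). lra.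
    + specialize (H2 x y). pose proof (Rabs_pos (x - y)).
      apply Rle_trans with (exp B * (B * Rabs (x - y))); [apply Rmult_le_compat_l; lra|]. nra.
Qed.

Lemma expT_bddLip v m : (forall i, (i <= m)%nat -> bddLip (v i)) ->
  forall p, (p <= m)%nat -> bddLip (expT v m p).
Proof.
  induction m as [|m IH]; intros Hv p Hp.
  - simpl. apply exp_bddLip. auto.
  - destruct p as [|p].
    + simpl. apply exp_bddLip. apply Hv. lia.
    + apply mulT_bddLip; intros i Hi; [apply Hv; lia|].
      apply IH; [intros; apply Hv; lia | lia].
Qed.

(* The formal Taylor polynomial of [f 0] at [theta], evaluated at the imaginary increment [i s]. *)
Definition jet (m : nat) (f : nat -> R -> R) (theta s : R) : C :=
  csum (fun p => RtoC (f p theta / INR (fact p)) * (Ci * RtoC s) ^ p)%C (S m).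

Lemma jet_at_0 m f theta : jet m f theta 0 = RtoC (f 0%nat theta).
Proof.
  unfold jet. rewrite csum_S_l, (csum_ext _ (fun _ => RtoC 0)).
  - rewrite csum_zero. simpl. unfold Rdiv. rewrite Rinv_1, Rmult_1_r. ring.
  - intros i _. rewrite Cpow_S. ring.
Qed.

Lemma jet_plus m f g theta s :
  jet m (fun p x => f p x + g p x) theta s = (jet m f theta s + jet m g theta s)%C.
Proof.
  unfold jet. rewrite <- csum_plus. apply csum_ext. intros p _.
  unfold Rdiv. rewrite Rmult_plus_distr_r, RtoC_plus. ring.
Qed.

Lemma Cderiv_jet m f theta s :
  Cderiv (jet (S m) f theta) s (Ci * jet m (shift f) theta s)%C.
Proof.
  apply Cderiv_ext with (fun s => RtoC (f 0%nat theta)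
    + csum (fun p => (RtoC (f (S p) theta / INR (fact (S p))) * Ci ^ S p) * RtoC (s ^ S p)) (S m))%C.
  - intros t. unfold jet. rewrite (csum_S_l _ (S m)). f_equal.
    + simpl. unfold Rdiv. rewrite Rinv_1, Rmult_1_r. ring.
    + apply csum_ext. intros p _. rewrite Cpow_mult_l, <- RtoC_pow. ring.
  - replace (Ci * jet m (shift f) theta s)%C with (0%R + Ci * jet m (shift f) theta s)%C by ring.
    apply Cderiv_plus; [apply Cderiv_const|].
    unfold jet. rewrite <- csum_scal.
    apply (Cderiv_csum (fun p s => (RtoC (f (S p) theta / INR (fact (S p))) * Ci ^ S p) * RtoC (s ^ S p))%C).
    intros p _.
    replace (Ci * (RtoC (shift f p theta / INR (fact p)) * (Ci * RtoC s) ^ p))%C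
      with (RtoC (INR (S p)) * (RtoC (f (S p) theta / INR (fact (S p))) * Ci ^ S p) * RtoC (s ^ p))%C.
    + apply Cderiv_monomial.
    + rewrite Cpow_mult_l, RtoC_pow, Cpow_S.
      replace (shift f p theta / INR (fact p)) with (INR (S p) * (f (S p) theta / INR (fact (S p)))).
      * rewrite RtoC_mult. ring.
      * unfold shift. rewrite fact_simpl, mult_INR. field.
        split; [apply INR_fact_neq_0 | apply not_0_INR; lia].
Qed.

Definition bounded_upto (m : nat) (f : nat -> R -> R) : Prop :=
  exists B, 0 <= B /\ forall i, (i <= m)%nat -> forall x, Rabs (f i x) <= B.

Lemma bounded_upto_of_bddLip m f : (forall i, (i <= m)%nat -> bddLip (f i)) -> bounded_upto m f.
Proof.
  induction m as [|m IH]; intros H.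
  - destruct (H 0%nat ltac:(lia)) as [B [HB _]]. exists B. split.
    + eapply Rle_trans; [apply Rabs_pos | apply (HB 0)].
    + intros i Hi. now replace i with 0%nat by lia.
  - destruct IH as [B [HB HB']]; [intros; apply H; lia|].
    destruct (H (S m) ltac:(lia)) as [D [HD _]].
    assert (0 <= D) by (eapply Rle_trans; [apply Rabs_pos | apply (HD 0)]).
    exists (B + D). split; [lra|]. intros i Hi x.
    destruct (Nat.eq_dec i (S m)) as [->|].
    + specialize (HD x). lra.
    + specialize (HB' i ltac:(lia) x). lra.
Qed.

Lemma bounded_upto_mono m m' f : (m <= m')%nat -> bounded_upto m' f -> bounded_upto m f.
Proof. intros H [B [H1 H2]]. exists B. split; auto. intros; apply H2; lia. Qed.

Lemma bounded_upto_shift m f : bounded_upto (S m) f -> bounded_upto m (shift f).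
Proof. intros [B [H1 H2]]. exists B. split; auto. intros; apply H2; lia. Qed.

Lemma Cmod_jet_term (f : nat -> R -> R) p theta s B : 0 <= s -> Rabs (f p theta) <= B ->
  Cmod (RtoC (f p theta / INR (fact p)) * (Ci * RtoC s) ^ p)%C <= B * s ^ p.
Proof.
  intros Hs HB. rewrite Cmod_mult, Cmod_pow, Cmod_mult, Cmod_Ci, !Cmod_R, Rmult_1_l, (Rabs_pos_eq s) by auto.
  apply Rmult_le_compat_r; [now apply pow_le|].
  unfold Rdiv. rewrite Rabs_mult, Rabs_inv, (Rabs_pos_eq (INR _)) by apply pos_INR.
  assert (Hf : 1 <= INR (fact p)) by (apply (le_INR 1), lt_O_fact).
  assert (0 < / INR (fact p) <= 1).
  { split; [apply Rinv_0_lt_compat; lra|]. rewrite <- Rinv_1. apply Rinv_le_contravar; lra. }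
  pose proof (Rabs_pos (f p theta)). nra.
Qed.

Lemma jet_bounded m f s0 : 0 <= s0 -> bounded_upto m f ->
  exists D, 0 <= D /\ forall theta s, 0 <= s <= s0 -> Cmod (jet m f theta s) <= D.
Proof.
  intros Hs0 [B [HB Hf]]. exists (rsum (fun p => B * s0 ^ p) (S m)). split.
  - apply rsum_nonneg. intros; apply Rmult_le_pos; auto. now apply pow_le.
  - intros theta s Hs. apply Cmod_csum_le. intros p Hp.
    eapply Rle_trans; [apply Cmod_jet_term with (B := B); [lra | apply Hf; lia]|].
    apply Rmult_le_compat_l; auto. apply pow_incr. lra.
Qed.

Lemma Cderiv_bound_pow (f f' : R -> C) D n s : 0 <= s -> 0 <= D -> f 0 = 0%R ->
  (forall x, 0 <= x <= s -> Cderiv f x (f' x)) ->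
  (forall x, 0 <= x <= s -> Cmod (f' x) <= D * x ^ n) -> Cmod (f s) <= D * s ^ S n.
Proof.
  intros Hs HD F0 Hf Hle.
  assert (H : Cmod (f s - f 0) <= D * s ^ S n - D * 0 ^ S n).
  { apply (Cderiv_mean_value f f' (fun x => D * x ^ S n) (fun x => D * INR (S n) * x ^ n)); auto.
    - intros x _. apply is_derive_monomial.
    - intros x Hx. eapply Rle_trans; [now apply Hle|].
      apply Rmult_le_compat_r; [apply pow_le; lra|].
      assert (1 <= INR (S n)) by (apply (le_INR 1); lia). nra. }
  rewrite F0 in H. replace (f s - 0%R)%C with (f s) in H by ring.
  replace (0 ^ S n) with 0 in H by (simpl; ring). lra.
Qed.

(** Differentiating the error in [s] yields the errors for [(f', g)] and [(f, g')] one order lower,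
    plus products with the top term of a jet, which are themselves of order [s^(m+1)] at level
    [m + 1]. *)
Lemma jet_mult m : forall f g s0, 0 <= s0 -> bounded_upto m f -> bounded_upto m g ->
  exists D, 0 <= D /\ forall theta s, 0 <= s <= s0 ->
    Cmod (jet m (fun p => mulT p f g) theta s - jet m f theta s * jet m g theta s) <= D * s ^ S m.
Proof.
  induction m as [|m IH]; intros f g s0 Hs0 Hf Hg.
  - exists 0. split; [lra|]. intros theta s Hs. rewrite Rmult_0_l.
    replace (_ - _)%C with (RtoC 0); [rewrite Cmod_0; lra|].
    unfold jet. simpl. unfold Rdiv. rewrite Rinv_1, !Rmult_1_r, RtoC_mult. ring.
  - assert (Hf' := bounded_upto_mono m (S m) f ltac:(lia) Hf).
    assert (Hg' := bounded_upto_mono m (S m) g ltac:(lia) Hg).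
    destruct (IH (shift f) g s0 Hs0 (bounded_upto_shift _ _ Hf) Hg') as [D1 [P1 H1]].
    destruct (IH f (shift g) s0 Hs0 Hf' (bounded_upto_shift _ _ Hg)) as [D2 [P2 H2]].
    destruct (jet_bounded m (shift f) s0 Hs0 (bounded_upto_shift _ _ Hf)) as [D3 [P3 H3]].
    destruct (jet_bounded m (shift g) s0 Hs0 (bounded_upto_shift _ _ Hg)) as [D4 [P4 H4]].
    destruct Hf as [Bf [Pf Hf]], Hg as [Bg [Pg Hg]].
    set (D := D1 + D2 + D3 * Bg + Bf * D4).
    assert (0 <= D3 * Bg) by now apply Rmult_le_pos.
    assert (0 <= Bf * D4) by now apply Rmult_le_pos.
    assert (PD : 0 <= D) by (unfold D; lra).
    exists D. split; [auto|]. intros theta s Hs.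
    apply (Cderiv_bound_pow
      (fun s => jet (S m) (fun p => mulT p f g) theta s - jet (S m) f theta s * jet (S m) g theta s)%C
      (fun s => Ci * jet m (shift (fun p => mulT p f g)) theta s
        + (- (1)) * ((Ci * jet m (shift f) theta s) * jet (S m) g theta s
           + jet (S m) f theta s * (Ci * jet m (shift g) theta s)))%C); try lra.
    + rewrite !jet_at_0. simpl. rewrite RtoC_mult. ring.
    + intros x _.
      apply Cderiv_ext with (fun s => jet (S m) (fun p => mulT p f g) theta s
        + (- (1)) * (jet (S m) f theta s * jet (S m) g theta s))%C; [intros; ring|].
      apply Cderiv_plus; [apply Cderiv_jet|]. apply Cderiv_scal.
      apply Cderiv_mult; apply Cderiv_jet.
    + intros x Hx. assert (Hx' : 0 <= x <= s0) by lra.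
      assert (Hxp : 0 <= x ^ S m) by (apply pow_le; lra).
      specialize (H1 theta x Hx'). specialize (H2 theta x Hx').
      specialize (H3 theta x Hx'). specialize (H4 theta x Hx').
      pose proof (Cmod_jet_term f (S m) theta x Bf ltac:(lra) (Hf (S m) ltac:(lia) theta)) as Tf.
      pose proof (Cmod_jet_term g (S m) theta x Bg ltac:(lra) (Hg (S m) ltac:(lia) theta)) as Tg.
      set (tf := (RtoC (f (S m) theta / INR (fact (S m))) * (Ci * RtoC x) ^ S m)%C) in *.
      set (tg := (RtoC (g (S m) theta / INR (fact (S m))) * (Ci * RtoC x) ^ S m)%C) in *.
      assert (Ef : jet (S m) f theta x = (jet m f theta x + tf)%C) by reflexivity.
      assert (Eg : jet (S m) g theta x = (jet m g theta x + tg)%C) by reflexivity.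
      rewrite Ef, Eg.
      change (shift (fun p => mulT p f g))
        with (fun p x => mulT p (shift f) g x + mulT p f (shift g) x).
      rewrite (jet_plus m (fun p => mulT p (shift f) g) (fun p => mulT p f (shift g))).
      match goal with |- Cmod ?X <= _ => replace X with
        (Ci * ((jet m (fun p => mulT p (shift f) g) theta x - jet m (shift f) theta x * jet m g theta x)
         + (jet m (fun p => mulT p f (shift g)) theta x - jet m f theta x * jet m (shift g) theta x)
         - (jet m (shift f) theta x * tg + tf * jet m (shift g) theta x)))%C by ring end.
      rewrite Cmod_mult, Cmod_Ci, Rmult_1_l.
      eapply Rle_trans; [apply Cmod_sub_le|].
      eapply Rle_trans; [apply Rplus_le_compat; apply Cmod_triangle|]. rewrite !Cmod_mult.
      assert (Cmod (jet m (shift f) theta x) * Cmod tg <= D3 * (Bg * x ^ S m))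
        by (apply Rmult_le_compat; auto; apply Cmod_ge_0).
      assert (Cmod tf * Cmod (jet m (shift g) theta x) <= Bf * x ^ S m * D4)
        by (apply Rmult_le_compat; auto; apply Cmod_ge_0).
      unfold D. lra.
Qed.

(** In the variable [s], [exp (jet v)] solves [y' = (jet v)' y], and the jet of [exp v] solves it up
    to the error of [jet_mult] and a top term. Hence [y exp (- jet v)] starts at 1 and hardly
    moves. *)
Lemma jet_exp m v s0 : 0 <= s0 -> (forall i, (i <= m)%nat -> bddLip (v i)) ->
  exists D, 0 <= D /\ forall theta s, 0 <= s <= s0 ->
    Cmod (jet m (expT v m) theta s - Cexp (jet m v theta s)) <= D * s ^ S m.
Proof.
  intros Hs0 Hv. destruct m as [|m].
  - exists 0. split; [lra|]. intros theta s Hs. rewrite Rmult_0_l.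
    replace (_ - _)%C with (RtoC 0); [rewrite Cmod_0; lra|].
    unfold jet. simpl. unfold Rdiv. rewrite Rinv_1, !Rmult_1_r, !Cplus_0_l, !Cmult_1_r, Cexp_RtoC. ring.
  - assert (Bv : bounded_upto (S m) v) by now apply bounded_upto_of_bddLip.
    assert (Be : bounded_upto m (expT v m)).
    { apply bounded_upto_of_bddLip. intros; apply expT_bddLip; auto. }
    assert (BE : bounded_upto (S m) (expT v (S m))).
    { apply bounded_upto_of_bddLip. intros; apply expT_bddLip; auto. }
    destruct (jet_mult m (shift v) (expT v m) s0 Hs0 (bounded_upto_shift _ _ Bv) Be) as [D1 [P1 H1]].
    destruct (jet_bounded m (shift v) s0 Hs0 (bounded_upto_shift _ _ Bv)) as [D2 [P2 H2]].
    destruct (jet_bounded (S m) v s0 Hs0 Bv) as [D3 [P3 H3]].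
    destruct BE as [B [PB HB]].
    assert (PE := exp_pos D3).
    set (D := exp D3 * (D1 + D2 * B)).
    assert (0 <= D2 * B) by now apply Rmult_le_pos.
    assert (PD : 0 <= D) by (apply Rmult_le_pos; lra).
    exists (exp D3 * D). split; [apply Rmult_le_pos; lra|]. intros theta s Hs.
    set (y := jet (S m) (expT v (S m)) theta). set (b := jet (S m) v theta).
    assert (HE : forall e x, Rabs e <= 1 -> 0 <= x <= s0 -> Cmod (Cexp (RtoC e * b x)) <= exp D3).
    { intros e x He Hx. rewrite Cmod_Cexp. apply exp_le_compat.
      eapply Rle_trans; [apply Rle_abs|]. eapply Rle_trans; [apply re_le_Cmod|].
      rewrite Cmod_mult, Cmod_R. specialize (H3 theta x Hx). fold b in H3.
      pose proof (Cmod_ge_0 (b x)). pose proof (Rabs_pos e). nra. }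
    assert (Z : Cmod (y s * Cexp (RtoC (-1) * b s) - 1%R) <= D * s ^ S (S m)).
    { apply (Cderiv_bound_pow (fun s => y s * Cexp (RtoC (-1) * b s) - 1%R)%C
        (fun s => (Ci * jet m (shift (expT v (S m))) theta s) * Cexp (RtoC (-1) * b s)
           + y s * ((RtoC (-1) * (Ci * jet m (shift v) theta s)) * Cexp (RtoC (-1) * b s)))%C); try lra.
      - unfold y, b. rewrite !jet_at_0, expT_0, <- RtoC_mult, Cexp_RtoC, <- RtoC_mult, <- exp_plus.
        replace (v 0%nat theta + -1 * v 0%nat theta) with 0 by ring. rewrite exp_0. ring.
      - intros x _.
        apply Cderiv_ext with (fun s => y s * Cexp (RtoC (-1) * b s) + - (1))%C; [intros; ring|].
        match goal with |- Cderiv _ _ ?X => replace X with (X + RtoC 0)%C by ring end.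
        apply Cderiv_plus; [|apply Cderiv_const].
        apply (Cderiv_mult y (fun s => Cexp (RtoC (-1) * b s))); [apply Cderiv_jet|].
        apply (Cderiv_Cexp (fun s => RtoC (-1) * b s)%C). apply Cderiv_scal, Cderiv_jet.
      - intros x Hx. assert (Hx' : 0 <= x <= s0) by lra.
        assert (Hxp : 0 <= x ^ S m) by (apply pow_le; lra).
        set (te := (RtoC (expT v (S m) (S m) theta / INR (fact (S m))) * (Ci * RtoC x) ^ S m)%C).
        assert (Te : Cmod te <= B * x ^ S m) by (apply Cmod_jet_term; [lra | apply HB; lia]).
        assert (Ey : y x = (jet m (expT v m) theta x + te)%C).
        { unfold y. change (jet (S m) (expT v (S m)) theta x) with (jet m (expT v (S m)) theta x + te)%C.
          f_equal. unfold jet. apply csum_ext. intros p Hp. now rewrite expT_stable by lia. }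
        change (shift (expT v (S m))) with (fun p => mulT p (shift v) (expT v m)).
        specialize (H1 theta x Hx'). specialize (H2 theta x Hx').
        rewrite Ey.
        match goal with |- Cmod ?X <= _ => replace X with
          (Cexp (RtoC (-1) * b x) * (Ci * ((jet m (fun p => mulT p (shift v) (expT v m)) theta x
              - jet m (shift v) theta x * jet m (expT v m) theta x) - jet m (shift v) theta x * te)))%C by ring end.
        rewrite !Cmod_mult, Cmod_Ci, Rmult_1_l. unfold D. rewrite Rmult_assoc.
        apply Rmult_le_compat; try apply Cmod_ge_0.
        + apply HE; auto. rewrite Rabs_left; lra.
        + eapply Rle_trans; [apply Cmod_sub_le|]. rewrite Cmod_mult.
          assert (Cmod (jet m (shift v) theta x) * Cmod te <= D2 * (B * x ^ S m))
            by (apply Rmult_le_compat; auto; apply Cmod_ge_0).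
          lra. }
    replace (y s - Cexp (b s))%C with ((y s * Cexp (RtoC (-1) * b s) - 1%R) * Cexp (RtoC 1 * b s))%C.
    + rewrite Cmod_mult, Rmult_comm, Rmult_assoc. apply Rmult_le_compat; auto; try apply Cmod_ge_0.
      apply HE; auto. rewrite Rabs_R1; lra.
    + rewrite Cmult_1_l.
      assert (E1 : (Cexp (RtoC (-1) * b s) * Cexp (b s))%C = 1%R).
      { rewrite <- Cexp_plus, <- Cexp_0. f_equal. ring. }
      replace ((y s * Cexp (RtoC (-1) * b s) - 1%R) * Cexp (b s))%C
        with (y s * (Cexp (RtoC (-1) * b s) * Cexp (b s)) - Cexp (b s))%C by ring.
      rewrite E1. ring.
Qed.

(** With [s = - ln r], the point [r e^(it)] is [e^(i (t + i s))]; inside the disc [s] is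
    positive. *)
Lemma Eext_jet k V r t : Eext k V r t = jet (k - 1) (Derive_n V) t (- ln r).
Proof.
  unfold Eext, jet. rewrite sum_n_csum. apply csum_ext. intros p _. do 2 f_equal.
  rewrite RtoC_opp. ring.
Qed.

(** Descent from the top derivative: a periodic Lipschitz function is bounded, and a bounded
    derivative makes the next lower one Lipschitz. *)
Lemma C_lip_tower k V : periodic2pi V -> C_lip k V ->
  tower (k - 1) (Derive_n V) /\
  forall p, (p <= k - 1)%nat -> periodic2pi (Derive_n V p) /\ bddLip (Derive_n V p).
Proof.
  intros Hp [Hd [L HL]].
  assert (Ht : tower (k - 1) (Derive_n V)).
  { intros p Hpk x. apply Derive_correct. apply (Hd (S p) x). lia. }
  assert (Hper : forall p, periodic2pi (Derive_n V p)).
  { intros p t. rewrite <- Derive_n_comp_trans. apply Derive_n_ext. auto. }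
  split; auto.
  assert (HB : forall d, (d <= k - 1)%nat -> bddLip (Derive_n V (k - 1 - d))).
  { induction d as [|d IH]; intros Hdk.
    - rewrite Nat.sub_0_r. apply periodic_bddLip with L; auto.
    - destruct (IH ltac:(lia)) as [B [HB _]].
      apply periodic_bddLip with B; auto.
      apply derive_Lipschitz with (Derive_n V (k - 1 - d)); auto.
      intros x. replace (k - 1 - d)%nat with (S (k - 1 - S d)) by lia. apply Ht. lia. }
  intros p Hpk. split; auto. replace p with (k - 1 - (k - 1 - p))%nat by lia. apply HB. lia.
Qed.

(** * Multiplication by absolutely convergent Fourier series *)

(* [e = 1] for power series in [z], [e = -1] for power series in [1/z]. *)
Definition unif_series (e : Z) (phi : nat -> C) (Phi : R -> C) : Prop :=
  forall d, 0 < d -> exists N, forall n, (N <= n)%nat -> forall t,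
    Cmod (Phi t - csum (fun j => phi j * eit (IZR (e * Z.of_nat j) * t))%C n) <= d.

Lemma Ccont_eit_sum (c : nat -> C) (iota : nat -> Z) n :
  Ccont (fun t => csum (fun j => c j * eit (IZR (iota j) * t))%C n).
Proof.
  apply (Ccont_csum (fun j t => c j * eit (IZR (iota j) * t))%C). intros j.
  apply Ccont_mult; auto using Ccont_const, Ccont_eit.
Qed.

Lemma unif_series_Ccont e phi Phi : unif_series e phi Phi -> Ccont Phi.
Proof.
  intros H. apply Ccont_unif_limit. intros d Hd. destruct (H d Hd) as [N HN].
  exists (fun t => csum (fun j => phi j * eit (IZR (e * Z.of_nat j) * t))%C N). split.
  - apply (Ccont_eit_sum phi (fun j => (e * Z.of_nat j)%Z)).
  - intros x. apply HN. auto.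
Qed.

Lemma unif_series_conj e phi Phi : unif_series e phi Phi ->
  unif_series (- e) (fun j => Cconj (phi j)) (fun t => Cconj (Phi t)).
Proof.
  intros H d Hd. destruct (H d Hd) as [N HN]. exists N. intros n Hn t.
  specialize (HN n Hn t). rewrite <- Cmod_conj, Cminus_conj, csum_conj in HN.
  rewrite (csum_ext _ (fun j => Cconj (phi j * eit (IZR (e * Z.of_nat j) * t)))%C); auto.
  intros j _. rewrite Cmult_conj, eit_conj. do 2 f_equal.
  replace (- e * Z.of_nat j)%Z with (- (e * Z.of_nat j))%Z by ring. rewrite opp_IZR. ring.
Qed.

(** Uniform convergence of [Phi] and boundedness of [f] on a period give one [N] for all frequencies
    [l]; the estimates of sums over [l] rely on this. *)
Lemma coef_mult_series e phi Phi f : Ccont f -> unif_series e phi Phi ->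
  forall d, 0 < d -> exists N, forall n, (N <= n)%nat -> forall l,
    Cmod (coef (fun t => f t * Phi t)%C l
          - csum (fun j => phi j * coef f (l - e * Z.of_nat j))%C n) <= d.
Proof.
  intros Hf HP d Hd. pose proof (unif_series_Ccont _ _ _ HP) as HPc.
  destruct (Ccont_bounded f (- PI) PI Hf) as [B [HB0 HB]].
  destruct (HP (d / B) ltac:(now apply Rdiv_lt_0_compat)) as [N HN].
  exists N. intros n Hn l.
  set (S := fun t => csum (fun j => phi j * eit (IZR (e * Z.of_nat j) * t))%C n).
  assert (HS : Ccont S) by apply (Ccont_eit_sum phi (fun j => (e * Z.of_nat j)%Z)).
  assert (E : csum (fun j => phi j * coef f (l - e * Z.of_nat j))%C n = coef (fun t => f t * S t)%C l).
  { rewrite (coef_ext _ (fun t => csum (fun j => phi j * (f t * eit (IZR (e * Z.of_nat j) * t)))%C n)).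
    - rewrite (coef_csum (fun j t => phi j * (f t * eit (IZR (e * Z.of_nat j) * t)))%C).
      + apply csum_ext. intros j _. rewrite coef_scal by now apply Ccont_mult_eit.
        now rewrite coef_mult_eit.
      + intros j. apply Ccont_mult; [apply Ccont_const | now apply Ccont_mult_eit].
    - intros t. unfold S. rewrite <- csum_scal. apply csum_ext. intros; ring. }
  rewrite E, <- coef_minus by now apply Ccont_mult.
  apply Cmod_coef_le.
  - apply Ccont_minus; now apply Ccont_mult.
  - intros t Ht. replace (f t * Phi t - f t * S t)%C with (f t * (Phi t - S t))%C by ring.
    rewrite Cmod_mult. apply Rle_trans with (B * (d / B)).
    + apply Rmult_le_compat; auto using Cmod_ge_0. now apply HN.
    + right. field. lra.
Qed.

(** Meant for factors whose supports make the convolution finite: its partial sums are eventually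
    constant and the limit is exact. *)
Lemma coef_mult_series_eq e phi Phi f l x N0 : Ccont f -> unif_series e phi Phi ->
  (forall n, (N0 <= n)%nat -> csum (fun j => phi j * coef f (l - e * Z.of_nat j))%C n = x) ->
  coef (fun t => f t * Phi t)%C l = x.
Proof.
  intros Hf HP Hx. apply Ceq_minus. apply Cmod_eq_0. apply Rle_antisym; [|apply Cmod_ge_0].
  apply Rle_eps_plus with 1; [lra|]. intros d Hd.
  destruct (coef_mult_series e phi Phi f Hf HP d Hd) as [N HN].
  specialize (HN (N + N0)%nat ltac:(lia) l). rewrite Hx in HN by lia. lra.
Qed.

Lemma coef_series_neg phi Phi l : unif_series 1 phi Phi -> (l < 0)%Z -> coef Phi l = 0%R.
Proof.
  intros HP Hl. rewrite (coef_ext _ (fun t => 1%R * Phi t)%C) by (intros; ring).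
  apply (coef_mult_series_eq 1 phi Phi (fun _ => RtoC 1) l 0%R 0%nat); auto using Ccont_const.
  intros n _. rewrite (csum_ext _ (fun _ => RtoC 0)); [apply csum_zero|].
  intros j _. rewrite coef_const. destruct (Z.eq_dec _ _); [lia | ring].
Qed.

Lemma csum_single (c : nat -> C) i n : (forall j, j <> i -> c j = 0%R) -> (i < n)%nat -> csum c n = c i.
Proof.
  intros H Hi. replace n with (i + (1 + (n - i - 1)))%nat by lia. rewrite !csum_add.
  rewrite (csum_ext c (fun _ => RtoC 0)) by (intros; apply H; lia).
  rewrite (csum_ext (fun j => c (i + (1 + j))%nat) (fun _ => RtoC 0)) by (intros; apply H; lia).
  rewrite !csum_zero. simpl. rewrite Nat.add_0_r. ring.
Qed.

Lemma coef_series_nonneg phi Phi (i : nat) : unif_series 1 phi Phi -> coef Phi (Z.of_nat i) = phi i.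
Proof.
  intros HP. rewrite (coef_ext _ (fun t => 1%R * Phi t)%C) by (intros; ring).
  apply (coef_mult_series_eq 1 phi Phi (fun _ => RtoC 1) (Z.of_nat i) (phi i) (S i)); auto using Ccont_const.
  intros n Hn. rewrite (csum_single _ i); [| |lia].
  - rewrite coef_const. destruct (Z.eq_dec _ _); [ring | lia].
  - intros j Hj. rewrite coef_const. destruct (Z.eq_dec _ _); [lia | ring].
Qed.

Lemma coef_poly (c : nat -> C) n l :
  coef (fun t => csum (fun j => c j * eit (IZR (Z.of_nat j) * t))%C n) l
  = if Z_lt_dec l 0 then 0%R else if Z_lt_dec l (Z.of_nat n) then c (Z.to_nat l) else 0%R.
Proof.
  rewrite (coef_csum (fun j t => c j * eit (IZR (Z.of_nat j) * t))%C).
  2:{ intros j. apply Ccont_mult; auto using Ccont_const, Ccont_eit. }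
  rewrite (csum_ext _ (fun j => c j * (if Z.eq_dec l (Z.of_nat j) then 1%R else 0%R))%C).
  2:{ intros j _. now rewrite coef_scal, coef_eit by apply Ccont_eit. }
  destruct (Z_lt_dec l 0); [|destruct (Z_lt_dec l (Z.of_nat n))].
  - rewrite (csum_ext _ (fun _ => RtoC 0)); [apply csum_zero|].
    intros j _. destruct (Z.eq_dec _ _); [lia | ring].
  - rewrite (csum_single _ (Z.to_nat l)); [| |lia].
    + destruct (Z.eq_dec _ _); [ring | lia].
    + intros j Hj. destruct (Z.eq_dec _ _); [lia | ring].
  - rewrite (csum_ext _ (fun _ => RtoC 0)); [apply csum_zero|].
    intros j Hj. destruct (Z.eq_dec _ _); [lia | ring].
Qed.

Lemma sqnorm_eit_sum (c : nat -> C) (iota : nat -> Z) n : (forall i j, iota i = iota j -> i = j) ->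
  sqnorm (fun t => csum (fun j => c j * eit (IZR (iota j) * t))%C n) = rsum (fun j => Cmod (c j) ^ 2) n.
Proof.
  intros Hi. induction n as [|n IH]; cbn [csum rsum].
  - unfold sqnorm. rewrite (mean_ext _ (fun _ => 0)), mean_const; auto.
    intros; rewrite Cmod_0; ring.
  - set (S := fun t => csum (fun j => c j * eit (IZR (iota j) * t))%C n) in *.
    assert (HS : Ccont S) by apply Ccont_eit_sum.
    rewrite <- IH, <- (Cmod_opp (c n)).
    transitivity (sqnorm (fun t => S t - (- c n) * eit (IZR (iota n) * t))%C).
    { unfold sqnorm. apply mean_ext. intros t. unfold S. do 2 f_equal. ring. }
    rewrite sqnorm_minus_eit by auto.
    assert (E : coef S (iota n) = 0%R).
    { unfold S. rewrite (coef_csum (fun j t => c j * eit (IZR (iota j) * t))%C).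
      - rewrite (csum_ext _ (fun _ => RtoC 0)); [apply csum_zero|].
        intros j Hj. rewrite coef_scal, coef_eit by apply Ccont_eit.
        destruct (Z.eq_dec _ _) as [h|h]; [apply Hi in h; lia | ring].
      - intros j. apply Ccont_mult; auto using Ccont_const, Ccont_eit. }
    rewrite E, Cmult_0_r. simpl Re. ring.
Qed.

(* The frequencies below [b] reach [b] and above only through the tails of [phi], which form a
   Hankel operator. *)
Lemma coef_mult_series_sum alpha tau A phi Phi q b L Bq X :
  (forall i, Cmod (phi i) <= alpha i) -> (forall n, rsum alpha n <= A) -> 0 <= tau ->
  (forall N, 4 * rsum (fun i => (INR i * alpha i) ^ 2) N <= tau ^ 2) ->
  Ccont q -> unif_series 1 phi Phi -> 0 <= X ->
  rsum (fun j => Cmod (coef q (b + Z.of_nat j))) L <= Bq ->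
  (forall M, rsum (fun m => Cmod (coef q (b - 1 - Z.of_nat m)) ^ 2) M <= X ^ 2) ->
  rsum (fun l => Cmod (coef (fun t => q t * Phi t)%C (b + Z.of_nat l))) L <= A * Bq + tau * X.
Proof.
  intros Hphi HA Htau HT Hq HP HX HBq HXs.
  assert (Ha : forall i, 0 <= alpha i) by (intros i; eapply Rle_trans; [apply Cmod_ge_0 | apply Hphi]).
  assert (HBq0 : 0 <= Bq) by (eapply Rle_trans; [apply rsum_nonneg; intros; apply Cmod_ge_0 | apply HBq]).
  apply Rle_eps_plus with (INR L); [apply pos_INR|]. intros d Hd.
  destruct (coef_mult_series 1 phi Phi q Hq HP d Hd) as [N HN].
  set (n := (N + L)%nat). specialize (HN n ltac:(lia)).
  set (x := fun j => Cmod (coef q (b + Z.of_nat j))) in *.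
  set (y := fun m => Cmod (coef q (b - 1 - Z.of_nat m))) in *.
  (* A term [j <= l] of the convolution picks a frequency of [q] at least [b], while [j = l + m + 1]
     picks [b - 1 - m]. The slack [d] is paid once for each of the [L] coefficients. *)
  assert (Hl : forall l, (l < L)%nat -> Cmod (coef (fun t => q t * Phi t)%C (b + Z.of_nat l))
     <= rsum (fun j => alpha j * x (l - j)%nat) (S l) + rsum (fun m => alpha (l + S m)%nat * y m) n + d).
  { intros l Hl. specialize (HN (b + Z.of_nat l)%Z).
    set (s := csum _ n) in HN.
    assert (Hs : Cmod s <= rsum (fun j => alpha j * x (l - j)%nat) (S l) + rsum (fun m => alpha (l + S m)%nat * y m) n).
    { apply Rle_trans with (rsum (fun j => alpha j * Cmod (coef q (b + Z.of_nat l - 1 * Z.of_nat j))) n).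
      - apply Cmod_csum_le. intros j _. rewrite Cmod_mult. apply Rmult_le_compat_r; [apply Cmod_ge_0 | auto].
      - replace n with (S l + (n - S l))%nat at 1 by lia. rewrite rsum_add. apply Rplus_le_compat.
        + right. apply rsum_ext. intros j Hj. unfold x. do 3 f_equal. lia.
        + apply Rle_trans with (rsum (fun m => alpha (l + S m)%nat * y m) (n - S l)).
          * right. apply rsum_ext. intros m Hm. unfold y. f_equal; [f_equal; lia | do 2 f_equal; lia].
          * apply rsum_mono; [|lia]. intros m. apply Rmult_le_pos; auto. apply Cmod_ge_0. }
    replace (coef (fun t => q t * Phi t)%C (b + Z.of_nat l))
      with ((coef (fun t => q t * Phi t)%C (b + Z.of_nat l) - s) + s)%C by ring.
    eapply Rle_trans; [apply Cmod_triangle|]. lra. }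
  eapply Rle_trans; [apply rsum_le; intros l HlL; apply Hl; auto|].
  rewrite !rsum_plus, rsum_const. apply Rplus_le_compat_r. apply Rplus_le_compat.
  - rewrite (rsum_triangle (fun j i => alpha j * x i)).
    apply Rle_trans with (rsum (fun j => alpha j * Bq) L).
    + apply rsum_le. intros j Hj. rewrite rsum_scal. apply Rmult_le_compat_l; auto.
      eapply Rle_trans; [|apply HBq]. apply rsum_mono; [intros; apply Cmod_ge_0 | lia].
    + rewrite rsum_scal_r. apply Rmult_le_compat_r; auto.
  - apply hankel_bound; auto. intros; apply Cmod_ge_0.
Qed.

(** A series in [1/z] only lowers frequencies, so nothing leaks from the negative ones into the
    nonnegative ones and the plain [l^1] bound is enough. *)
Lemma coef_mult_coseries_sum alpha A phi Phi u L B :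
  (forall i, Cmod (phi i) <= alpha i) -> (forall n, rsum alpha n <= A) ->
  Ccont u -> unif_series (-1) phi Phi ->
  (forall n, rsum (fun l => Cmod (coef u (Z.of_nat l))) n <= B) ->
  rsum (fun j => Cmod (coef (fun t => u t * Phi t)%C (Z.of_nat j))) L <= A * B.
Proof.
  intros Hphi HA Hu HP HB.
  assert (Ha : forall i, 0 <= alpha i) by (intros i; eapply Rle_trans; [apply Cmod_ge_0 | apply Hphi]).
  assert (HB0 : 0 <= B) by (eapply Rle_trans; [|apply (HB 0%nat)]; simpl; lra).
  apply Rle_eps_plus with (INR L); [apply pos_INR|]. intros d Hd.
  destruct (coef_mult_series (-1) phi Phi u Hu HP d Hd) as [n HN].
  specialize (HN n (Nat.le_refl n)).
  apply Rle_trans with (rsum (fun j => rsum (fun i => alpha i * Cmod (coef u (Z.of_nat (i + j)))) n + d) L).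
  - apply rsum_le. intros j _. specialize (HN (Z.of_nat j)). set (s := csum _ n) in HN.
    assert (Hs : Cmod s <= rsum (fun i => alpha i * Cmod (coef u (Z.of_nat (i + j)))) n).
    { apply Cmod_csum_le. intros i _. rewrite Cmod_mult.
      replace (Z.of_nat j - -1 * Z.of_nat i)%Z with (Z.of_nat (i + j)) by lia.
      apply Rmult_le_compat_r; [apply Cmod_ge_0 | auto]. }
    replace (coef (fun t => u t * Phi t)%C (Z.of_nat j))
      with ((coef (fun t => u t * Phi t)%C (Z.of_nat j) - s) + s)%C by ring.
    eapply Rle_trans; [apply Cmod_triangle|]. lra.
  - rewrite rsum_plus, rsum_const, rsum_swap. apply Rplus_le_compat_r.
    apply Rle_trans with (rsum (fun i => alpha i * B) n).
    + apply rsum_le. intros i _. rewrite rsum_scal. apply Rmult_le_compat_l; auto.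
      eapply Rle_trans; [|apply (HB (i + L)%nat)]. rewrite rsum_add.
      pose proof (rsum_nonneg (fun l => Cmod (coef u (Z.of_nat l))) i (fun _ _ => Cmod_ge_0 _)). lra.
    + rewrite rsum_scal_r. apply Rmult_le_compat_r; auto.
Qed.

(** * Coefficients of the orthogonal polynomials *)

Lemma polyC_eit c n t : polyC c n (eit t) = csum (fun j => c j * eit (IZR (Z.of_nat j) * t))%C (S n).
Proof.
  unfold polyC. rewrite sum_n_csum. apply csum_ext. intros j _.
  now rewrite eit_pow, INR_IZR_INZ.
Qed.

Lemma Cconj_1 : Cconj 1%R = 1%R.
Proof. unfold Cconj, RtoC; simpl; f_equal; ring. Qed.

(* [F G = 1] with both power series; the weight is [w0 |F|^2].  The function [y] compares the
   polynomial with [z^n / conj F]; its small norm comes from minimality, and its nonnegative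
   coefficients are then recovered in three multiplications. *)
Lemma orthogonal_coefficients alpha tau A D k f g F G w w0 :
  (forall i, Cmod (f i) <= alpha i) -> (forall i, Cmod (g i) <= alpha i) ->
  f 0%nat = 1%R -> g 0%nat = 1%R ->
  (forall n, rsum alpha n <= A) -> 0 <= tau ->
  (forall N, 4 * rsum (fun i => (INR i * alpha i) ^ 2) N <= tau ^ 2) ->
  (forall N, rsum (fun i => (INR i ^ k * alpha i) ^ 2) N <= D) ->
  unif_series 1 f F -> unif_series 1 g G ->
  (forall t, (F t * G t)%C = 1%R) -> (forall t, Cmod (F t) <= A) -> (forall t, Cmod (G t) <= A) ->
  0 < w0 -> (forall t, RtoC (w t) = (RtoC w0 * (F t * Cconj (F t)))%C) ->
  forall n c, (1 <= n)%nat -> monic_OP w n c ->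
  rsum (fun j => Cmod (c j - Cconj (g (n - j)%nat))) n
  <= (A * A + 1) * tau * A ^ 3 * sqrt (2 * D + 2) / INR n ^ k.
Proof.
  intros Hf Hg f0 g0 HA Htau HT HD UF UG HFG BF BG Hw0 Hw n c Hn [Hcn Horth].
  pose proof (unif_series_Ccont _ _ _ UF) as CF. pose proof (unif_series_Ccont _ _ _ UG) as CG.
  pose proof (unif_series_conj _ _ _ UF) as UFc. pose proof (unif_series_conj _ _ _ UG) as UGc.
  change (- (1))%Z with (-1)%Z in UFc, UGc.
  set (Fc := fun t => Cconj (F t)) in *. set (Gc := fun t => Cconj (G t)) in *.
  assert (CFc : Ccont Fc) by now apply Ccont_conj.
  assert (CGc : Ccont Gc) by now apply Ccont_conj.
  assert (HFGc : forall t, (Fc t * Gc t)%C = 1%R).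
  { intros t. unfold Fc, Gc. rewrite <- Cmult_conj, HFG. apply Cconj_1. }
  assert (Ha : forall i, 0 <= alpha i) by (intros i; eapply Rle_trans; [apply Cmod_ge_0 | apply Hf]).
  assert (HA0 : 0 <= A) by (specialize (HA 0%nat); simpl in HA; lra).
  assert (HD0 : 0 <= D) by (specialize (HD 0%nat); simpl in HD; lra).
  assert (Hn0 : 0 < INR n) by (apply lt_0_INR; lia).
  assert (Hnk : 0 < INR n ^ k) by now apply pow_lt.
  set (zn := Z.of_nat n).
  set (P := fun t => csum (fun j => c j * eit (IZR (Z.of_nat j) * t))%C (S n)).
  assert (CP : Ccont P) by apply (Ccont_eit_sum c Z.of_nat).
  assert (CE : Ccont (fun t => eit (IZR zn * t))) by apply Ccont_eit.
  set (y := fun t => (P t - Gc t * eit (IZR zn * t))%C).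
  assert (CGE : Ccont (fun t => Gc t * eit (IZR zn * t))%C) by now apply Ccont_mult_eit.
  assert (Cy : Ccont y) by now apply Ccont_minus.
  set (u := fun t => (y t * Fc t * F t)%C).
  assert (Cq : Ccont (fun t => y t * Fc t)%C) by now apply Ccont_mult.
  assert (Cu : Ccont u) by now apply Ccont_mult.
  assert (Cv : Ccont (fun t => y t * F t)%C) by now apply Ccont_mult.
  (* As the weight is [w0 F conj F], orthogonality of [P] to [z^l] is the vanishing of a coefficient
     of [P F conj F]; the other part of [u] is [F z^n], without frequencies below [n]. *)
  assert (Hu : forall l, (0 <= l < zn)%Z -> coef u l = 0%R).
  { intros l Hl.
    rewrite (coef_ext _ (fun t => P t * (F t * Fc t) - F t * eit (IZR zn * t))%C).
    2:{ intros t. unfold u, y.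
        replace ((P t - Gc t * eit (IZR zn * t)) * Fc t * F t)%C
          with (P t * (F t * Fc t) - (Fc t * Gc t) * (F t * eit (IZR zn * t)))%C by ring.
        rewrite HFGc. ring. }
    rewrite coef_minus by (auto using Ccont_mult, Ccont_mult_eit).
    rewrite coef_mult_eit, (coef_series_neg f F) by (auto; lia).
    assert (E : coef (fun t => P t * (F t * Fc t))%C l = 0%R); [|rewrite E; ring].
    set (m := Z.to_nat l).
    pose proof (Horth m (fun j => if Nat.eq_dec j m then 1%R else 0%R) ltac:(lia)) as H.
    change (cmean (fun t => polyC c n (eit t) * Cconj (polyC (fun j => if Nat.eq_dec j m then RtoC 1 else RtoC 0) m (eit t)) * RtoC (w t))%C = 0%R) in H.
    rewrite (cmean_ext _ (fun t => RtoC w0 * ((P t * (F t * Fc t)) * eit (- IZR l * t)))%C) in H.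
    - rewrite cmean_scal in H by (apply Ccont_mult_eit; auto using Ccont_mult).
      fold (coef (fun t => P t * (F t * Fc t))%C l) in H.
      apply (f_equal Cmod) in H. rewrite Cmod_mult, Cmod_R, Cmod_0, Rabs_pos_eq in H by lra.
      apply Cmod_eq_0. apply Rmult_integral in H. destruct H as [H|H]; [lra | auto].
    - intros t. rewrite !polyC_eit, Hw. fold (P t).
      rewrite (csum_single _ m (S m)); [| |lia].
      + destruct (Nat.eq_dec m m); [|congruence]. rewrite Cmult_1_l, eit_conj.
        unfold m. rewrite Z2Nat.id by lia. replace (- (IZR l * t)) with (- IZR l * t) by ring.
        unfold Fc. ring.
      + intros j Hj. destruct (Nat.eq_dec j m); [congruence | ring]. }
  (* [P conj F] stops at frequency [n], with coefficient [c_n conj f_0 = 1] there, and this cancels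
     [z^n conj G conj F = z^n]. *)
  assert (Hq : forall j : nat, coef (fun t => y t * Fc t)%C (zn + Z.of_nat j) = 0%R).
  { intros j.
    rewrite (coef_ext _ (fun t => P t * Fc t - eit (IZR zn * t))%C).
    2:{ intros t. unfold y. replace ((P t - Gc t * eit (IZR zn * t)) * Fc t)%C
          with (P t * Fc t - (Fc t * Gc t) * eit (IZR zn * t))%C by ring.
        rewrite HFGc. ring. }
    rewrite coef_minus, coef_eit by auto using Ccont_mult.
    rewrite (coef_mult_series_eq (-1) (fun i => Cconj (f i)) Fc P (zn + Z.of_nat j)
      (if Z.eq_dec (zn + Z.of_nat j) zn then 1%R else 0%R) 1%nat); auto; [ring|].
    intros N HN. unfold P. destruct (Z.eq_dec (zn + Z.of_nat j) zn).
    - rewrite (csum_single _ 0%nat); [| |lia].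
      + rewrite f0, Cconj_1, coef_poly.
        replace (zn + Z.of_nat j - -1 * Z.of_nat 0)%Z with zn by lia.
        destruct (Z_lt_dec zn 0); [lia|]. destruct (Z_lt_dec zn (Z.of_nat (S n))); [|lia].
        unfold zn. rewrite Nat2Z.id, Hcn. ring.
      + intros i Hi. rewrite coef_poly. destruct (Z_lt_dec _ 0); [lia|].
        destruct (Z_lt_dec _ _); [lia | ring].
    - rewrite (csum_ext _ (fun _ => RtoC 0)); [apply csum_zero|].
      intros i Hi. rewrite coef_poly. destruct (Z_lt_dec _ 0); [lia|].
      destruct (Z_lt_dec _ _); [lia | ring]. }
  (* [p] collects the nonnegative frequencies of [z^n conj G]. So [T] is minus the tail of that
     series, and [y - T = P - p] has degree below [n], both leading coefficients being 1. *)
  set (p := fun t => csum (fun j => Cconj (g (n - j)%nat) * eit (IZR (Z.of_nat j) * t))%C (S n)).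
  set (T := fun t => (p t - Gc t * eit (IZR zn * t))%C).
  assert (Cp : Ccont p) by apply (Ccont_eit_sum (fun j => Cconj (g (n - j)%nat)) Z.of_nat).
  assert (CT : Ccont T) by now apply Ccont_minus.
  assert (HTn : sqnorm T <= (2 * D + 2) / (INR n ^ k) ^ 2).
  (* The tail is a finite sum, of squared norm at most [D / n^(2k)], plus a remainder uniformly
     below [1 / n^k]; then [(a + b)^2 <= 2 a^2 + 2 b^2] explains [2 D + 2]. *)
  { destruct (UGc (/ INR n ^ k) ltac:(now apply Rinv_0_lt_compat)) as [N HN].
    set (M := N). specialize (HN (S n + M)%nat ltac:(unfold M; lia)).
    set (TM := fun t => csum (fun i => Cconj (g (S n + i)%nat) * eit (IZR (zn - Z.of_nat (S n + i)) * t))%C M).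
    assert (CTM : Ccont TM) by apply (Ccont_eit_sum (fun i => Cconj (g (S n + i)%nat)) (fun i => (zn - Z.of_nat (S n + i))%Z)).
    assert (HTM : forall t, Cmod (T t) <= Cmod (TM t) + / INR n ^ k).
    { intros t. specialize (HN t). rewrite csum_add in HN.
      assert (E : T t = (- TM t - (Gc t - (csum (fun j => Cconj (g j) * eit (IZR (-1 * Z.of_nat j) * t))%C (S n)
         + csum (fun i => Cconj (g (S n + i)%nat) * eit (IZR (-1 * Z.of_nat (S n + i)) * t))%C M)) * eit (IZR zn * t))%C).
      { unfold T, TM, p. rewrite <- csum_rev.
        assert (E1 : csum (fun i => Cconj (g (n - (S n - 1 - i))%nat) * eit (IZR (Z.of_nat (S n - 1 - i)) * t))%C (S n)
          = (csum (fun j => Cconj (g j) * eit (IZR (-1 * Z.of_nat j) * t))%C (S n) * eit (IZR zn * t))%C).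
        { rewrite <- csum_scal_r. apply csum_ext. intros j Hj.
          replace (n - (S n - 1 - j))%nat with j by lia. rewrite <- Cmult_assoc, <- eit_plus. do 2 f_equal.
          rewrite <- Rmult_plus_distr_r, <- plus_IZR. do 2 f_equal. lia. }
        assert (E2 : csum (fun i => Cconj (g (S n + i)%nat) * eit (IZR (zn - Z.of_nat (S n + i)) * t))%C M
          = (csum (fun i => Cconj (g (S n + i)%nat) * eit (IZR (-1 * Z.of_nat (S n + i)) * t))%C M * eit (IZR zn * t))%C).
        { rewrite <- csum_scal_r. apply csum_ext. intros j Hj.
          rewrite <- Cmult_assoc, <- eit_plus. do 2 f_equal.
          rewrite <- Rmult_plus_distr_r, <- plus_IZR. do 2 f_equal. lia. }
        rewrite E1, E2. ring. }
      rewrite E. eapply Rle_trans; [apply Cmod_sub_le|].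
      rewrite Cmod_opp, Cmod_mult, Cmod_eit, Rmult_1_r. lra. }
    assert (HsM : sqnorm TM <= D / (INR n ^ k) ^ 2).
    { unfold TM. rewrite (sqnorm_eit_sum (fun i => Cconj (g (S n + i)%nat)) (fun i => (zn - Z.of_nat (S n + i))%Z)) by (intros; lia).
      apply Rmult_le_reg_r with ((INR n ^ k) ^ 2); [now apply pow_lt|].
      unfold Rdiv. rewrite Rmult_assoc, Rinv_l, Rmult_1_r by (apply Rgt_not_eq; now apply pow_lt).
      rewrite <- rsum_scal_r.
      apply Rle_trans with (rsum (fun i => (INR (S n + i) ^ k * alpha (S n + i)%nat) ^ 2) M).
      - apply rsum_le. intros i _. rewrite Cmod_conj, <- Rpow_mult_distr. apply pow_incr. split.
        + apply Rmult_le_pos; [apply Cmod_ge_0 | lra].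
        + rewrite Rmult_comm. apply Rmult_le_compat; auto using Cmod_ge_0; [lra|].
          apply pow_incr. split; [lra|]. apply le_INR. lia.
      - eapply Rle_trans; [|apply (HD (S n + M)%nat)]. rewrite rsum_add.
        pose proof (rsum_nonneg (fun i => (INR i ^ k * alpha i) ^ 2) (S n) (fun _ _ => pow2_ge_0 _)). lra. }
    assert (H2 : sqnorm T <= mean (fun t => 2 * Cmod (TM t) ^ 2 + 2 * (/ INR n ^ k) ^ 2)).
    { apply mean_le.
      - now apply Ccont_sqr_Cmod.
      - apply Rcont_plus; [|apply Rcont_const]. apply Rcont_mult; [apply Rcont_const | now apply Ccont_sqr_Cmod].
      - intros t _. specialize (HTM t). pose proof (Cmod_ge_0 (T t)).
        apply Rle_trans with ((Cmod (TM t) + / INR n ^ k) ^ 2); [apply pow_incr; lra|].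
        pose proof (pow2_ge_0 (Cmod (TM t) - / INR n ^ k)). lra. }
    rewrite mean_plus, mean_scal, mean_const in H2.
    - fold (sqnorm TM) in H2. replace ((2 * D + 2) / (INR n ^ k) ^ 2)
        with (2 * (D / (INR n ^ k) ^ 2) + 2 * (/ INR n ^ k) ^ 2) by (field; lra). lra.
    - now apply Ccont_sqr_Cmod.
    - apply Rcont_mult; [apply Rcont_const | now apply Ccont_sqr_Cmod].
    - apply Rcont_const. }
  (* minimality of the norm of [y] among its translates by polynomials of degree < n *)
  assert (Hmin : sqnorm (fun t => y t * F t)%C <= sqnorm (fun t => T t * F t)%C).
  { assert (CyF : Ccont (fun t => y t * F t)%C) by now apply Ccont_mult.
    assert (CTF : Ccont (fun t => T t * F t)%C) by now apply Ccont_mult.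
    set (r := fun t => (P t - p t)%C).
    assert (E0 : cmean (fun t => u t * Cconj (r t))%C = 0%R).
    { assert (Er : forall t, r t = csum (fun j => (c j - Cconj (g (n - j)%nat)) * eit (IZR (Z.of_nat j) * t))%C n).
      { intros t. unfold r, P, p. rewrite <- csum_minus. cbn [csum].
        rewrite Nat.sub_diag, g0, Hcn, Cconj_1.
        rewrite (csum_ext _ (fun j => (c j - Cconj (g (n - j)%nat)) * eit (IZR (Z.of_nat j) * t))%C) by (intros; ring).
        ring. }
      rewrite (cmean_ext _ (fun t => csum (fun j => Cconj (c j - Cconj (g (n - j)%nat)) * (u t * eit (- IZR (Z.of_nat j) * t)))%C n)).
      - assert (Hs : forall m, (m <= n)%nat ->
          Ccont (fun t => csum (fun j => Cconj (c j - Cconj (g (n - j)%nat)) * (u t * eit (- IZR (Z.of_nat j) * t)))%C m) /\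
          cmean (fun t => csum (fun j => Cconj (c j - Cconj (g (n - j)%nat)) * (u t * eit (- IZR (Z.of_nat j) * t)))%C m) = 0%R).
        { induction m as [|m IH]; intros Hm; cbn [csum].
          - split; [apply Ccont_const|]. rewrite cmean_alt. simpl. now rewrite !mean_const.
          - destruct (IH ltac:(lia)) as [I1 I2].
            assert (Ct : Ccont (fun t => Cconj (c m - Cconj (g (n - m)%nat)) * (u t * eit (- IZR (Z.of_nat m) * t)))%C)
              by (apply Ccont_mult; [apply Ccont_const | now apply Ccont_mult_eit]).
            split; [now apply Ccont_plus|].
            rewrite cmean_plus, I2 by auto. rewrite cmean_scal by now apply Ccont_mult_eit.
            fold (coef u (Z.of_nat m)). rewrite Hu by (unfold zn; lia). ring. }
        apply Hs. auto.
      - intros t. rewrite Er, csum_conj, <- csum_scal. apply csum_ext. intros j _.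
        rewrite Cmult_conj, eit_conj. replace (- (IZR (Z.of_nat j) * t)) with (- IZR (Z.of_nat j) * t) by ring.
        ring. }
    assert (Eyr : forall t, y t = (T t + r t)%C) by (intros; unfold y, T, r; ring).
    (* Since [y F] is orthogonal to [r F], its inner product with itself equals the one with [T F],
       and AM-GM concludes. *)
    assert (E1 : sqnorm (fun t => y t * F t)%C = mean (fun t => Re ((y t * F t) * Cconj (T t * F t))%C)).
    { assert (Cur : Ccont (fun t => u t * Cconj (r t))%C).
      { apply Ccont_mult; auto. apply Ccont_conj. now apply Ccont_minus. }
      assert (CyT : Ccont (fun t => (y t * F t) * Cconj (T t * F t))%C).
      { apply Ccont_mult; auto. now apply Ccont_conj. }
      transitivity (mean (fun t => Re ((y t * F t) * Cconj (T t * F t))%C + Re (u t * Cconj (r t))%C)).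
      - apply mean_ext. intros t. rewrite <- re_plus.
        replace ((y t * F t) * Cconj (T t * F t) + u t * Cconj (r t))%C with (Cconj (y t * F t) * (y t * F t))%C.
        + now rewrite Re_conj_mult.
        + unfold u, Fc. rewrite !Cmult_conj, (Eyr t) at 1. rewrite (Cplus_conj (T t)). ring.
      - rewrite mean_plus by (apply CyT || apply Cur).
        rewrite <- (Re_cmean (fun t => u t * Cconj (r t))%C), E0. simpl Re. ring. }
    assert (E2 : sqnorm (fun t => y t * F t)%C
      <= mean (fun t => / 2 * Cmod (y t * F t) ^ 2 + / 2 * Cmod (T t * F t) ^ 2)).
    { rewrite E1. apply mean_le.
      - apply (Ccont_mult (fun t => y t * F t)%C (fun t => Cconj (T t * F t))); auto. now apply Ccont_conj.
      - apply Rcont_plus; apply Rcont_mult; auto using Rcont_const, Ccont_sqr_Cmod.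
      - intros t _. pose proof (Cmod_sqr_minus (y t * F t) (T t * F t)) as H.
        pose proof (pow2_ge_0 (Cmod (y t * F t - T t * F t))). lra. }
    rewrite mean_plus, !mean_scal in E2; auto using Rcont_mult, Rcont_const, Ccont_sqr_Cmod.
    fold (sqnorm (fun t => y t * F t)%C) (sqnorm (fun t => T t * F t)%C) in E2. lra. }
  set (S2 := (2 * D + 2) / (INR n ^ k) ^ 2) in *.
  assert (HS2 : 0 <= S2) by (apply Rdiv_le_0_compat; [lra | now apply pow_lt]).
  assert (HyF : sqnorm (fun t => y t * F t)%C <= A ^ 2 * S2).
  { eapply Rle_trans; [apply Hmin|]. apply Rle_trans with (A ^ 2 * sqnorm T).
    - apply sqnorm_le; auto using Ccont_mult. intros t _. rewrite Cmod_mult, Rmult_comm.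
      apply Rmult_le_compat_r; auto using Cmod_ge_0.
    - apply Rmult_le_compat_l; auto. apply pow2_ge_0. }
  assert (HA1 : 1 <= A).
  { eapply Rle_trans; [|apply (HA 1%nat)]. simpl. rewrite Rplus_0_l.
    eapply Rle_trans; [|apply Hf]. rewrite f0, Cmod_1. lra. }
  assert (HyFc : sqnorm (fun t => y t * Fc t)%C <= A ^ 2 * S2).
  { eapply Rle_trans; [|apply HyF]. right. unfold sqnorm. apply mean_ext. intros t.
    unfold Fc. now rewrite !Cmod_mult, Cmod_conj. }
  set (X := A ^ 3 * sqrt (2 * D + 2) / INR n ^ k).
  assert (HX0 : 0 <= X).
  { apply Rdiv_le_0_compat; auto. apply Rmult_le_pos; [now apply pow_le | apply sqrt_pos]. }
  assert (HX : A ^ 2 * S2 <= X ^ 2).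
  { unfold X. replace ((A ^ 3 * sqrt (2 * D + 2) / INR n ^ k) ^ 2)
      with (A ^ 4 * (A ^ 2 * (sqrt (2 * D + 2) ^ 2 / (INR n ^ k) ^ 2))) by (field; lra).
    rewrite <- (Rsqr_pow2 (sqrt _)), Rsqr_sqrt by lra. fold S2.
    assert (1 <= A ^ 4) by (rewrite <- (pow1 4); apply pow_incr; lra).
    assert (0 <= A ^ 2 * S2) by (apply Rmult_le_pos; [apply pow2_ge_0 | auto]). nra. }
  assert (I1 : forall L, rsum (fun l => Cmod (coef u (zn + Z.of_nat l))) L <= tau * X).
  { intros L. replace (tau * X) with (A * 0 + tau * X) by ring.
    apply (coef_mult_series_sum alpha tau A f F (fun t => y t * Fc t)%C zn L 0 X); auto.
    - rewrite (rsum_ext _ (fun _ => 0)); [rewrite rsum_zero; lra|].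
      intros j _. rewrite Hq. apply Cmod_0.
    - intros M. eapply Rle_trans; [|apply HX]. eapply Rle_trans; [|apply HyFc].
      apply (bessel (fun m => (zn - 1 - Z.of_nat m)%Z)); auto. intros; lia. }
  (* The gap of [u] on [[0, n)] moves the threshold from [n] down to 0 at no cost. *)
  assert (I1' : forall L, rsum (fun l => Cmod (coef u (Z.of_nat l))) L <= tau * X).
  { intros L. apply Rle_trans with (rsum (fun l => Cmod (coef u (Z.of_nat l))) (n + L)).
    - apply rsum_mono; [intros; apply Cmod_ge_0 | lia].
    - rewrite rsum_add, (rsum_ext _ (fun _ => 0)).
      + rewrite rsum_zero, Rplus_0_l. eapply Rle_trans; [|apply (I1 L)]. right. apply rsum_ext.
        intros l _. now rewrite Nat2Z.inj_add.
      + intros l Hl. rewrite Hu by (unfold zn; lia). apply Cmod_0. }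
  assert (I2 : forall L, rsum (fun j => Cmod (coef (fun t => y t * F t)%C (Z.of_nat j))) L <= A * (tau * X)).
  { intros L. rewrite (rsum_ext _ (fun j => Cmod (coef (fun t => u t * Gc t)%C (Z.of_nat j)))).
    - apply (coef_mult_coseries_sum alpha A (fun i => Cconj (g i)) Gc u); auto.
      intros i. rewrite Cmod_conj. auto.
    - intros j _. f_equal. apply coef_ext. intros t. unfold u.
      replace (y t * Fc t * F t * Gc t)%C with (y t * F t * (Fc t * Gc t))%C by ring.
      rewrite HFGc. ring. }
  (* Multiplying by [G] restores [y]. The nonnegative frequencies of [y F] cost a factor [A], and
     its negative ones leak by [tau X]: together [(A * A + 1) * tau * X]. *)
  assert (I3 : rsum (fun l => Cmod (coef (fun t => (y t * F t) * G t)%C (0 + Z.of_nat l))) n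
               <= A * (A * (tau * X)) + tau * X).
  { apply (coef_mult_series_sum alpha tau A g G (fun t => y t * F t)%C 0%Z n (A * (tau * X)) X); auto.
    intros M. eapply Rle_trans; [|apply HX]. eapply Rle_trans; [|apply HyF].
    apply (bessel (fun m => (0 - 1 - Z.of_nat m)%Z)); auto. intros; lia. }
  rewrite (rsum_ext _ (fun l => Cmod (coef (fun t => (y t * F t) * G t)%C (0 + Z.of_nat l)))).
  - eapply Rle_trans; [apply I3|]. right. unfold X. field. lra.
  - intros j Hj. f_equal. rewrite Z.add_0_l.
    rewrite (coef_ext _ y).
    2:{ intros t. replace (y t * F t * G t)%C with (y t * (F t * G t))%C by ring. rewrite HFG. ring. }
    unfold y. rewrite coef_minus, coef_mult_eit by auto.
    unfold P. rewrite coef_poly. destruct (Z_lt_dec _ 0); [lia|]. destruct (Z_lt_dec _ _); [|lia].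
    rewrite Nat2Z.id. f_equal. f_equal. unfold Gc. rewrite coef_conj by auto.
    replace (- (Z.of_nat j - zn))%Z with (Z.of_nat (n - j)) by (unfold zn; lia).
    now rewrite (coef_series_nonneg g G).
Qed.

(** * Fourier coefficients along a tower of derivatives *)

Lemma bddLip_Rcont f : bddLip f -> Rcont f.
Proof. intros [B [_ H]]. now apply Rcont_Lipschitz with B. Qed.

Lemma fourier_tower m f : tower m f -> (forall p, (p <= m)%nat -> periodic2pi (f p)) ->
  (forall p, (p <= m)%nat -> Rcont (f p)) ->
  forall p l, (p <= m)%nat -> fourier (f p) l = ((Ci * RtoC (IZR l)) ^ p * fourier (f 0%nat) l)%C.
Proof.
  intros Ht Hp Hc. induction p as [|p IH]; intros l Hpm.
  - simpl. ring.
  - rewrite (fourier_derive (f p) (f (S p))).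
    + rewrite IH by lia. rewrite Cpow_S. ring.
    + intros x. apply Ht. lia.
    + apply Hc. lia.
    + apply Hp. lia.
Qed.

Lemma fourier_opp f l : Rcont f -> fourier f (- l) = Cconj (fourier f l).
Proof.
  intros Hf. rewrite !fourier_coef.
  rewrite <- (Z.opp_involutive l) at 2.
  rewrite <- (coef_conj (fun t => RtoC (f t))) by now apply Ccont_RtoC.
  apply coef_ext. intros t. unfold Cconj, RtoC; simpl; f_equal; ring.
Qed.

Lemma fourier_0_real f : Rcont f -> fourier f 0 = RtoC (Re (fourier f 0)).
Proof.
  intros Hf. pose proof (fourier_opp f 0 Hf) as E. simpl Z.opp in E.
  apply C_eq; [reflexivity|]. apply (f_equal Im) in E. rewrite im_conj in E. simpl in *. lra.
Qed.

Lemma Cmod_tower_factor p (j : nat) : Cmod ((Ci * RtoC (IZR (Z.of_nat j))) ^ p)%C = INR j ^ p.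
Proof.
  rewrite Cmod_pow, Cmod_mult, Cmod_Ci, Cmod_R, <- INR_IZR_INZ, Rabs_pos_eq by apply pos_INR.
  f_equal. ring.
Qed.

(** Differentiation accounts for [m] powers of the frequency, and the Lipschitz bound on the top
    derivative for the last one. *)
Lemma fourier_sobolev m f L n : tower m f -> (forall p, (p <= m)%nat -> periodic2pi (f p)) ->
  (forall p, (p <= m)%nat -> Rcont (f p)) -> Lipschitz L (f m) ->
  rsum (fun i => (INR (S i) ^ S m * Cmod (fourier (f 0%nat) (Z.of_nat (S i)))) ^ 2) n <= L ^ 2.
Proof.
  intros Ht Hp Hc HL.
  eapply Rle_trans;
    [|apply (fourier_lipschitz_sqr_sum (f m) L (fun i => Z.of_nat (S i)) n HL); [auto | intros; lia]].
  right. apply rsum_ext. intros i _. rewrite (fourier_tower m f Ht Hp Hc m) by auto.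
  rewrite Cmod_mult, Cmod_tower_factor, <- INR_IZR_INZ, Rabs_pos_eq by apply pos_INR.
  rewrite <- (tech_pow_Rmult (INR (S i)) m). f_equal. ring.
Qed.

Lemma fourier_tower_log_sum m f L theta n : tower m f -> (forall p, (p <= m)%nat -> periodic2pi (f p)) ->
  (forall p, (p <= m)%nat -> Rcont (f p)) -> Lipschitz L (f m) ->
  Cmod (csum (fun j => RtoC (INR (S j) ^ S m) * (fourier (f 0%nat) (Z.of_nat (S j)) * eit (INR (S j) * theta)))%C n)
  <= 14 * L * ln (INR n + 1).
Proof.
  intros Ht Hp Hc HL. destruct n as [|n].
  { simpl csum. rewrite Cmod_0. simpl INR. rewrite Rplus_0_l, ln_1. lra. }
  pose proof (fourier_lipschitz_log_sum (f m) L theta (S n) HL ltac:(auto) ltac:(lia)) as H.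
  rewrite (csum_ext _ (fun j => Ci ^ S m * (RtoC (INR (S j) ^ S m)
     * (fourier (f 0%nat) (Z.of_nat (S j)) * eit (INR (S j) * theta))))%C) in H.
  - rewrite csum_scal, Cmod_mult, Cmod_pow, Cmod_Ci, pow1, Rmult_1_l in H. auto.
  - intros j _. rewrite (fourier_tower m f Ht Hp Hc m), <- INR_IZR_INZ, Cpow_mult_l, RtoC_pow by auto.
    rewrite !Cpow_S. ring.
Qed.

(** * Limits of complex sequences *)

Definition Ccv (x : nat -> C) (l : C) : Prop :=
  forall d, 0 < d -> exists N, forall n, (N <= n)%nat -> Cmod (x n - l) <= d.

Lemma Ccv_const c : Ccv (fun _ => c) c.
Proof.
  intros d Hd. exists 0%nat. intros n _. replace (c - c)%C with (RtoC 0) by ring. rewrite Cmod_0. lra.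
Qed.

Lemma Ccv_plus x y l m : Ccv x l -> Ccv y m -> Ccv (fun n => x n + y n)%C (l + m)%C.
Proof.
  intros Hx Hy d Hd. destruct (Hx (d / 2) ltac:(lra)) as [N1 H1], (Hy (d / 2) ltac:(lra)) as [N2 H2].
  exists (N1 + N2)%nat. intros n Hn. specialize (H1 n ltac:(lia)). specialize (H2 n ltac:(lia)).
  replace (x n + y n - (l + m))%C with ((x n - l) + (y n - m))%C by ring.
  eapply Rle_trans; [apply Cmod_triangle|]. lra.
Qed.

Lemma Ccv_scal c x l : Ccv x l -> Ccv (fun n => c * x n)%C (c * l)%C.
Proof.
  intros Hx d Hd. assert (Hc : 0 < Cmod c + 1) by (pose proof (Cmod_ge_0 c); lra).
  destruct (Hx (d / (Cmod c + 1)) ltac:(now apply Rdiv_lt_0_compat)) as [N H].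
  exists N. intros n Hn. specialize (H n Hn).
  replace (c * x n - c * l)%C with (c * (x n - l))%C by ring. rewrite Cmod_mult.
  apply Rle_trans with ((Cmod c + 1) * (d / (Cmod c + 1))).
  - apply Rmult_le_compat; try apply Cmod_ge_0; lra.
  - right. field. lra.
Qed.

Lemma Ccv_csum (x : nat -> nat -> C) l K : (forall p, (p < K)%nat -> Ccv (x p) (l p)) ->
  Ccv (fun n => csum (fun p => x p n) K) (csum l K).
Proof.
  induction K as [|K IH]; intros H; cbn [csum].
  - apply Ccv_const.
  - apply Ccv_plus; [apply IH; intros; apply H; lia | apply H; lia].
Qed.

Lemma Cmod_CSeries_le alpha A a : (forall i, Cmod (a i) <= alpha i) -> (forall n, rsum alpha n <= A) ->
  Cmod (CSeries a) <= A.
Proof.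
  intros Ha HA. assert (H0 : forall i, 0 <= alpha i) by (intros i; eapply Rle_trans; [apply Cmod_ge_0 | apply Ha]).
  apply Rle_eps_plus with 1; [lra|]. intros d Hd.
  destruct (CSeries_uniform alpha A H0 HA d Hd) as [N HN]. specialize (HN N (Nat.le_refl N) a Ha).
  rewrite Cmod_minus_sym in HN.
  replace (CSeries a) with ((CSeries a - csum a N) + csum a N)%C by ring.
  eapply Rle_trans; [apply Cmod_triangle|].
  assert (Cmod (csum a N) <= A) by (eapply Rle_trans; [apply Cmod_csum_le; intros; apply Ha | apply HA]). lra.
Qed.

Lemma CSeries_opp a : CSeries (fun i => - a i)%C = (- CSeries a)%C.
Proof.
  unfold CSeries, Copp; simpl. f_equal.
  - rewrite <- Series_opp. apply Series_ext. intros; reflexivity.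
  - rewrite <- Series_opp. apply Series_ext. intros; reflexivity.
Qed.

Lemma CSeries_conj a : CSeries (fun i => Cconj (a i)) = Cconj (CSeries a).
Proof.
  unfold CSeries, Cconj; simpl. f_equal. rewrite <- Series_opp. apply Series_ext. intros; reflexivity.
Qed.

Lemma CSeries_ext a b : (forall i, a i = b i) -> CSeries a = CSeries b.
Proof. intros H. unfold CSeries. f_equal; apply Series_ext; intros; now rewrite H. Qed.

Lemma pser_opp b z : pser (fun i => - b i)%C z = (- pser b z)%C.
Proof. unfold pser. rewrite <- CSeries_opp. apply CSeries_ext. intros; ring. Qed.

(** As [V] is real, conjugation turns [V_(-j)] into [V_j], and [z -> 1 / conj z] turns negative
    powers into positive ones: [conj N (1 / conj z)] is a power series in [z]. *)
Lemma Nfun_pser V (z : C) : Rcont V -> z <> 0%R ->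
  Cconj (Nfun V (/ Cconj z)) = pser (fun j => fourier V (Z.of_nat (S j))) z.
Proof.
  intros HV Hz. unfold Nfun, pser. rewrite <- CSeries_conj. apply CSeries_ext. intros j.
  assert (Hcz : Cconj z <> 0%R).
  { intros E. apply Hz. rewrite <- (Cconj_conj z), E. unfold Cconj, RtoC; simpl; f_equal; ring. }
  assert (Ei : (/ / Cconj z)%C = Cconj z).
  { assert (Hi : (/ Cconj z)%C <> 0%R).
    { intros E. apply C1_nz. rewrite <- (Cinv_r (Cconj z)), E by auto. ring. }
    rewrite <- (Cmult_1_l (/ / Cconj z)), <- (Cinv_r (Cconj z)), <- Cmult_assoc, Cinv_r by auto. ring. }
  rewrite Ei, fourier_opp, Cmult_conj, Cpow_conj, !Cconj_conj by auto. reflexivity.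
Qed.

(** * The partial Fourier sums of exp V off the circle *)

(* [jet m u t s] with every derivative [u p t] replaced by its Fourier partial sum. *)
Definition jet_partial (m : nat) (u : nat -> R -> R) (t s : R) (M : nat) : C :=
  csum (fun p => RtoC (/ INR (fact p)) * (Ci * RtoC s) ^ p *
    (fourier (u p) 0 + csum (fun j => fourier (u p) (Z.of_nat (S j)) * eit (INR (S j) * t)
                              + Cconj (fourier (u p) (Z.of_nat (S j)) * eit (INR (S j) * t))) M))%C (S m).

Lemma jet_partial_cv m u t s : (forall p, (p <= m)%nat -> periodic2pi (u p)) ->
  (forall p, (p <= m)%nat -> bddLip (u p)) -> Ccv (jet_partial m u t s) (jet m u t s).
Proof.
  intros Hp Hb. unfold jet_partial, jet.
  apply (Ccv_csum (fun p M => RtoC (/ INR (fact p)) * (Ci * RtoC s) ^ p *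
    (fourier (u p) 0 + csum (fun j => fourier (u p) (Z.of_nat (S j)) * eit (INR (S j) * t)
         + Cconj (fourier (u p) (Z.of_nat (S j)) * eit (INR (S j) * t))) M))%C).
  intros p Hpm.
  replace (RtoC (u p t / INR (fact p)) * (Ci * RtoC s) ^ p)%C
    with (RtoC (/ INR (fact p)) * (Ci * RtoC s) ^ p * RtoC (u p t))%C
    by (unfold Rdiv; rewrite RtoC_mult; ring).
  apply Ccv_scal. destruct (Hb p ltac:(lia)) as [B [HB HL]].
  assert (Hper : periodic2pi (u p)) by (apply Hp; lia).
  rewrite (fourier_inversion (u p) B t HL Hper), RtoC_plus.
  rewrite <- fourier_0_real by now apply Rcont_Lipschitz with B.
  apply Ccv_plus; [apply Ccv_const|].
  intros d Hd.
  destruct (CSeries_uniform (fun j => Cmod (fourier (u p) (Z.of_nat (S j)))) (B ^ 2 / 2 + 1)) with (d := d / 2) as [N HN].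
  - intros; apply Cmod_ge_0.
  - intros n. exact (fourier_abs_sum (u p) B n HL Hper).
  - lra.
  - exists N. intros n Hn.
    specialize (HN n Hn (fun j => fourier (u p) (Z.of_nat (S j)) * eit t ^ S j)%C).
    assert (HC := HN (fun j => Cmod_mult_pow_le _ _ _ _ ltac:(rewrite Cmod_eit; lra) (Rle_refl _))).
    clear HN. fold (pser (fun j => fourier (u p) (Z.of_nat (S j))) (eit t)) in HC.
    set (S0 := csum (fun j => fourier (u p) (Z.of_nat (S j)) * eit t ^ S j)%C n) in HC.
    replace (csum _ n) with (S0 + Cconj S0)%C.
    + set (q := pser _ (eit t)) in *.
      replace (RtoC (2 * Re q)) with (q + Cconj q)%C
        by (destruct q; unfold Cconj, Cplus, RtoC; simpl; f_equal; ring).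
      replace (S0 + Cconj S0 - (q + Cconj q))%C with ((S0 - q) + Cconj (S0 - q))%C
        by (rewrite Cminus_conj; ring).
      eapply Rle_trans; [apply Cmod_triangle|]. rewrite Cmod_conj. lra.
    + rewrite csum_plus, <- csum_conj.
      replace S0 with (csum (fun j => fourier (u p) (Z.of_nat (S j)) * eit (INR (S j) * t))%C n); auto.
      apply csum_ext. intros j _. now rewrite eit_pow.
Qed.

(** The derivative multiplier [(i j)^p] meets the jet variable [(i s)^p]: on [e^(ijt)] the jet acts
    as the Taylor polynomial of [e^(-sj)], which is [|z|^j]. *)
Lemma Ci_mult_pow (a b : R) p : ((Ci * RtoC a) ^ p * (Ci * RtoC b) ^ p)%C = RtoC ((- (a * b)) ^ p).
Proof.
  rewrite <- Cpow_mult_l, RtoC_pow. f_equal.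
  unfold Ci, Cmult, RtoC; simpl. f_equal; ring.
Qed.

(** The sum is [z^n] times a Laurent sum over the frequencies from [-n] to [M]. Its negative half is
    the conjugate of a sum over positive frequencies, so [extension_estimate] handles both halves,
    and its factor [e^(ns)] is cancelled by [|z^n|]. *)
Lemma fourier_partial_sum_extension m u L t s n M : tower m u ->
  (forall p, (p <= m)%nat -> periodic2pi (u p)) -> (forall p, (p <= m)%nat -> Rcont (u p)) ->
  Lipschitz L (u m) -> (2 <= n)%nat -> (n <= M)%nat -> 0 <= s ->
  let z := (RtoC (exp (- s)) * eit t)%C in
  Cmod (csum (fun l => fourier (u 0%nat) (Z.of_nat l - Z.of_nat n) * z ^ l)%C (n + (1 + M))
        - z ^ n * jet_partial m u t s M)
  <= 2 * (4 + 12 * (INR (S m) + 1)) * (14 * L) * (ln (INR n) / INR n ^ S m).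
Proof.
  intros Ht Hp Hc HL Hn HM Hs z.
  assert (HL0 : 0 <= L) by now apply (Lipschitz_const_nonneg L (u m)).
  set (U := fun l => fourier (u 0%nat) l).
  set (w := fun j => (U (Z.of_nat (S j)) * eit (INR (S j) * t))%C).
  destruct (extension_estimate w (14 * L) (S m) s n M) as [E1 E2]; auto; try lia; [lra| |].
  { intros q. exact (fourier_tower_log_sum m u L t q Ht Hp Hc HL). }
  set (K := (4 + 12 * (INR (S m) + 1)) * (14 * L) * exp (INR n * s) * ln (INR n) / INR n ^ S m) in *.
  set (Xp := csum (fun j => RtoC (exp (- s * INR (S j)) - taylor_exp (S m) (- s * INR (S j))) * w j)%C M) in *.
  set (Xm := (csum (fun j => RtoC (exp (s * INR (S j))) * w j)%C n
        - csum (fun j => RtoC (taylor_exp (S m) (s * INR (S j))) * w j)%C M)%C) in *.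
  assert (Hzp : forall j, (z ^ j)%C = (RtoC (exp (- s * INR j)) * eit (INR j * t))%C).
  { intros j. unfold z. rewrite Cpow_mult_l, <- RtoC_pow, eit_pow. do 2 f_equal.
    induction j as [|j IH]; [simpl; now rewrite Rmult_0_r, exp_0|].
    rewrite S_INR, Rmult_plus_distr_l, exp_plus, <- IH, Rmult_1_r. simpl. ring. }
  assert (HJ : jet_partial m u t s M = (U 0%Z + csum (fun j => RtoC (taylor_exp (S m) (- s * INR (S j))) * w j) M
      + Cconj (csum (fun j => RtoC (taylor_exp (S m) (s * INR (S j))) * w j) M))%C).
  { unfold jet_partial.
    rewrite (csum_ext _ (fun p => (RtoC (/ INR (fact p)) * (Ci * RtoC s) ^ p * fourier (u p) 0)
      + csum (fun j => RtoC ((- s * INR (S j)) ^ p / INR (fact p)) * w j) M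
      + csum (fun j => RtoC ((s * INR (S j)) ^ p / INR (fact p)) * Cconj (w j)) M)%C).
    - rewrite !csum_plus, csum_conj. f_equal; [f_equal|].
      (* Only [p = 0] contributes at frequency 0, since a derivative of a periodic function has mean
         zero. *)
      + rewrite csum_S_l, (csum_ext _ (fun _ => RtoC 0)).
        * rewrite csum_zero. simpl. rewrite Rinv_1. unfold U. ring.
        * intros p Hpm. rewrite (fourier_tower m u Ht Hp Hc (S p)) by lia. rewrite !Cpow_S. ring.
      + rewrite csum_swap. apply csum_ext. intros j _. rewrite csum_scal_r, csum_RtoC. reflexivity.
      + rewrite csum_swap. apply csum_ext. intros j _. rewrite csum_scal_r, csum_RtoC, Cmult_conj.
        f_equal. unfold Cconj, RtoC; simpl; f_equal; ring.
    - intros p Hpm. rewrite Cmult_plus_distr_l, csum_plus, Cmult_plus_distr_l, Cplus_assoc.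
      f_equal; [f_equal|].
      + rewrite <- csum_scal. apply csum_ext. intros j _.
        rewrite (fourier_tower m u Ht Hp Hc p), <- INR_IZR_INZ by lia. fold (U (Z.of_nat (S j))).
        replace (- s * INR (S j)) with (- (s * INR (S j))) by ring.
        unfold Rdiv. rewrite RtoC_mult, <- Ci_mult_pow. unfold w. ring.
      + rewrite <- csum_scal. apply csum_ext. intros j _.
        rewrite (fourier_tower m u Ht Hp Hc p), <- INR_IZR_INZ by lia. fold (U (Z.of_nat (S j))).
        replace (Cconj ((Ci * RtoC (INR (S j))) ^ p * U (Z.of_nat (S j)) * eit (INR (S j) * t)))%C
          with ((Ci * RtoC (- INR (S j))) ^ p * Cconj (w j))%C.
        * replace (s * INR (S j)) with (- (s * - INR (S j))) by ring.
          unfold Rdiv. rewrite RtoC_mult, <- Ci_mult_pow. ring.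
        * unfold w. rewrite <- Cmult_assoc, (Cmult_conj (_ ^ p)), Cpow_conj. f_equal. f_equal.
          unfold Ci, Cconj, Cmult, RtoC; simpl; f_equal; ring. }
  assert (HP : csum (fun l => fourier (u 0%nat) (Z.of_nat l - Z.of_nat n) * z ^ l)%C (n + (1 + M))
    = (z ^ n * (U 0%Z + csum (fun j => RtoC (exp (- s * INR (S j))) * w j) M
        + Cconj (csum (fun j => RtoC (exp (s * INR (S j))) * w j) n)))%C).
  { rewrite !csum_add. rewrite !Cmult_plus_distr_l, csum_conj.
    rewrite <- (csum_rev (fun l => fourier (u 0%nat) (Z.of_nat l - Z.of_nat n) * z ^ l)%C n).
    rewrite (csum_ext (fun i => fourier (u 0%nat) (Z.of_nat (n - 1 - i) - Z.of_nat n) * z ^ (n - 1 - i))%C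
      (fun j => z ^ n * Cconj (RtoC (exp (s * INR (S j))) * w j))%C).
    - rewrite csum_scal.
      rewrite (csum_ext (fun i => fourier (u 0%nat) (Z.of_nat (n + (1 + i)) - Z.of_nat n) * z ^ (n + (1 + i)))%C
        (fun j => z ^ n * (RtoC (exp (- s * INR (S j))) * w j))%C).
      + rewrite csum_scal. cbn [csum]. rewrite Nat.add_0_r, Z.sub_diag. unfold U. ring.
      + intros j _. rewrite Cpow_add_r. replace (Z.of_nat (n + (1 + j)) - Z.of_nat n)%Z with (Z.of_nat (S j)) by lia.
        rewrite (Hzp (1 + j)%nat). unfold w, U. change (1 + j)%nat with (S j). ring.
    - intros j Hj.
      replace (Z.of_nat (n - 1 - j) - Z.of_nat n)%Z with (- Z.of_nat (S j))%Z by lia.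
      rewrite fourier_opp by (apply Hc; lia).
      assert (EI : INR (n - 1 - j) = INR n - INR (S j)).
      { rewrite <- minus_INR by lia. f_equal. lia. }
      unfold w. rewrite !Cmult_conj, eit_conj, !Hzp, EI.
      replace (Cconj (RtoC (exp (s * INR (S j))))) with (RtoC (exp (s * INR (S j))))
        by (unfold Cconj, RtoC; simpl; f_equal; ring).
      replace ((INR n - INR (S j)) * t) with (INR n * t + - (INR (S j) * t)) by ring.
      replace (- s * (INR n - INR (S j))) with (- s * INR n + s * INR (S j)) by ring.
      rewrite eit_plus, exp_plus, RtoC_mult. unfold U. ring. }
  assert (ED : (csum (fun l => fourier (u 0%nat) (Z.of_nat l - Z.of_nat n) * z ^ l)%C (n + (1 + M))
        - z ^ n * jet_partial m u t s M)%C = (z ^ n * (Xp + Cconj Xm))%C).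
  { rewrite HP, HJ. unfold Xp, Xm. rewrite Cminus_conj.
    rewrite (csum_ext (fun j => RtoC (exp (- s * INR (S j)) - taylor_exp (S m) (- s * INR (S j))) * w j)%C
      (fun j => RtoC (exp (- s * INR (S j))) * w j - RtoC (taylor_exp (S m) (- s * INR (S j))) * w j)%C).
    - rewrite csum_minus. ring.
    - intros j _. rewrite RtoC_minus. ring. }
  unfold U at 1. rewrite ED, Cmod_mult, Hzp, Cmod_mult, Cmod_eit, Cmod_R, Rmult_1_r.
  rewrite Rabs_pos_eq by (left; apply exp_pos).
  apply Rle_trans with (exp (- s * INR n) * (2 * K)).
  - apply Rmult_le_compat_l; [left; apply exp_pos|].
    eapply Rle_trans; [apply Cmod_triangle|]. rewrite Cmod_conj. lra.
  - unfold K. assert (EE : exp (- s * INR n) * exp (INR n * s) = 1).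
    { rewrite <- exp_plus, <- exp_0. f_equal. ring. }
    right. unfold Rdiv.
    replace (exp (- s * INR n) * (2 * ((4 + 12 * (INR (S m) + 1)) * (14 * L) * exp (INR n * s) * ln (INR n) * / INR n ^ S m)))
      with ((exp (- s * INR n) * exp (INR n * s)) * (2 * ((4 + 12 * (INR (S m) + 1)) * (14 * L) * ln (INR n) * / INR n ^ S m))) by ring.
    rewrite EE. ring.
Qed.

(** The coefficients of [z^n U F] are [W conj g_(n-l)]. As [F] only raises frequencies, cutting
    [z^n U] to [[0, N)] affects the coefficients [l < N] of the product only through the frequencies
    of [U] below [-n], whose leak is a Hankel operator. *)
Lemma coef_quotient_truncation alpha tau A f g F G U W n N X :
  (forall i, Cmod (f i) <= alpha i) -> (forall n, rsum alpha n <= A) -> 0 <= tau ->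
  (forall N, 4 * rsum (fun i => (INR i * alpha i) ^ 2) N <= tau ^ 2) ->
  unif_series 1 f F -> unif_series 1 g G -> Rcont U ->
  (forall t, (RtoC (U t) * F t)%C = (RtoC W * Cconj (G t))%C) -> 0 <= X ->
  (forall M, rsum (fun m => Cmod (fourier U (Z.of_nat (S (n + m)))) ^ 2) M <= X ^ 2) ->
  rsum (fun l => Cmod (csum (fun i => f i * fourier U (Z.of_nat (l - i) - Z.of_nat n))%C (S l)
     - RtoC W * (if Nat.leb l n then Cconj (g (n - l)%nat) else 0%R))) N <= tau * X.
Proof.
  intros Hf HA Htau HT UF UG HU HUF HX HXs.
  pose proof (unif_series_Ccont _ _ _ UF) as CF. pose proof (unif_series_Ccont _ _ _ UG) as CG.
  set (zn := Z.of_nat n). set (a := fun l : nat => fourier U (Z.of_nat l - zn)).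
  assert (CU : Ccont (fun t => RtoC (U t))) by now apply Ccont_RtoC.
  set (Ut := fun t => (RtoC (U t) * eit (IZR zn * t))%C).
  assert (CUt : Ccont Ut) by now apply Ccont_mult_eit.
  set (P := fun t => csum (fun l => a l * eit (IZR (Z.of_nat l) * t))%C N).
  assert (CP : Ccont P) by apply (Ccont_eit_sum a Z.of_nat).
  set (q := fun t => (Ut t - P t)%C). assert (Cq : Ccont q) by now apply Ccont_minus.
  assert (EU : forall l, coef Ut l = fourier U (l - zn)) by (intros l; apply coef_mult_eit).
  replace (tau * X) with (A * 0 + tau * X) by ring.
  eapply Rle_trans; [|apply (coef_mult_series_sum alpha tau A f F q 0%Z N 0 X); auto].
  - right. apply rsum_ext. intros l Hl. rewrite Z.add_0_l.
    rewrite (coef_ext (fun t => q t * F t)%C (fun t => Ut t * F t - P t * F t)%C) by (intros; unfold q; ring).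
    rewrite coef_minus by now apply Ccont_mult.
    rewrite (coef_mult_series_eq 1 f F P (Z.of_nat l)
      (csum (fun i => f i * a (l - i)%nat)%C (S l)) (S l)); auto.
    + rewrite (coef_ext _ (fun t => RtoC W * (Cconj (G t) * eit (IZR zn * t)))%C).
      2:{ intros t. unfold Ut.
          replace (RtoC (U t) * eit (IZR zn * t) * F t)%C with ((RtoC (U t) * F t) * eit (IZR zn * t))%C by ring.
          rewrite HUF. ring. }
      rewrite coef_scal by now apply Ccont_mult_eit, Ccont_conj.
      rewrite (coef_mult_eit (fun t => Cconj (G t))), coef_conj by auto.
      rewrite Cmod_minus_sym. do 3 f_equal. destruct (Nat.leb_spec l n).
      * replace (- (Z.of_nat l - zn))%Z with (Z.of_nat (n - l)) by (unfold zn; lia).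
        now rewrite (coef_series_nonneg g G).
      * rewrite (coef_series_neg g G) by (auto; unfold zn; lia).
        unfold Cconj, RtoC; simpl; f_equal; ring.
    + intros n' Hn'. replace n' with (S l + (n' - S l))%nat by lia. rewrite csum_add.
      rewrite (csum_ext (fun i => f (S l + i)%nat * coef P (Z.of_nat l - 1 * Z.of_nat (S l + i)))%C (fun _ => RtoC 0)).
      * rewrite csum_zero, Cplus_0_r. apply csum_ext. intros i Hi. unfold P. rewrite coef_poly.
        destruct (Z_lt_dec _ 0); [lia|]. destruct (Z_lt_dec _ _); [|lia]. do 2 f_equal. lia.
      * intros i _. unfold P. rewrite coef_poly. destruct (Z_lt_dec _ 0); [ring | lia].
  - rewrite (rsum_ext _ (fun _ => 0)); [rewrite rsum_zero; lra|].
    intros j Hj. rewrite Z.add_0_l. unfold q. rewrite coef_minus, EU by auto.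
    unfold P. rewrite coef_poly. destruct (Z_lt_dec _ 0); [lia|]. destruct (Z_lt_dec _ _); [|lia].
    rewrite Nat2Z.id. unfold a. rewrite <- Cmod_0. f_equal. ring.
  - intros M. eapply Rle_trans; [|apply (HXs M)]. right. apply rsum_ext. intros i _. f_equal.
    unfold q. rewrite coef_minus, EU by auto.
    unfold P. rewrite coef_poly. destruct (Z_lt_dec _ 0); [|lia].
    replace (0 - 1 - Z.of_nat i - zn)%Z with (- Z.of_nat (S (n + i)))%Z by (unfold zn; lia).
    rewrite fourier_opp, <- (Cmod_conj (fourier U _)) by auto. f_equal. ring.
Qed.

(** One factor [sqrt rho ^ j] absorbs the polynomial weight, through [(j s)^k / k! <= e^(js)] with
    [e^(-s) = sqrt rho]; the other one remains as a convergent geometric series. *)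
Lemma geometric_poly_sum rho k : 0 < rho < 1 ->
  exists D, 0 <= D /\ forall n, rsum (fun j => INR (S j) ^ k * rho ^ j) n <= D.
Proof.
  intros Hr. set (sg := sqrt rho).
  assert (Es : sg * sg = rho) by (apply sqrt_sqrt; lra).
  assert (S0 : 0 < sg) by (apply sqrt_lt_R0; lra).
  assert (S1 : sg < 1) by nra.
  assert (Hl : ln sg < 0) by (rewrite <- ln_1; apply ln_increasing; lra).
  set (s := - ln sg). assert (Hs : 0 < s) by (unfold s; lra).
  assert (Esg : exp (- s) = sg) by (unfold s; rewrite Ropp_involutive; now apply exp_ln).
  pose proof (INR_fact_lt_0 k) as Hf. assert (Hsk : 0 < s ^ k) by now apply pow_lt.
  set (D := INR (fact k) / s ^ k / sg).
  assert (HD : 0 <= D) by (unfold D; repeat apply Rdiv_le_0_compat; lra).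
  exists (D * / (1 - sg)). split.
  { apply Rmult_le_pos; auto. left. apply Rinv_0_lt_compat. lra. }
  assert (Hterm : forall j, INR (S j) ^ k * rho ^ j <= D * sg ^ j).
  { intros j. assert (Hj : 0 < INR (S j)) by (apply lt_0_INR; lia).
    pose proof (pow_fact_le_exp (INR (S j) * s) k ltac:(nra)) as HE.
    rewrite Rpow_mult_distr in HE.
    assert (Eexp : exp (INR (S j) * s) * (sg * sg ^ j) = 1).
    { rewrite <- Esg. change (exp (- s) * exp (- s) ^ j) with (exp (- s) ^ S j).
      assert (P : forall i, exp (- s) ^ i = exp (INR i * - s)).
      { induction i as [|i IH]; [simpl; now rewrite Rmult_0_l, exp_0|].
        rewrite S_INR, Rmult_plus_distr_r, exp_plus, <- IH, Rmult_1_l. simpl. ring. }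
      rewrite P, <- exp_plus, <- exp_0. f_equal. ring. }
    assert (Hsj : 0 < sg ^ j) by now apply pow_lt.
    apply Rmult_le_reg_r with (s ^ k / INR (fact k)); [now apply Rdiv_lt_0_compat|].
    replace (D * sg ^ j * (s ^ k / INR (fact k))) with (sg ^ j * (/ sg)) by (unfold D; field; lra).
    replace (INR (S j) ^ k * rho ^ j * (s ^ k / INR (fact k)))
      with ((INR (S j) ^ k * s ^ k / INR (fact k)) * (sg ^ j * sg ^ j)).
    2:{ rewrite <- Es, Rpow_mult_distr. field. lra. }
    apply Rle_trans with (exp (INR (S j) * s) * (sg ^ j * sg ^ j)).
    - apply Rmult_le_compat_r; auto. nra.
    - right. replace (exp (INR (S j) * s) * (sg ^ j * sg ^ j))
        with ((exp (INR (S j) * s) * (sg * sg ^ j)) * (sg ^ j * / sg)) by (field; lra).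
      rewrite Eexp. ring. }
  intros n. apply Rle_trans with (rsum (fun j => D * sg ^ j) n); [apply rsum_le; auto|].
  rewrite rsum_scal. apply Rmult_le_compat_l; auto.
  assert (G : rsum (fun j => sg ^ j) n = (1 - sg ^ n) * / (1 - sg)).
  { induction n as [|n IH]; simpl; [|rewrite IH]; field; lra. }
  apply Rle_trans with ((1 - sg ^ n) * / (1 - sg)); [right; exact G|].
  rewrite <- (Rmult_1_l (/ (1 - sg))) at 2.
  apply Rmult_le_compat_r; [left; apply Rinv_0_lt_compat; lra|].
  pose proof (pow_lt sg n S0). lra.
Qed.

(** Because [n <= (n - j + 1) (j + 1)], the factor [n^k] can be shared: [alpha] decays enough to
    absorb [(n - j + 1)^k], and [rho^j] absorbs [(j + 1)^k]. *)
Lemma poly_decay alpha A D k rho : 0 < rho < 1 -> (forall i, 0 <= alpha i) ->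
  (forall i, alpha i <= A) -> (forall N, rsum (fun i => (INR i ^ k * alpha i) ^ 2) N <= D) ->
  exists K, 0 <= K /\ forall n, (1 <= n)%nat ->
    rsum (fun j => alpha (n - j)%nat * rho ^ j) (S n) <= K / INR n ^ k.
Proof.
  intros Hr Ha HA HD. destruct (geometric_poly_sum rho k Hr) as [G [HG0 HG]].
  assert (A0 : 0 <= A) by (eapply Rle_trans; [apply (Ha 0%nat) | apply HA]).
  assert (D0 : 0 <= D) by (specialize (HD 0%nat); simpl in HD; lra).
  set (C2 := 2 ^ k * (D + 1 + A)).
  assert (HC2 : 0 <= C2) by (apply Rmult_le_pos; [apply pow_le|]; lra).
  assert (Hal : forall i, INR (S i) ^ k * alpha i <= C2).
  { intros i. assert (H1 : (INR i ^ k * alpha i) ^ 2 <= D).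
    { eapply Rle_trans; [|apply (HD (S i))].
      apply (rsum_term_le (fun i => (INR i ^ k * alpha i) ^ 2)); [intros; apply pow2_ge_0 | lia]. }
    assert (H2 : INR i ^ k * alpha i <= D + 1).
    { apply Rle_of_sqr_le; [lra|]. eapply Rle_trans; [apply H1|]. nra. }
    assert (H3 : INR (S i) ^ k <= 2 ^ k * (INR i ^ k + 1)).
    { rewrite S_INR, <- (pow1 k) at 1. replace (1 ^ k) with 1 by (now rewrite pow1).
      eapply Rle_trans; [apply pow_plus_le; [apply pos_INR | lra]|]. rewrite pow1. lra. }
    apply Rle_trans with (2 ^ k * (INR i ^ k + 1) * alpha i); [apply Rmult_le_compat_r; auto|].
    unfold C2. rewrite Rmult_assoc. apply Rmult_le_compat_l; [apply pow_le; lra|].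
    specialize (HA i). lra. }
  exists (C2 * G). split; [now apply Rmult_le_pos|]. intros n Hn.
  assert (Hn0 : 0 < INR n ^ k) by (apply pow_lt, lt_0_INR; lia).
  apply Rmult_le_reg_r with (INR n ^ k); auto.
  replace (C2 * G / INR n ^ k * INR n ^ k) with (C2 * G) by (field; lra).
  rewrite <- rsum_scal_r.
  apply Rle_trans with (rsum (fun j => C2 * (INR (S j) ^ k * rho ^ j)) (S n)).
  - apply rsum_le. intros j Hj.
    assert (H : INR n ^ k <= INR (S (n - j)) ^ k * INR (S j) ^ k).
    { rewrite <- Rpow_mult_distr. apply pow_incr. split; [apply pos_INR|].
      rewrite <- mult_INR. apply le_INR. nia. }
    assert (Hrj : 0 <= rho ^ j) by (apply pow_le; lra).
    assert (Hsj : 0 <= INR (S j) ^ k) by (apply pow_le, pos_INR).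
    apply Rle_trans with (alpha (n - j)%nat * rho ^ j * (INR (S (n - j)) ^ k * INR (S j) ^ k)).
    + apply Rmult_le_compat_l; auto. now apply Rmult_le_pos.
    + replace (alpha (n - j)%nat * rho ^ j * (INR (S (n - j)) ^ k * INR (S j) ^ k))
        with ((INR (S (n - j)) ^ k * alpha (n - j)%nat) * (INR (S j) ^ k * rho ^ j)) by ring.
      apply Rmult_le_compat_r; auto. now apply Rmult_le_pos.
  - rewrite rsum_scal. apply Rmult_le_compat_l; auto.
Qed.

Lemma fourier_shifted_abs_sum U L n N : Lipschitz L U -> periodic2pi U ->
  rsum (fun l => Cmod (fourier U (Z.of_nat l - Z.of_nat n))) N
  <= 2 * (L ^ 2 / 2 + 1) + Cmod (fourier U 0).
Proof.
  intros HL Hp. assert (HU : Rcont U) by now apply Rcont_Lipschitz with L.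
  apply Rle_trans with (rsum (fun l => Cmod (fourier U (Z.of_nat l - Z.of_nat n))) (n + (1 + N))).
  { apply rsum_mono; [intros; apply Cmod_ge_0 | lia]. }
  rewrite !rsum_add. cbn [rsum]. rewrite Nat.add_0_r, Z.sub_diag, Rplus_0_l.
  rewrite <- (rsum_rev (fun l => Cmod (fourier U (Z.of_nat l - Z.of_nat n))) n).
  rewrite (rsum_ext _ (fun i => Cmod (fourier U (Z.of_nat (S i)))) n).
  2:{ intros i Hi. replace (Z.of_nat (n - 1 - i) - Z.of_nat n)%Z with (- Z.of_nat (S i))%Z by lia.
      now rewrite fourier_opp, Cmod_conj by auto. }
  rewrite (rsum_ext _ (fun i => Cmod (fourier U (Z.of_nat (S i)))) N).
  2:{ intros i Hi. do 2 f_equal. lia. }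
  pose proof (fourier_abs_sum U L n HL Hp). pose proof (fourier_abs_sum U L N HL Hp). lra.
Qed.

(** An [l^1] bound on coefficients bounds the error everywhere on the closed disc. Replacing the
    convolution by a product of two partial sums costs [d], as small as desired; [tau * X] is the
    genuine error. *)
Lemma quotient_in_disc alpha tau A f g F G U W BU n X (z : C) :
  (forall i, Cmod (f i) <= alpha i) -> (forall n, rsum alpha n <= A) -> 0 <= tau ->
  (forall N, 4 * rsum (fun i => (INR i * alpha i) ^ 2) N <= tau ^ 2) ->
  unif_series 1 f F -> unif_series 1 g G -> Rcont U ->
  (forall t, (RtoC (U t) * F t)%C = (RtoC W * Cconj (G t))%C) -> 0 <= X ->
  (forall M, rsum (fun m => Cmod (fourier U (Z.of_nat (S (n + m)))) ^ 2) M <= X ^ 2) ->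
  (forall N, rsum (fun l => Cmod (fourier U (Z.of_nat l - Z.of_nat n))) N <= BU) ->
  Cmod z <= 1 ->
  forall d, 0 < d -> exists N0, forall N, (N0 <= N)%nat ->
    Cmod (RtoC W * csum (fun l => Cconj (g (n - l)%nat) * z ^ l) (S n)
          - csum (fun i => f i * z ^ i) N
            * csum (fun l => fourier U (Z.of_nat l - Z.of_nat n) * z ^ l) N)%C <= d + tau * X.
Proof.
  intros Hf HA Htau HT UF UG HU HUF HX HXs HBU Hz d Hd.
  set (a := fun l : nat => fourier U (Z.of_nat l - Z.of_nat n)).
  assert (Ha : forall i, 0 <= alpha i) by (intros i; eapply Rle_trans; [apply Cmod_ge_0 | apply Hf]).
  destruct (rsum_prod_defect alpha (fun l => Cmod (a l)) A BU Ha (fun _ => Cmod_ge_0 _) HA HBU d Hd) as [h Hh].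
  exists (S n + 2 * h)%nat. intros N HN.
  set (conv := csum (fun l => csum (fun i => (f i * z ^ i) * (a (l - i)%nat * z ^ (l - i)))%C (S l)) N).
  set (g' := fun l => if Nat.leb l n then Cconj (g (n - l)%nat) else 0%R).
  assert (E1 : (RtoC W * csum (fun l => Cconj (g (n - l)%nat) * z ^ l) (S n))%C
               = csum (fun l => RtoC W * g' l * z ^ l)%C N).
  { replace N with (S n + (N - S n))%nat by lia. rewrite csum_add.
    rewrite (csum_ext (fun i => RtoC W * g' (S n + i)%nat * z ^ (S n + i))%C (fun _ => RtoC 0)), csum_zero, Cplus_0_r.
    - rewrite <- csum_scal. apply csum_ext. intros l Hl. unfold g'.
      destruct (Nat.leb_spec l n); [ring | lia].
    - intros i _. unfold g'. destruct (Nat.leb_spec (S n + i) n); [lia | ring]. }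
  assert (H1 : Cmod (csum (fun l => RtoC W * g' l * z ^ l)%C N - conv) <= tau * X).
  { rewrite Cmod_minus_sym. unfold conv. rewrite <- csum_minus.
    eapply Rle_trans; [|apply (coef_quotient_truncation alpha tau A f g F G U W n N X); auto].
    apply Cmod_csum_le. intros l Hl.
    replace (csum (fun i => (f i * z ^ i) * (a (l - i)%nat * z ^ (l - i)))%C (S l))
      with (csum (fun i => f i * a (l - i)%nat)%C (S l) * z ^ l)%C.
    - replace (csum (fun i => f i * a (l - i)%nat)%C (S l) * z ^ l - RtoC W * g' l * z ^ l)%C
        with ((csum (fun i => f i * a (l - i)%nat)%C (S l) - RtoC W * g' l) * z ^ l)%C by ring.
      apply Cmod_mult_pow_le; auto. apply Rle_refl.
    - rewrite <- csum_scal_r. apply csum_ext. intros i Hi.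
      replace l with (i + (l - i))%nat at 2 by lia. rewrite Cpow_add_r. ring. }
  assert (H2 : Cmod (conv - csum (fun i => f i * z ^ i)%C N * csum (fun l => a l * z ^ l)%C N) <= d).
  { rewrite Cmod_minus_sym. unfold conv.
    eapply Rle_trans; [apply (cauchy_product_defect (fun i => f i * z ^ i)%C (fun l => a l * z ^ l)%C
      alpha (fun l => Cmod (a l)) N N)|].
    - intros i. now apply Cmod_mult_pow_le.
    - intros i. apply Cmod_mult_pow_le; auto. apply Rle_refl.
    - lia.
    - eapply Rle_trans; [apply (triangle_defect_le alpha (fun l => Cmod (a l)) h N N)|]; auto; try lia.
      + intros; apply Cmod_ge_0.
      + apply Hh. lia. }
  rewrite E1, Rplus_comm. eapply Rle_trans; [apply (Cmod_minus_triangle _ conv)|].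
  apply Rplus_le_compat; [exact H1 | exact H2].
Qed.

Lemma unif_series_expcoef b beta A : (forall i, Cmod (b i) <= beta i) -> (forall n, rsum beta n <= A) ->
  unif_series 1 (expcoef b) (fun t => Cexp (pser b (eit t))).
Proof.
  intros Hb HA d Hd. destruct (expcoef_pser b beta A Hb HA d Hd) as [N HN].
  exists N. intros n Hn t. specialize (HN n Hn (eit t) ltac:(rewrite Cmod_eit; lra)).
  rewrite Cmod_minus_sym in HN.
  rewrite (csum_ext _ (fun j => expcoef b j * eit t ^ j)%C); auto.
  intros j _. now rewrite eit_pow, INR_IZR_INZ, Z.mul_1_l.
Qed.

Lemma Cmod_Cexp_le z x : Cmod z <= x -> Cmod (Cexp z) <= exp x.
Proof.
  intros H. rewrite Cmod_Cexp. apply exp_le_compat.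
  eapply Rle_trans; [apply Rle_abs|]. eapply Rle_trans; [apply re_le_Cmod | auto].
Qed.

Theorem theorem3p4 (k : nat) (V : R -> R) :
  (1 <= k)%nat -> periodic2pi V -> C_lip k V ->
  forall rho : R, 0 < rho < 1 ->
  exists Km Kp : R, 0 < Km /\ 0 < Kp /\
  exists N : nat, forall n : nat, (N <= n)%nat ->
  forall c : nat -> C, monic_OP (fun t => exp (- V t)) n c ->
  (forall r t : R, rho < r < 1 ->
     let z := ((r : C) * eit t)%C in
     Cmod (polyC c n z
           - z ^ n * Cexp (- (fourier V 0%Z) - Cconj (Nfun V (/ Cconj z)))
               * Cexp (Eext k V r t))%C
     <= Km * ln (INR n) / INR n ^ k) /\
  (forall z : C, Cmod z < rho -> Cmod (polyC c n z) <= Kp / INR n ^ k).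
Proof.
  intros Hk Hper HCl rho Hrho.
  set (m := (k - 1)%nat). assert (Ek : k = S m) by (unfold m; lia).
  destruct (C_lip_tower k V Hper HCl) as [Tv Hv]. fold m in Tv, Hv.
  set (v := Derive_n V) in *.
  set (u := expT v m).
  assert (Tu : tower m u) by now apply expT_tower.
  assert (Pu : forall p, (p <= m)%nat -> periodic2pi (u p))
    by (intros p Hp; apply expT_periodic; auto; intros; apply Hv; auto).
  assert (Bu : forall p, (p <= m)%nat -> bddLip (u p))
    by (intros p Hp; apply expT_bddLip; auto; intros; apply Hv; auto).
  assert (Pv : forall p, (p <= m)%nat -> periodic2pi (v p)) by (intros; now apply Hv).
  assert (Bv : forall p, (p <= m)%nat -> bddLip (v p)) by (intros; now apply Hv).
  set (U := fun x => exp (V x)).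
  assert (Eu : u 0%nat = U) by apply expT_0.
  destruct (Bv 0%nat ltac:(lia)) as [B0 [_ LV]]. change (v 0%nat) with V in LV.
  destruct (Bv m (Nat.le_refl m)) as [Bm [_ Lvm]].
  destruct (Bu 0%nat ltac:(lia)) as [BU0 [_ LU0]]. rewrite Eu in LU0.
  destruct (Bu m (Nat.le_refl m)) as [LU [_ LUm]].
  assert (PU : periodic2pi U) by (rewrite <- Eu; apply Pu; lia).
  assert (CV : Rcont V) by now apply Rcont_Lipschitz with B0.
  assert (CU : Rcont U) by now apply Rcont_Lipschitz with BU0.
  assert (HLU : 0 <= LU) by now apply (Lipschitz_const_nonneg LU (u m)).
  set (b := fun j => fourier V (Z.of_nat (S j))). set (beta := fun j => Cmod (b j)).
  set (A0 := B0 ^ 2 / 2 + 1).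
  assert (Hbeta : forall i, 0 <= beta i) by (intros; apply Cmod_ge_0).
  assert (HA0 : forall n, rsum beta n <= A0) by (intros n; exact (fourier_abs_sum V B0 n LV Hper)).
  set (A := exp A0).
  set (al := rexpcoef beta).
  assert (Hal0 : forall i, 0 <= al i) by now apply rexpcoef_nonneg.
  assert (HalA : forall n, rsum al n <= A).
  { intros n. eapply Rle_trans; [now apply rsum_rexpcoef_le|]. now apply exp_le_compat. }
  assert (HSob : forall n, rsum (fun i => (INR (S i) ^ k * beta i) ^ 2) n <= Bm ^ 2).
  { intros n. rewrite Ek. apply (fourier_sobolev m v Bm n); auto. intros; now apply bddLip_Rcont, Bv. }
  destruct (rexpcoef_sobolev beta A0 (Bm ^ 2) k Hbeta HA0 HSob 1%nat Hk) as [D1 HD1].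
  destruct (rexpcoef_sobolev beta A0 (Bm ^ 2) k Hbeta HA0 HSob k (Nat.le_refl k)) as [Dk HDk].
  fold al in HD1, HDk.
  assert (D10 : 0 <= D1) by (specialize (HD1 0%nat); simpl in HD1; lra).
  set (tau := sqrt (4 * D1)). assert (Htau : 0 <= tau) by apply sqrt_pos.
  assert (HT : forall N, 4 * rsum (fun i => (INR i * al i) ^ 2) N <= tau ^ 2).
  { intros N. unfold tau. rewrite <- Rsqr_pow2, Rsqr_sqrt by lra. apply Rmult_le_compat_l; [lra|].
    eapply Rle_trans; [|apply (HD1 N)]. right. apply rsum_ext. intros i _. now rewrite pow_1. }
  set (nb := fun i => (- b i)%C).
  assert (Hnb : forall i, Cmod (nb i) <= beta i) by (intros i; unfold nb; rewrite Cmod_opp; apply Rle_refl).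
  assert (Hb : forall i, Cmod (b i) <= beta i) by (intros; apply Rle_refl).
  set (f := expcoef nb). set (g := expcoef b).
  assert (Hf : forall i, Cmod (f i) <= al i) by now apply Cmod_expcoef_le.
  assert (Hg : forall i, Cmod (g i) <= al i) by now apply Cmod_expcoef_le.
  set (F := fun t => Cexp (pser nb (eit t))). set (G := fun t => Cexp (pser b (eit t))).
  assert (UF : unif_series 1 f F) by now apply (unif_series_expcoef nb beta A0).
  assert (UG : unif_series 1 g G) by now apply (unif_series_expcoef b beta A0).
  assert (Eopp : forall z, pser nb z = (- pser b z)%C) by (intros; apply pser_opp).
  assert (HFG : forall t, (F t * G t)%C = 1%R).
  { intros t. unfold F, G. rewrite Eopp, <- Cexp_plus, <- Cexp_0. f_equal. ring. }
  assert (Hpser : forall h z, (forall i, Cmod (h i) <= beta i) -> Cmod z <= 1 -> Cmod (pser h z) <= A0).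
  { intros h z Hh Hz. apply Cmod_CSeries_le with beta; auto. intros i. now apply Cmod_mult_pow_le. }
  assert (BF : forall t, Cmod (F t) <= A).
  { intros t. apply Cmod_Cexp_le, Hpser; auto. rewrite Cmod_eit; lra. }
  assert (BG : forall t, Cmod (G t) <= A).
  { intros t. apply Cmod_Cexp_le, Hpser; auto. rewrite Cmod_eit; lra. }
  set (V0 := Re (fourier V 0)).
  (* The source of both factorizations on the circle, [exp (- V) = |F|^2 / W] and
     [exp V = W |G|^2]. *)
  assert (EV : forall t, V t = V0 + 2 * Re (pser b (eit t)))
    by (intros t; exact (fourier_inversion V B0 t LV Hper)).
  set (W := exp V0). assert (HW : 0 < W) by apply exp_pos.
  assert (Hconj2 : forall q, (q + Cconj q)%C = RtoC (2 * Re q)).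
  { intros q. destruct q; unfold Cconj, Cplus, RtoC; simpl; f_equal; ring. }
  assert (Hw : forall t, RtoC (exp (- V t)) = (RtoC (/ W) * (F t * Cconj (F t)))%C).
  { intros t. unfold F. rewrite Cexp_conj, <- Cexp_plus, Hconj2, Eopp, Cexp_RtoC, <- RtoC_mult.
    f_equal. unfold W. rewrite <- exp_Ropp, <- exp_plus. f_equal. rewrite EV, re_opp. ring. }
  assert (HUF : forall t, (RtoC (U t) * F t)%C = (RtoC W * Cconj (G t))%C).
  { intros t. unfold U, F, G. rewrite Cexp_conj, Eopp.
    assert (E : RtoC (exp (V t)) = (RtoC W * (Cexp (pser b (eit t)) * Cexp (Cconj (pser b (eit t)))))%C).
    { rewrite <- Cexp_plus, Hconj2, Cexp_RtoC, <- RtoC_mult. unfold W. rewrite <- exp_plus. now rewrite <- EV. }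
    rewrite E.
    assert (E2 : (Cexp (pser b (eit t)) * Cexp (- pser b (eit t)))%C = 1%R).
    { rewrite <- Cexp_plus, <- Cexp_0. f_equal. ring. }
    replace (RtoC W * (Cexp (pser b (eit t)) * Cexp (Cconj (pser b (eit t)))) * Cexp (- pser b (eit t)))%C
      with (RtoC W * Cexp (Cconj (pser b (eit t))) * (Cexp (pser b (eit t)) * Cexp (- pser b (eit t))))%C by ring.
    rewrite E2. ring. }
  set (K1 := (A * A + 1) * tau * A ^ 3 * sqrt (2 * Dk + 2)).
  assert (HA1 : 0 < A) by apply exp_pos.
  assert (HK1 : 0 <= K1).
  { unfold K1. repeat apply Rmult_le_pos; auto; try apply sqrt_pos; try nra; apply pow_le; lra. }
  assert (Hcoef : forall n c, (1 <= n)%nat -> monic_OP (fun t => exp (- V t)) n c ->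
    rsum (fun j => Cmod (c j - Cconj (g (n - j)%nat))) n <= K1 / INR n ^ k).
  { intros n c Hn Hc.
    apply (orthogonal_coefficients al tau A Dk k f g F G (fun t => exp (- V t)) (/ W)); auto.
    now apply Rinv_0_lt_compat. }
  assert (Hpoly : forall n c (z : C), (1 <= n)%nat -> monic_OP (fun t => exp (- V t)) n c -> Cmod z <= 1 ->
    Cmod (polyC c n z - csum (fun l => Cconj (g (n - l)%nat) * z ^ l)%C (S n)) <= K1 / INR n ^ k).
  { intros n c z Hn Hc Hz. eapply Rle_trans; [|apply (Hcoef n c Hn Hc)].
    unfold polyC. rewrite sum_n_csum, <- csum_minus. cbn [csum].
    destruct Hc as [Hcn _]. rewrite Nat.sub_diag, Hcn. change (g 0%nat) with (RtoC 1). rewrite Cconj_1.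
    replace (_ + (1%R * z ^ n - 1%R * z ^ n))%C with
      (csum (fun i => c i * z ^ i - Cconj (g (n - i)%nat) * z ^ i)%C n) by ring.
    apply Cmod_csum_le. intros i _.
    replace (c i * z ^ i - Cconj (g (n - i)%nat) * z ^ i)%C with ((c i - Cconj (g (n - i)%nat)) * z ^ i)%C by ring.
    apply Cmod_mult_pow_le; auto. apply Rle_refl. }
  assert (HalA' : forall i, al i <= A).
  { intros i. eapply Rle_trans; [|apply (HalA (S i))]. apply rsum_term_le; auto. }
  destruct (poly_decay al A Dk k rho Hrho Hal0 HalA' HDk) as [K2 [HK2 Hdecay]].
  set (s0 := - ln rho).
  assert (Hs0 : 0 <= s0).
  { unfold s0. assert (ln rho < 0) by (rewrite <- ln_1; apply ln_increasing; lra). lra. }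
  destruct (jet_exp m v s0 Hs0 Bv) as [DJ [HDJ HJ]].
  destruct (jet_bounded m v s0 Hs0 (bounded_upto_of_bddLip m v Bv)) as [DV [HDV HJV]].
  set (KD := 2 * (4 + 12 * (INR k + 1)) * (14 * LU)).
  assert (HKD : 0 <= KD).
  { unfold KD. pose proof (pos_INR k). apply Rmult_le_pos; lra. }
  (* In order: the error of the coefficients, the leak in the quotient, the extension of [U], and
     the exchange of exponential and jet. The factors 2 convert [n^-k] into [ln n / n^k], as
     [ln n >= 1/2]; the 1 ensures positivity. *)
  set (Km := 2 * K1 + 2 * (/ W * (tau * LU)) + / W * (A * KD) + 2 * (/ W * (A * (DJ * INR (fact k)))) + 1).
  assert (HWi : 0 < / W) by now apply Rinv_0_lt_compat.
  assert (Hp1 : 0 <= / W * (tau * LU)) by (repeat apply Rmult_le_pos; lra).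
  assert (Hp2 : 0 <= / W * (A * KD)) by (apply Rmult_le_pos; [lra | apply Rmult_le_pos; lra]).
  assert (Hp3 : 0 <= / W * (A * (DJ * INR (fact k)))).
  { repeat apply Rmult_le_pos; try lra. apply pos_INR. }
  exists Km, (K1 + K2 + 1).
  split; [unfold Km; lra|]. split; [lra|].
  exists 2%nat. intros n Hn c Hc.
  assert (Hn2 : 2 <= INR n) by (apply (le_INR 2); auto).
  assert (Hnk : 0 < INR n ^ k) by (apply pow_lt; lra).
  split.
  - intros r t Hr z.
    set (s := - ln r).
    assert (Hs : 0 <= s <= s0).
    { unfold s, s0. assert (ln r < 0) by (rewrite <- ln_1; apply ln_increasing; lra).
      assert (ln rho < ln r) by (apply ln_increasing; lra). lra. }
    assert (Er : r = exp (- s)) by (unfold s; rewrite Ropp_involutive; symmetry; apply exp_ln; lra).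
    assert (Ez : z = (RtoC (exp (- s)) * eit t)%C) by (unfold z; now rewrite <- Er).
    assert (Hzr : Cmod z = r) by (unfold z; rewrite Cmod_mult, Cmod_R, Cmod_eit, Rabs_pos_eq; lra).
    assert (Hz1 : Cmod z <= 1) by lra.
    assert (Hz0 : z <> 0%R) by (intros E; rewrite E, Cmod_0 in Hzr; lra).
    set (Phi := Cexp (pser nb z)).
    set (jv := jet m v t s).
    replace (Cexp (- fourier V 0 - Cconj (Nfun V (/ Cconj z))))%C with (RtoC (/ W) * Phi)%C.
    2:{ rewrite Nfun_pser by auto. fold b.
        replace (- fourier V 0 - pser b z)%C with (RtoC (- V0) + pser nb z)%C.
        - rewrite Cexp_plus, Cexp_RtoC. unfold W. now rewrite <- exp_Ropp.
        - rewrite Eopp, (fourier_0_real V CV). fold V0. rewrite RtoC_opp. ring. }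
    rewrite Eext_jet. fold m v s jv.
    set (X := LU / INR n ^ k). assert (HX : 0 <= X) by (apply Rdiv_le_0_compat; auto).
    assert (HXs : forall M, rsum (fun i => Cmod (fourier U (Z.of_nat (S (n + i)))) ^ 2) M <= X ^ 2).
    { intros M. unfold X.
      replace ((LU / INR n ^ k) ^ 2) with (LU ^ 2 * / (INR n ^ k) ^ 2) by (field; lra).
      assert (Hnk2 : 0 < (INR n ^ k) ^ 2) by now apply pow_lt.
      apply Rmult_le_reg_r with ((INR n ^ k) ^ 2); auto.
      rewrite Rmult_assoc, Rinv_l, Rmult_1_r, <- rsum_scal_r by lra.
      eapply Rle_trans; [|apply (fourier_sobolev m u LU (n + M) Tu Pu (fun p Hp => bddLip_Rcont _ (Bu p Hp)) LUm)].
      rewrite Eu, rsum_add, <- Ek.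
      apply Rle_trans with (rsum (fun i => (INR (S (n + i)) ^ k * Cmod (fourier U (Z.of_nat (S (n + i))))) ^ 2) M).
      - apply rsum_le. intros i _. rewrite <- Rpow_mult_distr, Rmult_comm. apply pow_incr.
        assert (INR n ^ k <= INR (S (n + i)) ^ k) by (apply pow_incr; split; [lra | apply le_INR; lia]).
        split; [apply Rmult_le_pos; [lra | apply Cmod_ge_0]|].
        apply Rmult_le_compat_r; [apply Cmod_ge_0 | auto].
      - pose proof (rsum_nonneg (fun i => (INR (S i) ^ k * Cmod (fourier U (Z.of_nat (S i)))) ^ 2) n
          (fun _ _ => pow2_ge_0 _)). lra. }
    assert (Hzn : Cmod (z ^ n)%C = exp (- (INR n * s))).
    { rewrite Cmod_pow, Hzr, Er. clear. induction n as [|n IH].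
      - simpl. now rewrite Rmult_0_l, Ropp_0, exp_0.
      - rewrite S_INR. simpl pow. rewrite IH, <- exp_plus. f_equal. ring. }
    assert (Hzn1 : Cmod (z ^ n)%C <= 1).
    { rewrite Hzn, <- exp_0. apply exp_le_compat. nra. }
    assert (Hln : / 2 <= ln (INR n)).
    { pose proof ln_lt_2. assert (ln 2 <= ln (INR n)) by (apply ln_le; lra). lra. }
    (* A single slack for three limits: the quotient enters with factor 1, the Fourier sums of the
       jet with [A], and the truncation of [Phi] with [exp DV]. *)
    apply Rle_eps_plus with (/ W * (1 + A + exp DV)).
    { pose proof (exp_pos DV). apply Rmult_le_pos; lra. }
    intros d Hd.
    destruct (quotient_in_disc al tau A f g F G U W (2 * (BU0 ^ 2 / 2 + 1) + Cmod (fourier U 0)) n X z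
      Hf HalA Htau HT UF UG CU HUF HX HXs (fun N => fourier_shifted_abs_sum U BU0 n N LU0 PU) Hz1 d Hd) as [N1 Q1].
    destruct (expcoef_pser nb beta A0 Hnb HA0 d Hd) as [N2 Q2].
    destruct (jet_partial_cv m u t s Pu Bu d Hd) as [N3 Q3].
    set (M := (n + N1 + N2 + N3)%nat). set (N := (n + (1 + M))%nat).
    specialize (Q1 N ltac:(lia)). specialize (Q2 N ltac:(lia) z Hz1). specialize (Q3 M ltac:(lia)).
    pose proof (fourier_partial_sum_extension m u LU t s n M Tu Pu
      (fun p Hp => bddLip_Rcont _ (Bu p Hp)) LUm Hn ltac:(lia) (proj1 Hs)) as Q4.
    cbv zeta in Q4. rewrite <- Ez, Eu, <- Ek in Q4. fold N KD in Q4.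
    specialize (HJ t s Hs). fold u jv in HJ. specialize (HJV t s Hs). fold jv in HJV.
    set (p := csum (fun l => Cconj (g (n - l)%nat) * z ^ l)%C (S n)) in *.
    fold f in Q2. fold Phi in Q2.
    set (FN := csum (fun i => f i * z ^ i)%C N) in *.
    set (PN := csum (fun l => fourier U (Z.of_nat l - Z.of_nat n) * z ^ l)%C N) in *.
    set (JM := jet_partial m u t s M) in *. set (ju := jet m u t s) in *.
    assert (Q0 := Hpoly n c z ltac:(lia) Hc Hz1). fold p in Q0.
    assert (HFN : Cmod FN <= A).
    { eapply Rle_trans; [|apply (HalA N)]. apply Cmod_csum_le. intros i _. now apply Cmod_mult_pow_le. }
    assert (HEV : Cmod (Cexp jv) <= exp DV) by now apply Cmod_Cexp_le.
    assert (EW : (RtoC (/ W) * RtoC W)%C = 1%R) by (rewrite <- RtoC_mult, Rinv_l by lra; reflexivity).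
    (* Telescoping from the polynomial to the claimed expression through [p], then through [/ W]
       times [FN * PN], [FN * z^n * JM], [FN * z^n * ju] and [FN * z^n * Cexp jv]. *)
    replace (polyC c n z - z ^ n * (RtoC (/ W) * Phi) * Cexp jv)%C with
      ((polyC c n z - p) + RtoC (/ W) * ((RtoC W * p - FN * PN) + FN * (PN - z ^ n * JM)
         + FN * (z ^ n * (JM - ju)) + FN * (z ^ n * (ju - Cexp jv)) + (FN - Phi) * (z ^ n * Cexp jv)))%C.
    2:{ replace p with ((RtoC (/ W) * RtoC W) * p)%C at 1 by (rewrite EW; ring). ring. }
    assert (R2 : Cmod (FN * (PN - z ^ n * JM)) <= A * (KD * (ln (INR n) / INR n ^ k))).
    { rewrite Cmod_mult. apply Rmult_le_compat; auto using Cmod_ge_0. }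
    assert (R3 : Cmod (FN * (z ^ n * (JM - ju))) <= A * d).
    { rewrite !Cmod_mult. apply Rmult_le_compat; auto using Cmod_ge_0.
      - apply Rmult_le_pos; apply Cmod_ge_0.
      - rewrite <- (Rmult_1_l d). apply Rmult_le_compat; auto using Cmod_ge_0. }
    (* The exchange error is [DJ * s ^ k]; multiplied by [|z^n| = e^(-ns)] it is at most
       [DJ * k! / n^k], because [(n s)^k / k! <= e^(ns)]. *)
    assert (R4 : Cmod (FN * (z ^ n * (ju - Cexp jv))) <= A * (DJ * INR (fact k)) / INR n ^ k).
    { rewrite !Cmod_mult, Hzn.
      replace (A * (DJ * INR (fact k)) / INR n ^ k) with (A * (DJ * INR (fact k) / INR n ^ k)) by (field; lra).
      apply Rmult_le_compat; auto using Cmod_ge_0.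
      - apply Rmult_le_pos; [left; apply exp_pos | apply Cmod_ge_0].
      - rewrite <- Ek in HJ.
        apply Rle_trans with (exp (- (INR n * s)) * (DJ * s ^ k)).
        + apply Rmult_le_compat_l; auto. left; apply exp_pos.
        + pose proof (pow_fact_le_exp (INR n * s) k ltac:(nra)) as HE. rewrite Rpow_mult_distr in HE.
          pose proof (INR_fact_lt_0 k) as Hfk.
          assert (EE : exp (- (INR n * s)) * exp (INR n * s) = 1) by (rewrite <- exp_plus, <- exp_0; f_equal; ring).
          assert (HS : exp (- (INR n * s)) * (INR n ^ k * s ^ k / INR (fact k)) <= 1).
          { rewrite <- EE. apply Rmult_le_compat_l; auto. left; apply exp_pos. }
          replace (exp (- (INR n * s)) * (DJ * s ^ k)) with
            (DJ * INR (fact k) / INR n ^ k * (exp (- (INR n * s)) * (INR n ^ k * s ^ k / INR (fact k))))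
            by (field; lra).
          rewrite <- (Rmult_1_r (DJ * INR (fact k) / INR n ^ k)) at 2.
          apply Rmult_le_compat_l; auto. apply Rdiv_le_0_compat; auto. apply Rmult_le_pos; lra. }
    assert (R5 : Cmod ((FN - Phi) * (z ^ n * Cexp jv)) <= d * exp DV).
    { rewrite !Cmod_mult. apply Rmult_le_compat; auto using Cmod_ge_0.
      - apply Rmult_le_pos; apply Cmod_ge_0.
      - rewrite <- (Rmult_1_l (exp DV)). apply Rmult_le_compat; auto using Cmod_ge_0. }
    eapply Rle_trans; [apply Cmod_triangle|]. rewrite Cmod_mult, Cmod_R, Rabs_pos_eq by lra.
    assert (R6 : Cmod ((RtoC W * p - FN * PN) + FN * (PN - z ^ n * JM)
         + FN * (z ^ n * (JM - ju)) + FN * (z ^ n * (ju - Cexp jv)) + (FN - Phi) * (z ^ n * Cexp jv))%C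
       <= (d + tau * X) + A * (KD * (ln (INR n) / INR n ^ k)) + A * d
          + A * (DJ * INR (fact k)) / INR n ^ k + d * exp DV).
    { repeat (eapply Rle_trans; [apply Cmod_triangle|]; apply Rplus_le_compat; auto). }
    apply Rle_trans with (K1 / INR n ^ k + / W * ((d + tau * X) + A * (KD * (ln (INR n) / INR n ^ k)) + A * d
          + A * (DJ * INR (fact k)) / INR n ^ k + d * exp DV)).
    { apply Rplus_le_compat; auto. apply Rmult_le_compat_l; lra. }
    set (iv := / INR n ^ k). assert (Hiv : 0 < iv) by now apply Rinv_0_lt_compat.
    unfold Km, X, Rdiv. fold iv.
    assert (L1 : forall q, 0 <= q -> q * iv <= 2 * q * ln (INR n) * iv).
    { intros q Hq. apply Rmult_le_compat_r; [lra|]. nra. }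
    pose proof (L1 K1 HK1). pose proof (L1 _ Hp1). pose proof (L1 _ Hp3).
    assert (0 <= ln (INR n) * iv) by (apply Rmult_le_pos; lra).
    replace (/ W * (d + tau * (LU * iv) + A * (KD * (ln (INR n) * iv)) + A * d + A * (DJ * INR (fact k)) * iv + d * exp DV))
      with (/ W * (1 + A + exp DV) * d + / W * (tau * LU) * iv + / W * (A * KD) * (ln (INR n) * iv)
            + / W * (A * (DJ * INR (fact k))) * iv) by ring.
    lra.
  - intros z Hz.
    assert (Hz1 : Cmod z <= 1) by lra.
    set (p := csum (fun l => Cconj (g (n - l)%nat) * z ^ l)%C (S n)).
    assert (Q0 := Hpoly n c z ltac:(lia) Hc Hz1). fold p in Q0.
    assert (Qp : Cmod p <= K2 / INR n ^ k).
    { eapply Rle_trans; [|apply (Hdecay n ltac:(lia))]. apply Cmod_csum_le. intros l _.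
      rewrite Cmod_mult, Cmod_conj, Cmod_pow. apply Rmult_le_compat; auto using Cmod_ge_0.
      - apply pow_le, Cmod_ge_0.
      - apply pow_incr. split; [apply Cmod_ge_0 | lra]. }
    replace (polyC c n z) with ((polyC c n z - p) + p)%C by ring.
    eapply Rle_trans; [apply Cmod_triangle|].
    apply Rle_trans with (K1 / INR n ^ k + K2 / INR n ^ k); [lra|].
    unfold Rdiv. rewrite <- Rmult_plus_distr_r. apply Rmult_le_compat_r; [|lra].
    left; now apply Rinv_0_lt_compat.
Qed.
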